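(* Let $n\ge 0$ be an integer and $w\in\mathbb{C}$ with $\Re w>0$. Then $$\mathbf{S}_n(w)=-\zeta_H'(-n,w)+(-1)^{n+1}n!\,b_n(w)\,H_n,$$ where $\zeta_H'(s,w)=\frac{\partial}{\partial s}\zeta_H(s,w)$, $b_n(w)$ are the modified Bernoulli polynomials and $H_n$ is the $n$-th harmonic number ($H_0=0$).
   Context: Logarithms are principal branches. For an integer $n\ge 0$ and $\Re w>0$, the partial sum $\sum_{k=0}^{s-1}(k+w)^n\log(k+w)$ has, as the integer $s\to+\infty$, a unique asymptotic expansion in the family of functions $s^m\log s$ ($m\ge 0$) and $s^m$ ($m\in\mathbb{Z}$); $\mathbf{S}_n(w)$ is its constant term (coefficient of $s^0$). $\zeta_H(s,w)$ is the Hurwitz zeta function, $\zeta_H(s,w)=\sum_{k\ge 0}(k+w)^{-s}$ for $\Re s>1$, extended meromorphically to $s\in\mathbb{C}$ (holomorphic on $\mathbb{C}\setminus\{1\}$). The modified Bernoulli polynomials $b_k(w)$ are defined by $\dfrac{e^{-wt}}{1-e^{-t}}=\dfrac1t+\sum_{k=0}^{+\infty}b_k(w)t^k$. *)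

(* Defs.v *)
From Stdlib Require Import Reals ZArith ClassicalEpsilon.
From Coquelicot Require Import Coquelicot.

Local Open Scope R_scope.
Local Open Scope C_scope.

Definition Cexp (z : C) : C :=
  ((exp (Re z) * cos (Im z))%R, (exp (Re z) * sin (Im z))%R).

(* Principal argument, in (-PI, PI] for z <> 0. *)
Definition Carg (z : C) : R :=
  if Rle_dec 0 (Im z) then acos (Re z / Cmod z) else (- acos (Re z / Cmod z))%R.

Definition Clog (z : C) : C := (ln (Cmod z), Carg z).

Definition Cpower (z a : C) : C := Cexp (a * Clog z).

Definition C_differentiable (f : C -> C) (z : C) : Prop :=
  @ex_derive C_AbsRing C_NormedModule f z.

Definition meromorphic_at (f : C -> C) (z0 : C) : Prop :=
  exists (m : nat) (g : C -> C),
    @locally C_UniformSpace z0 (C_differentiable g) /\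
    @locally' C_UniformSpace z0 (fun z => f z = g z / (z - z0) ^ m).

(* [f] is asymptotic, as the integer [s] tends to infinity, to
     sum_(m >= 0) a m * s ^ m * log s  +  sum_(m in Z) b m * s ^ m,
   where only finitely many [a m], and [b m] with [m > 0], are nonzero: for
   every [N], the remainder after the terms of degree at least [-N] is
   o(s ^ (-N)).  In the second sum, [m] is the integer [j - N]. *)
Definition log_power_expansion (f : nat -> C) (a : nat -> C) (b : Z -> C) : Prop :=
  exists d : nat,
    (forall m : nat, (d < m)%nat -> a m = 0) /\
    (forall m : Z, (Z.of_nat d < m)%Z -> b m = 0) /\
    forall N : nat,
      @filterlim nat C_UniformSpace
        (fun s : nat =>
           RtoC (INR s ^ N) *
           (f s
            - @sum_n C_AbelianMonoid
                (fun m => a m * RtoC (INR s ^ m * ln (INR s))) d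
            - @sum_n C_AbelianMonoid
                (fun j => let m := (Z.of_nat j - Z.of_nat N)%Z in
                          b m * RtoC (powerRZ (INR s) m)) (d + N)))
        eventually (@locally C_UniformSpace (RtoC 0)).

Definition constant_term (f : nat -> C) : C :=
  epsilon (inhabits (RtoC 0))
    (fun c => exists (a : nat -> C) (b : Z -> C),
                log_power_expansion f a b /\ b 0%Z = c).

(* f 0 + ... + f (s - 1) *)
Fixpoint Csum (f : nat -> C) (s : nat) : C :=
  match s with
  | O => 0
  | S s' => Csum f s' + f s'
  end.

Definition reg_log_sum (n : nat) (w : C) : C :=
  constant_term
    (Csum (fun k => (RtoC (INR k) + w) ^ n * Clog (RtoC (INR k) + w))).

(* The value of [Z] at the pole 1 is left unspecified. *)
Definition is_hurwitz_zeta (w : C) (Z : C -> C) : Prop :=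
  (forall s : C, (1 < Re s)%R ->
     @is_series C_AbsRing C_NormedModule
       (fun k => Cpower (RtoC (INR k) + w) (- s)) (Z s)) /\
  (forall s : C, s <> RtoC 1 -> C_differentiable Z s) /\
  meromorphic_at Z (RtoC 1).

Definition hurwitz_zeta (s w : C) : C :=
  epsilon (inhabits (fun _ : C => RtoC 0)) (is_hurwitz_zeta w) s.

Definition is_modified_bernoulli (w : C) (b : nat -> C) : Prop :=
  @locally' C_UniformSpace (RtoC 0) (fun t : C =>
    @is_pseries C_AbsRing C_NormedModule b t
      (Cexp (- (w * t)) / (1 - Cexp (- t)) - 1 / t)).

Definition modified_bernoulli (k : nat) (w : C) : C :=
  epsilon (inhabits (fun _ : nat => RtoC 0)) (is_modified_bernoulli w) k.

Definition harmonic (n : nat) : R := sum_n_m (fun k => (/ INR k)%R) 1 n.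

(* Main.v *)
Require Import Defs.
From Stdlib Require Import Reals ZArith Factorial Lra Lia ClassicalEpsilon.
From Coquelicot Require Import Coquelicot.

(** Put [P_N(s, x) = x^(1-s)/(s-1) + sum_(k<N) b_k(w) (s)_k x^(-s-k)], where [(s)_k] is
    the rising factorial.  The identity [exp(-w t) = (1 - exp(-t)) (1/t + sum_k b_k t^k)],
    read with [t^m] replaced by [(s)_m x^(-m)], says that
    [P_N(s, x) - P_N(s, x+1) - (x+w)^(-s) = O(x^(-s-N-1))], locally uniformly in [s].
    Hence [sum_(k<x) (k+w)^(-s) + P_N(s, x)] converges locally uniformly for
    [Re s > - N], [s <> 1]; by Weierstrass' theorem the limit is the analytic continuation
    [zeta_H(s, w)], and by Cauchy's estimate the convergence, with its rate, survives
    differentiation in [s].  At [s = -n] this gives the expansion of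
    [sum_(k<x) (k+w)^n log(k+w)], whose constant term is
    [- zeta_H'(-n, w) + b_n(w) d/ds (s)_n] with
    [d/ds (s)_n = (-1)^(n+1) n! H_n] at [s = -n]. *)

(** The umbral rule is a Mellin transform: [1/Gamma(s)] times the integral of
    [t^(s-1) exp(-x t) f(t)] sends [t^m] to [(s)_m x^(-s-m)], [1/t] to [x^(1-s)/(s-1)], and
    multiplication by [exp(-a t)] to the shift from [x] to [x + a]. No such integral is formed: the
    rule survives as an identity between finite binomial sums with explicit Taylor remainders. The
    constant term, [zeta_H] and the [b_k] are all picked by [epsilon], so each needs both existence
    and uniqueness. For [zeta_H], uniqueness only asks that an entire function vanishing on
    [Re s > 1] be zero; a Gaussian weight and one rectangle settle this without power series. For
    the constant term, comparing [u(2n)] with [2^D u(n)] eliminates the top degree. The obstacle is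
    that an asymptotic bound at [s = -n] alone says nothing about the derivative in [s]. Hence all
    constants are uniform for bounded [s], and Goursat's theorem on rectangles is developed far
    enough to give Cauchy's estimate. The factor [s - 1] makes every approximant entire, so that the
    pole never interferes with the limit. *)

Local Open Scope C_scope.

(** * Complex derivatives *)

Definition is_C_derive (f : C -> C) (z l : C) : Prop :=
  @is_derive C_AbsRing C_NormedModule f z l.

Lemma locally_Cmod (z : C) (P : C -> Prop) :
  @locally C_UniformSpace z P <->
  exists d : R, (0 < d)%R /\ forall y : C, (Cmod (y - z) < d)%R -> P y.
Proof.
  split.
  - intros H. apply locally_C in H. destruct H as [d Hd].
    exists d. split; [apply cond_pos | exact Hd].
  - intros [d [Hd H]]. apply locally_C. exists (mkposreal d Hd). exact H.
Qed.

Lemma is_C_derive_eps (f : C -> C) (z l : C) :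
  is_C_derive f z l <->
  forall e : R, (0 < e)%R -> exists d : R, (0 < d)%R /\
    forall y, (Cmod (y - z) < d)%R ->
      (Cmod (f y - f z - (y - z) * l) <= e * Cmod (y - z))%R.
Proof.
  split.
  - intros [_ H] e He.
    specialize (H z (fun P HP => HP) (mkposreal e He)).
    apply (locally_C z) in H.
    apply (locally_Cmod z) in H. exact H.
  - intros H. split; [apply is_linear_scal_l|].
    intros x Hx.
    apply (is_filter_lim_locally_unique (V := AbsRing_NormedModule C_AbsRing)) in Hx.
    rewrite <- Hx.
    intros e. apply (locally_C z). apply (locally_Cmod z).
    exact (H e (cond_pos e)).
Qed.

(** The product and chain rules see [C] as a module over itself, whose balls differ from those of
    [C_NormedModule]. The neighbourhoods agree, so both notions have the same epsilon form. *)
Lemma is_C_derive_ring (f : C -> C) (z l : C) :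
  @is_derive C_AbsRing (AbsRing_NormedModule C_AbsRing) f z l <-> is_C_derive f z l.
Proof.
  rewrite is_C_derive_eps. split.
  - intros [_ H] e He.
    specialize (H z (fun P HP => HP) (mkposreal e He)).
    apply (locally_C z) in H.
    apply (locally_Cmod z) in H. exact H.
  - intros H. split; [apply is_linear_scal_l|].
    intros x Hx.
    apply (is_filter_lim_locally_unique (V := AbsRing_NormedModule C_AbsRing)) in Hx.
    rewrite <- Hx.
    intros e. apply (locally_C z). apply (locally_Cmod z).
    exact (H e (cond_pos e)).
Qed.

Lemma is_C_derive_const (a z : C) : is_C_derive (fun _ => a) z 0.
Proof. apply (is_derive_const (K := C_AbsRing) (V := C_NormedModule)). Qed.

Lemma is_C_derive_id (z : C) : is_C_derive (fun y => y) z 1.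
Proof. apply is_C_derive_ring. apply (is_derive_id (K := C_AbsRing)). Qed.

Lemma is_C_derive_plus (f g : C -> C) (z a b : C) :
  is_C_derive f z a -> is_C_derive g z b ->
  is_C_derive (fun y => f y + g y) z (a + b).
Proof. apply (is_derive_plus (K := C_AbsRing) (V := C_NormedModule)). Qed.

Lemma is_C_derive_minus (f g : C -> C) (z a b : C) :
  is_C_derive f z a -> is_C_derive g z b ->
  is_C_derive (fun y => f y - g y) z (a - b).
Proof. apply (is_derive_minus (K := C_AbsRing) (V := C_NormedModule)). Qed.

Lemma is_C_derive_opp (f : C -> C) (z a : C) :
  is_C_derive f z a -> is_C_derive (fun y => - f y) z (- a).
Proof. apply (is_derive_opp (K := C_AbsRing) (V := C_NormedModule)). Qed.

Lemma is_C_derive_mult (f g : C -> C) (z a b : C) :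
  is_C_derive f z a -> is_C_derive g z b ->
  is_C_derive (fun y => f y * g y) z (a * g z + f z * b).
Proof.
  intros Hf Hg. apply is_C_derive_ring.
  apply (is_derive_mult (K := C_AbsRing) f g z a b).
  - now apply is_C_derive_ring.
  - now apply is_C_derive_ring.
  - exact Cmult_comm.
Qed.

Lemma is_C_derive_comp (f g : C -> C) (z a b : C) :
  is_C_derive f (g z) a -> is_C_derive g z b ->
  is_C_derive (fun y => f (g y)) z (b * a).
Proof.
  intros Hf Hg.
  apply (is_derive_comp (K := C_AbsRing) (V := C_NormedModule) f g z a b Hf).
  now apply is_C_derive_ring.
Qed.

Lemma is_C_derive_ext_loc (f g : C -> C) (z l : C) :
  @locally C_UniformSpace z (fun y => f y = g y) ->
  is_C_derive f z l -> is_C_derive g z l.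
Proof.
  intros H. apply (is_derive_ext_loc (K := C_AbsRing) (V := C_NormedModule)).
  apply (locally_C z). exact H.
Qed.

Lemma is_C_derive_ext (f g : C -> C) (z l : C) :
  (forall y, f y = g y) -> is_C_derive f z l -> is_C_derive g z l.
Proof. apply (is_derive_ext (K := C_AbsRing) (V := C_NormedModule)). Qed.

Lemma C_derive_eq (f : C -> C) (z a b : C) :
  a = b -> is_C_derive f z a -> is_C_derive f z b.
Proof. intros ->. exact (fun H => H). Qed.

Lemma is_C_derive_inv (z : C) : z <> 0 -> is_C_derive (fun y => / y) z (- / (z * z)).
Proof.
  intros Hz. apply is_C_derive_eps. intros e He.
  assert (Hm : (0 < Cmod z)%R) by now apply Cmod_gt_0.
  set (m := Cmod z) in *.
  (* The error is [(y - z)^2 / (y z^2)]. Staying within [m / 2] of [z] gives [|y z^2| >= m^3 / 2],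
     and the second bound then absorbs one factor [|y - z|]. *)
  exists (Rmin (m / 2) (e * (m * m * m) / 2)).
  assert (0 < m * m * m)%R by (repeat apply Rmult_lt_0_compat; assumption).
  split.
  { apply Rmin_case; [lra|]. assert (0 < e * (m * m * m))%R by now apply Rmult_lt_0_compat. lra. }
  intros y Hy.
  assert (Hy1 := Rlt_le_trans _ _ _ Hy (Rmin_l _ _)).
  assert (Hy2 := Rlt_le_trans _ _ _ Hy (Rmin_r _ _)).
  assert (Hmy : (m / 2 <= Cmod y)%R).
  { assert (T := Cmod_triangle y (z - y)).
    replace (y + (z - y)) with z in T by ring.
    replace (z - y) with (- (y - z)) in T by ring. rewrite Cmod_opp in T. fold m in T. lra. }
  assert (Hy0 : y <> 0) by (apply Cmod_gt_0; lra).
  replace (/ y - / z - (y - z) * - / (z * z)) with ((y - z) * ((y - z) / (y * (z * z))))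
    by (field; split; assumption).
  rewrite Cmod_mult, Cmod_div by (repeat apply Cmult_neq_0; assumption).
  rewrite !Cmod_mult. fold m.
  rewrite Rmult_comm. apply Rmult_le_compat_r; [apply Cmod_ge_0|].
  apply Rle_div_l.
  - repeat apply Rmult_lt_0_compat; lra.
  - apply Rle_trans with (e * (m / 2 * (m * m)))%R; [lra|].
    apply Rmult_le_compat_l; [lra|]. apply Rmult_le_compat_r; [nra|lra].
Qed.

Lemma is_C_derive_continuous (f : C -> C) (z l : C) :
  is_C_derive f z l -> forall e : R, (0 < e)%R ->
  exists d : R, (0 < d)%R /\ forall y, (Cmod (y - z) < d)%R -> (Cmod (f y - f z) < e)%R.
Proof.
  intros H e He. rewrite is_C_derive_eps in H.
  destruct (H 1%R Rlt_0_1) as [d [Hd Hf]].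
  assert (Hl := Cmod_ge_0 l).
  exists (Rmin d (e / (2 + Cmod l))). split.
  - apply Rmin_case; [assumption|]. apply Rdiv_lt_0_compat; lra.
  - intros y Hy.
    assert (Hy1 := Rlt_le_trans _ _ _ Hy (Rmin_l _ _)).
    assert (Hy2 := Rlt_le_trans _ _ _ Hy (Rmin_r _ _)).
    specialize (Hf y Hy1).
    replace (f y - f z) with ((f y - f z - (y - z) * l) + (y - z) * l) by ring.
    eapply Rle_lt_trans; [apply Cmod_triangle|].
    rewrite Cmod_mult. apply Rlt_div_r in Hy2; [|lra].
    assert (H0 := Cmod_ge_0 (y - z)). nra.
Qed.

(** * Paths in the complex plane *)

(** Stated by coordinates so that real calculus applies to each one; [is_path_derive_eps] gives the
    form that composes with complex derivatives. *)
Definition is_path_derive (g : R -> C) (t : R) (l : C) : Prop :=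
  is_derive (fun u => Re (g u)) t (Re l) /\ is_derive (fun u => Im (g u)) t (Im l).

Lemma is_derive_eps (f : R -> R) (x l : R) :
  is_derive f x l <->
  forall e : R, (0 < e)%R -> exists d : R, (0 < d)%R /\
    forall y, (Rabs (y - x) < d)%R ->
      (Rabs (f y - f x - (y - x) * l) <= e * Rabs (y - x))%R.
Proof.
  split.
  - intros [_ H] e He.
    destruct (H x (fun P HP => HP) (mkposreal e He)) as [d Hd].
    exists d. split; [apply cond_pos|exact Hd].
  - intros H. split; [apply is_linear_scal_l|].
    intros y Hy.
    apply (is_filter_lim_locally_unique (V := AbsRing_NormedModule R_AbsRing)) in Hy.
    rewrite <- Hy.
    intros e. destruct (H e (cond_pos e)) as [d [Hd Hf]].
    exists (mkposreal d Hd). exact Hf.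
Qed.

Lemma im_le_Cmod (z : C) : (Rabs (Im z) <= Cmod z)%R.
Proof. eapply Rle_trans; [apply Rmax_r|apply Rmax_Cmod]. Qed.

Lemma Cmod_le_Re_Im (z : C) : (Cmod z <= Rabs (Re z) + Rabs (Im z))%R.
Proof.
  assert (E : z = RtoC (Re z) + Ci * RtoC (Im z)).
  { destruct z as [x y]. apply injective_projections; simpl; ring. }
  rewrite E at 1. eapply Rle_trans; [apply Cmod_triangle|].
  rewrite Cmod_mult, Cmod_Ci, !Cmod_R. lra.
Qed.

Lemma is_path_derive_eps (g : R -> C) (t : R) (l : C) :
  is_path_derive g t l <->
  forall e : R, (0 < e)%R -> exists d : R, (0 < d)%R /\
    forall u, (Rabs (u - t) < d)%R ->
      (Cmod (g u - g t - RtoC (u - t) * l) <= e * Rabs (u - t))%R.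
Proof.
  assert (ERe : forall u, Re (g u - g t - RtoC (u - t) * l) = (Re (g u) - Re (g t) - (u - t) * Re l)%R).
  { intros u. rewrite <- re_scal_l. reflexivity. }
  assert (EIm : forall u, Im (g u - g t - RtoC (u - t) * l) = (Im (g u) - Im (g t) - (u - t) * Im l)%R).
  { intros u. rewrite <- im_scal_l. reflexivity. }
  unfold is_path_derive. rewrite !is_derive_eps. split.
  - intros [H1 H2] e He.
    assert (He2 : (0 < e / 2)%R) by lra.
    destruct (H1 _ He2) as [d1 [Hd1 K1]]. destruct (H2 _ He2) as [d2 [Hd2 K2]].
    exists (Rmin d1 d2). split; [now apply Rmin_case|].
    intros u Hu.
    assert (Hu1 := K1 u (Rlt_le_trans _ _ _ Hu (Rmin_l _ _))).
    assert (Hu2 := K2 u (Rlt_le_trans _ _ _ Hu (Rmin_r _ _))).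
    eapply Rle_trans; [apply Cmod_le_Re_Im|]. rewrite ERe, EIm. lra.
  - intros H. split; intros e He; destruct (H e He) as [d [Hd K]]; exists d; split; trivial;
    intros u Hu; specialize (K u Hu).
    + rewrite <- ERe. eapply Rle_trans; [apply re_le_Cmod|exact K].
    + rewrite <- EIm. eapply Rle_trans; [apply im_le_Cmod|exact K].
Qed.

Lemma is_path_derive_line (a b : C) (t : R) :
  is_path_derive (fun u => a + RtoC u * b) t b.
Proof.
  apply is_path_derive_eps. intros e He. exists 1%R. split; [lra|]. intros u _.
  replace (a + RtoC u * b - (a + RtoC t * b) - RtoC (u - t) * b) with (RtoC 0).
  - rewrite Cmod_0. assert (H := Rabs_pos (u - t)). nra.
  - rewrite RtoC_minus. ring.
Qed.

Lemma is_path_derive_minus (g h : R -> C) (t : R) (a b : C) :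
  is_path_derive g t a -> is_path_derive h t b ->
  is_path_derive (fun u => g u - h u) t (a - b).
Proof.
  intros [H1 H2] [K1 K2]. split.
  - exact (is_derive_minus _ _ _ _ _ H1 K1).
  - exact (is_derive_minus _ _ _ _ _ H2 K2).
Qed.

Lemma is_path_derive_comp (f : C -> C) (g : R -> C) (t : R) (a b : C) :
  is_C_derive f (g t) a -> is_path_derive g t b ->
  is_path_derive (fun u => f (g u)) t (b * a).
Proof.
  rewrite is_C_derive_eps, !is_path_derive_eps. intros Hf Hg e He.
  assert (Hb := Cmod_ge_0 b). assert (Ha := Cmod_ge_0 a).
  (* The added 1 keeps both factors positive even when a derivative vanishes; it also pays for the
     inner linearization error, of size at most [|u - t|]. *)
  set (B := (Cmod b + 1)%R). set (A := (Cmod a + 1)%R).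
  assert (HB : (0 < B)%R) by (unfold B; lra).
  assert (HA : (0 < A)%R) by (unfold A; lra).
  destruct (Hf (e / (2 * B))%R) as [d1 [Hd1 K1]]; [apply Rdiv_lt_0_compat; lra|].
  destruct (Hg (Rmin 1 (e / (2 * A)))%R) as [d2 [Hd2 K2]].
  { apply Rmin_case; [lra|]. apply Rdiv_lt_0_compat; lra. }
  exists (Rmin d2 (d1 / B)). split.
  { apply Rmin_case; trivial. now apply Rdiv_lt_0_compat. }
  intros u Hu.
  assert (Hu1 := Rlt_le_trans _ _ _ Hu (Rmin_l _ _)).
  assert (Hu2 := Rlt_le_trans _ _ _ Hu (Rmin_r _ _)).
  specialize (K2 u Hu1).
  assert (Hr := Rabs_pos (u - t)). set (r := Rabs (u - t)) in *.
  assert (K3 : (Cmod (g u - g t - RtoC (u - t) * b) <= 1 * r)%R).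
  { eapply Rle_trans; [exact K2|]. apply Rmult_le_compat_r; [assumption|apply Rmin_l]. }
  assert (K4 : (Cmod (g u - g t - RtoC (u - t) * b) <= e / (2 * A) * r)%R).
  { eapply Rle_trans; [exact K2|]. apply Rmult_le_compat_r; [assumption|apply Rmin_r]. }
  assert (HG : (Cmod (g u - g t) <= B * r)%R).
  { replace (g u - g t) with ((g u - g t - RtoC (u - t) * b) + RtoC (u - t) * b) by ring.
    eapply Rle_trans; [apply Cmod_triangle|].
    rewrite Cmod_mult, Cmod_R. fold r. unfold B. lra. }
  assert (HGd : (Cmod (g u - g t) < d1)%R).
  { eapply Rle_lt_trans; [exact HG|]. apply Rlt_div_r in Hu2; [lra|assumption]. }
  specialize (K1 _ HGd).
  replace (f (g u) - f (g t) - RtoC (u - t) * (b * a)) with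
    ((f (g u) - f (g t) - (g u - g t) * a) + (g u - g t - RtoC (u - t) * b) * a) by ring.
  eapply Rle_trans; [apply Cmod_triangle|]. rewrite Cmod_mult.
  assert (E1 : (e / (2 * B) * Cmod (g u - g t) <= e / 2 * r)%R).
  { replace (e / 2 * r)%R with (e / (2 * B) * (B * r))%R by (field; lra).
    apply Rmult_le_compat_l; [|assumption]. apply Rlt_le, Rdiv_lt_0_compat; lra. }
  assert (E2 : (Cmod (g u - g t - RtoC (u - t) * b) * Cmod a <= e / 2 * r)%R).
  { replace (e / 2 * r)%R with ((e / (2 * A) * r) * A)%R by (field; lra).
    apply Rmult_le_compat; try apply Cmod_ge_0; [assumption|unfold A; lra]. }
  lra.
Qed.

(* Project on the direction of [g 1 - g 0] and use the real mean value inequality. *)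
Lemma path_mean_value (g dg : R -> C) (D : R) :
  (forall t, (0 <= t <= 1)%R -> is_path_derive g t (dg t) /\ (Cmod (dg t) <= D)%R) ->
  (Cmod (g 1%R - g 0%R) <= D)%R.
Proof.
  intros H.
  set (v := g 1%R - g 0%R).
  destruct (Req_dec (Cmod v) 0) as [Z|NZ].
  { rewrite Z. destruct (H 0%R) as [_ K]; [lra|]. assert (T := Cmod_ge_0 (dg 0%R)). lra. }
  assert (Hv : (0 < Cmod v)%R) by (assert (T := Cmod_ge_0 v); lra).
  set (h := fun t => (Re v * Re (g t) + Im v * Im (g t))%R).
  set (dh := fun t => (Re v * Re (dg t) + Im v * Im (dg t))%R).
  assert (Dh : forall t, (0 <= t <= 1)%R -> is_derive h t (dh t)).
  { intros t Ht. destruct (H t Ht) as [[D1 D2] _].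
    apply @is_derive_plus; apply @is_derive_scal; assumption. }
  destruct (MVT_gen h 0 1 dh) as [c [Hc Ec]].
  { intros t Ht. rewrite Rmin_left, Rmax_right in Ht by lra. apply Dh. lra. }
  { intros t Ht. rewrite Rmin_left, Rmax_right in Ht by lra.
    apply continuity_pt_filterlim, (ex_derive_continuous (V := R_NormedModule)).
    exists (dh t). now apply Dh. }
  rewrite Rmin_left, Rmax_right in Hc by lra. destruct (H c Hc) as [_ DB].
  assert (E1 : (h 1 - h 0 = Cmod v ^ 2)%R).
  { rewrite Cmod2_alt. unfold h, v, Cminus. simpl. unfold Re, Im. simpl. ring. }
  assert (E2 : (dh c <= Cmod v * D)%R).
  { replace (dh c) with (Re (Cconj v * dg c)) by (unfold dh, Cconj, Re, Im; simpl; ring).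
    eapply Rle_trans; [apply Rle_abs|]. eapply Rle_trans; [apply re_le_Cmod|].
    rewrite Cmod_mult, Cmod_conj. apply Rmult_le_compat_l; lra. }
  assert (E3 : (Cmod v * Cmod v <= Cmod v * D)%R) by (simpl in E1; lra).
  now apply Rmult_le_reg_l in E3.
Qed.

(** * The complex exponential *)

Lemma RtoC_inj_neq (x y : R) : x <> y -> RtoC x <> RtoC y.
Proof. intros H E. now apply H, RtoC_inj. Qed.

Lemma exp_le (x y : R) : (x <= y)%R -> (exp x <= exp y)%R.
Proof. intros [H| ->]; [now apply Rlt_le, exp_increasing|apply Rle_refl]. Qed.

Lemma Cexp_0 : Cexp 0 = 1.
Proof. unfold Cexp. simpl. rewrite exp_0, cos_0, sin_0. apply injective_projections; simpl; ring. Qed.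

Lemma Cexp_plus (a b : C) : Cexp (a + b) = Cexp a * Cexp b.
Proof.
  unfold Cexp, Re, Im. simpl. rewrite exp_plus, cos_plus, sin_plus.
  apply injective_projections; simpl; ring.
Qed.

Lemma Cexp_opp_l (z : C) : Cexp (- z) * Cexp z = 1.
Proof. rewrite <- Cexp_plus. replace (- z + z) with (RtoC 0) by ring. apply Cexp_0. Qed.

Lemma Cexp_neq_0 (z : C) : Cexp z <> 0.
Proof. intros H. assert (T := Cexp_opp_l z). rewrite H, Cmult_0_r in T. now apply C1_nz. Qed.

Lemma Cexp_opp (z : C) : Cexp (- z) = / Cexp z.
Proof.
  rewrite <- (Cmult_1_r (Cexp (- z))), <- (Cinv_r (Cexp z)) by apply Cexp_neq_0.
  rewrite Cmult_assoc, Cexp_opp_l. ring.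
Qed.

Lemma Cexp_INR (n : nat) (z : C) : Cexp (RtoC (INR n) * z) = Cexp z ^ n.
Proof.
  induction n as [|n IH].
  - simpl. rewrite Cmult_0_l. apply Cexp_0.
  - rewrite S_INR, RtoC_plus, Cmult_plus_distr_r, Cexp_plus, IH, Cmult_1_l, Cpow_S. ring.
Qed.

Lemma Cmod_Cexp (z : C) : Cmod (Cexp z) = exp (Re z).
Proof.
  assert (H : (Cmod (Cexp z) ^ 2 = exp (Re z) ^ 2)%R).
  { rewrite Cmod2_alt. unfold Cexp. simpl.
    assert (T := sin2_cos2 (Im z)). unfold Rsqr in T. nra. }
  assert (H1 := Cmod_ge_0 (Cexp z)). assert (H2 := exp_pos (Re z)).
  simpl in H. nra.
Qed.

Lemma Cmod_Cexp_le (z : C) : (Cmod (Cexp z) <= exp (Cmod z))%R.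
Proof.
  rewrite Cmod_Cexp. apply exp_le.
  eapply Rle_trans; [apply Rle_abs|apply re_le_Cmod].
Qed.

Lemma is_path_derive_Cexp (z : C) (t : R) :
  is_path_derive (fun u => Cexp (RtoC u * z)) t (z * Cexp (RtoC t * z)).
Proof.
  destruct z as [x y]. unfold is_path_derive, Cexp, Re, Im. simpl.
  split.
  - eapply is_derive_ext with (f := fun u : R => (exp (u * x) * cos (u * y))%R).
    { intros u. f_equal; f_equal; ring. }
    auto_derive; trivial.
    replace (t * x - 0 * y)%R with (t * x)%R by ring.
    replace (t * y + 0 * x)%R with (t * y)%R by ring. ring.
  - eapply is_derive_ext with (f := fun u : R => (exp (u * x) * sin (u * y))%R).
    { intros u. f_equal; f_equal; ring. }
    auto_derive; trivial.
    replace (t * x - 0 * y)%R with (t * x)%R by ring.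
    replace (t * y + 0 * x)%R with (t * y)%R by ring. ring.
Qed.

(** * Finite sums and the Taylor remainder of the exponential *)

Lemma Csum_ext (f g : nat -> C) (n : nat) :
  (forall k, (k < n)%nat -> f k = g k) -> Csum f n = Csum g n.
Proof.
  induction n as [|n IH]; intros H; simpl; trivial.
  rewrite IH, H; trivial; [lia|]. intros k Hk. apply H. lia.
Qed.

Lemma Csum_plus (f g : nat -> C) (n : nat) :
  Csum (fun k => f k + g k) n = Csum f n + Csum g n.
Proof. induction n as [|n IH]; simpl; [|rewrite IH]; ring. Qed.

Lemma Csum_minus (f g : nat -> C) (n : nat) :
  Csum (fun k => f k - g k) n = Csum f n - Csum g n.
Proof. induction n as [|n IH]; simpl; [|rewrite IH]; ring. Qed.

Lemma Csum_scal (a : C) (f : nat -> C) (n : nat) :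
  Csum (fun k => a * f k) n = a * Csum f n.
Proof. induction n as [|n IH]; simpl; [|rewrite IH]; ring. Qed.

Lemma Csum_S_l (f : nat -> C) (n : nat) :
  Csum f (S n) = f 0%nat + Csum (fun k => f (S k)) n.
Proof.
  induction n as [|n IH]; [simpl; ring|].
  change (Csum f (S (S n))) with (Csum f (S n) + f (S n)).
  rewrite IH. simpl. ring.
Qed.

(** The real majorant is summed by [Csum] as well and read off through [Re], so that one summation
    operator serves throughout. *)
Lemma Cmod_Csum_le (f : nat -> C) (g : nat -> R) (n : nat) :
  (forall k, (k < n)%nat -> (Cmod (f k) <= g k)%R) ->
  (Cmod (Csum f n) <= Re (Csum (fun k => RtoC (g k)) n))%R.
Proof.
  induction n as [|n IH]; intros H; simpl.
  - rewrite Cmod_0. lra.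
  - eapply Rle_trans; [apply Cmod_triangle|].
    apply Rplus_le_compat; [apply IH; intros k Hk|]; apply H; lia.
Qed.

Lemma is_C_derive_Csum (f df : nat -> C -> C) (n : nat) (z : C) :
  (forall k, (k < n)%nat -> is_C_derive (f k) z (df k z)) ->
  is_C_derive (fun y => Csum (fun k => f k y) n) z (Csum (fun k => df k z) n).
Proof.
  induction n as [|n IH]; intros H; simpl.
  - apply is_C_derive_const.
  - apply is_C_derive_plus; [apply IH; intros k Hk|]; apply H; lia.
Qed.

Lemma is_C_derive_pow (n : nat) (z : C) :
  is_C_derive (fun y => y ^ (S n)) z (RtoC (INR (S n)) * z ^ n).
Proof.
  induction n as [|n IH].
  - eapply is_C_derive_ext; [|eapply C_derive_eq; [|apply is_C_derive_id]].
    + intros y. simpl. ring.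
    + simpl. ring.
  - eapply is_C_derive_ext; [|eapply C_derive_eq; [|apply is_C_derive_mult; [apply is_C_derive_id|exact IH]]].
    + intros y. simpl. ring.
    + rewrite (S_INR (S n)), RtoC_plus, Cpow_S. ring.
Qed.

Definition Cexp_rem (M : nat) (z : C) : C :=
  Cexp z - Csum (fun m => z ^ m / RtoC (INR (fact m))) M.

Lemma RtoC_fact_neq_0 (m : nat) : RtoC (INR (fact m)) <> 0.
Proof. intros H. apply RtoC_inj in H. now apply (INR_fact_neq_0 m). Qed.

Lemma RtoC_fact_S (m : nat) : RtoC (INR (fact (S m))) = RtoC (INR (S m)) * RtoC (INR (fact m)).
Proof. rewrite fact_simpl, mult_INR, RtoC_mult. reflexivity. Qed.

Lemma RtoC_S_neq_0 (m : nat) : RtoC (INR (S m)) <> 0.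
Proof. intros H. apply RtoC_inj in H. revert H. now apply not_0_INR. Qed.

Lemma is_C_derive_Cexp_sum (M : nat) (z : C) :
  is_C_derive (fun y => Csum (fun m => y ^ m / RtoC (INR (fact m))) (S M)) z
    (Csum (fun m => z ^ m / RtoC (INR (fact m))) M).
Proof.
  eapply is_C_derive_ext; [intros y; symmetry; apply Csum_S_l|].
  eapply C_derive_eq; [|apply is_C_derive_plus; [apply (is_C_derive_const (1 / RtoC (INR (fact 0))))|]].
  2:{ apply (is_C_derive_Csum (fun k y => y ^ S k / RtoC (INR (fact (S k))))
             (fun k y => y ^ k / RtoC (INR (fact k)))).
      intros k _. eapply C_derive_eq; [|apply is_C_derive_mult; [apply is_C_derive_pow|apply is_C_derive_const]].
      rewrite RtoC_fact_S. field. split; [apply RtoC_fact_neq_0|apply RtoC_S_neq_0]. }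
  ring.
Qed.

Lemma Cmod_scal_le (t : R) (z : C) : (0 <= t <= 1)%R -> (Cmod (RtoC t * z) <= Cmod z)%R.
Proof.
  intros Ht. rewrite Cmod_mult, Cmod_R, Rabs_pos_eq by lra.
  assert (H := Cmod_ge_0 z). nra.
Qed.

(** Along the segment from 0 to [z], the remainder of order [M + 1] starts at 0 and has velocity [z]
    times the remainder of order [M]. The mean value inequality then gives the induction step; the
    usual factor [1 / M!] is given up. *)
Lemma Cmod_Cexp_rem (M : nat) (z : C) :
  (Cmod (Cexp_rem M z) <= Cmod z ^ M * exp (Cmod z))%R.
Proof.
  revert z. induction M as [|M IH]; intros z.
  - unfold Cexp_rem. simpl. replace (Cexp z - 0) with (Cexp z) by ring.
    rewrite Rmult_1_l. apply Cmod_Cexp_le.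
  - replace (Cexp_rem (S M) z) with
      (Cexp_rem (S M) (RtoC 1 * z) - Cexp_rem (S M) (RtoC 0 * z)).
    2:{ rewrite Cmult_1_l, Cmult_0_l.
        replace (Cexp_rem (S M) 0) with (RtoC 0); [ring|].
        unfold Cexp_rem. rewrite Csum_S_l, Cexp_0.
        rewrite (Csum_ext _ (fun k => 0 * 0)).
        - rewrite Csum_scal. simpl. field.
        - intros k _. simpl. unfold Cdiv. rewrite !Cmult_0_l. reflexivity. }
    apply (path_mean_value (fun t => Cexp_rem (S M) (RtoC t * z))
             (fun t => z * Cexp_rem M (RtoC t * z))).
    intros t Ht. split.
    + unfold Cexp_rem.
      replace (z * (Cexp (RtoC t * z) - Csum (fun m => (RtoC t * z) ^ m / RtoC (INR (fact m))) M))
        with (z * Cexp (RtoC t * z) - z * Csum (fun m => (RtoC t * z) ^ m / RtoC (INR (fact m))) M) by ring.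
      apply is_path_derive_minus; [apply is_path_derive_Cexp|].
      apply (is_path_derive_comp (fun y => Csum (fun m => y ^ m / RtoC (INR (fact m))) (S M))
               (fun u => RtoC u * z)).
      * apply is_C_derive_Cexp_sum.
      * destruct (is_path_derive_line 0 z t) as [H1 H2].
        split; [revert H1|revert H2]; apply is_derive_ext; intros u; now rewrite Cplus_0_l.
    + rewrite Cmod_mult. simpl. rewrite Rmult_assoc.
      apply Rmult_le_compat_l; [apply Cmod_ge_0|].
      eapply Rle_trans; [apply IH|]. assert (T := Cmod_scal_le t z Ht).
      apply Rmult_le_compat.
      * apply pow_le, Cmod_ge_0.
      * apply Rlt_le, exp_pos.
      * apply pow_incr. split; [apply Cmod_ge_0|assumption].
      * now apply exp_le.
Qed.

Lemma is_C_derive_Cexp (z : C) : is_C_derive Cexp z (Cexp z).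
Proof.
  apply is_C_derive_eps. intros e He.
  assert (Hm : (0 < Cmod (Cexp z) * exp 1)%R).
  { rewrite Cmod_Cexp. apply Rmult_lt_0_compat; apply exp_pos. }
  (* The linearization error is [Cexp z] times the second-order remainder at [h = y - z], at most
     [|Cexp z| |h|^2 exp |h|]; the bound [|h| < 1] replaces [exp |h|] by [exp 1]. *)
  exists (Rmin 1 (e / (Cmod (Cexp z) * exp 1))). split.
  { apply Rmin_case; [lra|now apply Rdiv_lt_0_compat]. }
  intros y Hy.
  assert (Hy1 := Rlt_le_trans _ _ _ Hy (Rmin_l _ _)).
  assert (Hy2 := Rlt_le_trans _ _ _ Hy (Rmin_r _ _)).
  set (h := y - z) in *. replace y with (z + h) by (unfold h; ring).
  replace (Cexp (z + h) - Cexp z - h * Cexp z) with (Cexp z * Cexp_rem 2 h).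
  2:{ rewrite Cexp_plus. unfold Cexp_rem. simpl. field. }
  rewrite Cmod_mult. apply Rlt_div_r in Hy2; [|assumption].
  assert (T := Cmod_Cexp_rem 2 h). simpl in T. rewrite Rmult_1_r in T.
  assert (T1 : (exp (Cmod h) <= exp 1)%R) by (apply exp_le; lra).
  assert (H0 := Cmod_ge_0 h). assert (H1 := Cmod_ge_0 (Cexp z)).
  apply Rle_trans with (Cmod (Cexp z) * (Cmod h * Cmod h * exp 1))%R.
  - apply Rmult_le_compat_l; [assumption|]. eapply Rle_trans; [exact T|].
    apply Rmult_le_compat_l; nra.
  - replace (Cmod (Cexp z) * (Cmod h * Cmod h * exp 1))%R with
      (Cmod h * (Cmod (Cexp z) * exp 1) * Cmod h)%R by ring.
    apply Rmult_le_compat_r; lra.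
Qed.

(** * Logarithm and powers *)

Lemma Re_div_Cmod_bound (z : C) : z <> 0 -> (-1 <= Re z / Cmod z <= 1)%R.
Proof.
  intros Hz. apply Cmod_gt_0 in Hz.
  assert (H := re_le_Cmod z). apply Rabs_le_between in H.
  split; [apply Rle_div_r|apply Rle_div_l]; lra.
Qed.

Lemma sqrt_1_minus_cos_sqr (z : C) :
  z <> 0 -> sqrt (1 - (Re z / Cmod z)²) = (Rabs (Im z) / Cmod z)%R.
Proof.
  intros Hz. apply Cmod_gt_0 in Hz.
  replace (1 - (Re z / Cmod z)²)%R with ((Rabs (Im z) / Cmod z) ^ 2)%R.
  - apply sqrt_pow2. apply Rdiv_le_0_compat; [apply Rabs_pos|assumption].
  - assert (H := Cmod2_alt z).
    unfold Rdiv. rewrite Rpow_mult_distr, pow2_abs. unfold Rsqr.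
    replace (Im z ^ 2)%R with (Cmod z ^ 2 - Re z ^ 2)%R by lra. field. lra.
Qed.

Lemma Cexp_Clog (z : C) : z <> 0 -> Cexp (Clog z) = z.
Proof.
  intros Hz. assert (Hm := proj1 (Cmod_gt_0 z) Hz).
  assert (HB := Re_div_Cmod_bound z Hz). assert (HS := sqrt_1_minus_cos_sqr z Hz).
  unfold Cexp, Clog, Carg. simpl. rewrite exp_ln by assumption.
  destruct (Rle_dec 0 (Im z)) as [Hi|Hi].
  - rewrite cos_acos, sin_acos, HS, Rabs_pos_eq by assumption.
    apply injective_projections; simpl; unfold Re, Im; field; lra.
  - rewrite cos_neg, sin_neg, cos_acos, sin_acos, HS, Rabs_left by (trivial; lra).
    apply injective_projections; simpl; unfold Re, Im; field; lra.
Qed.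

(** The two [acos] branches of the argument meet without a derivative formula at the positive axis.
    In the right half plane, where all logarithms of the proof live, [atan] is one smooth
    formula. *)
Lemma Clog_atan (z : C) : (0 < Re z)%R -> Clog z = (ln (Cmod z), atan (Im z / Re z)).
Proof.
  intros Hr.
  assert (Hz : z <> 0) by (intros ->; simpl in Hr; lra).
  assert (Hm := proj1 (Cmod_gt_0 z) Hz). assert (HS := sqrt_1_minus_cos_sqr z Hz).
  unfold Clog, Carg. f_equal.
  assert (E : acos (Re z / Cmod z) = atan (Rabs (Im z) / Re z)).
  { rewrite acos_atan, HS by now apply Rdiv_lt_0_compat. f_equal. field. lra. }
  destruct (Rle_dec 0 (Im z)) as [Hi|Hi]; rewrite E.
  - now rewrite Rabs_pos_eq.
  - rewrite Rabs_left, <- atan_opp by lra. f_equal. field. lra.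
Qed.

Lemma Clog_RtoC (x : R) : (0 < x)%R -> Clog (RtoC x) = RtoC (ln x).
Proof.
  intros Hx. rewrite Clog_atan by exact Hx.
  rewrite Cmod_R, Rabs_pos_eq by lra. simpl.
  replace (0 / x)%R with 0%R by (field; lra). now rewrite atan_0.
Qed.

Lemma Clog_scal (r : R) (z : C) :
  (0 < r)%R -> (0 < Re z)%R -> Clog (RtoC r * z) = RtoC (ln r) + Clog z.
Proof.
  intros Hr Hz.
  assert (Hm : (0 < Cmod z)%R).
  { apply Cmod_gt_0. intros ->. simpl in Hz. lra. }
  rewrite !Clog_atan; trivial.
  2:{ rewrite re_scal_l. now apply Rmult_lt_0_compat. }
  rewrite re_scal_l, im_scal_l, Cmod_mult, Cmod_R, Rabs_pos_eq, ln_mult by lra.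
  replace (r * Im z / (r * Re z))%R with (Im z / Re z)%R by (field; lra).
  apply injective_projections; simpl; ring.
Qed.

(** Differentiability along lines through 1 is all that the binomial remainder asks of the
    logarithm; it follows from real calculus on the two coordinates. *)
Lemma is_path_derive_Clog_line (v : C) (t : R) :
  (0 < Re (1 + RtoC t * v))%R ->
  is_path_derive (fun u => Clog (1 + RtoC u * v)) t (v / (1 + RtoC t * v)).
Proof.
  intros Ht. destruct v as [a b].
  assert (ERe : forall u : R, Re (1 + RtoC u * (a, b)) = (1 + u * a)%R) by (intros u; simpl; ring).
  assert (EIm : forall u : R, Im (1 + RtoC u * (a, b)) = (u * b)%R) by (intros u; simpl; ring).
  rewrite ERe in Ht.
  assert (Hloc : locally t (fun u => Clog (1 + RtoC u * (a, b)) =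
    (ln (sqrt ((1 + u * a) ^ 2 + (u * b) ^ 2)), atan (u * b / (1 + u * a)))%R)).
  (* Within this distance of [t] the real part [1 + u a] stays positive, so that the [atan] formula
     holds on a whole neighbourhood. *)
  { assert (Hd : (0 < (1 + t * a) / (Rabs a + 1))%R).
    { apply Rdiv_lt_0_compat; [assumption|]. assert (H := Rabs_pos a). lra. }
    exists (mkposreal _ Hd). intros u Hu.
    rewrite Clog_atan, ERe, EIm.
    - f_equal. f_equal. unfold Cmod. f_equal.
      rewrite <- ERe, <- EIm. reflexivity.
    - rewrite ERe. change (Rabs (u - t) < (1 + t * a) / (Rabs a + 1))%R in Hu.
      assert (H := Rabs_pos a). apply Rlt_div_r in Hu; [|lra].
      assert (H2 : (Rabs ((u - t) * a) < 1 + t * a)%R).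
      { rewrite Rabs_mult. assert (H3 := Rabs_pos (u - t)). nra. }
      apply Rabs_def2 in H2. lra. }
  assert (Hp : (0 < (1 + t * a) ^ 2 + (t * b) ^ 2)%R).
  { assert (H1 := pow2_ge_0 (t * b)). assert (0 < (1 + t * a) ^ 2)%R by now apply pow_lt. lra. }
  assert (E : (a, b) / (1 + RtoC t * (a, b)) =
    ((a * (1 + t * a) + b * (t * b)) / ((1 + t * a) ^ 2 + (t * b) ^ 2),
     (b * (1 + t * a) - a * (t * b)) / ((1 + t * a) ^ 2 + (t * b) ^ 2))%R).
  { unfold Cdiv, Cinv. apply injective_projections; simpl.
    - field.
      match goal with |- ?X <> _ => replace X with ((1 + t * a) ^ 2 + (t * b) ^ 2)%R by ring end. lra.
    - field.
      match goal with |- ?X <> _ => replace X with ((1 + t * a) ^ 2 + (t * b) ^ 2)%R by ring end. lra. }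
  rewrite E. split.
  - eapply is_derive_ext_loc with
      (f := fun u => Re (ln (sqrt ((1 + u * a) ^ 2 + (u * b) ^ 2)), atan (u * b / (1 + u * a)))%R).
    { revert Hloc. apply filter_imp. intros u ->. reflexivity. }
    unfold Re. simpl fst. auto_derive.
    + repeat split; try lra. apply sqrt_lt_R0. simpl in Hp |- *. lra.
    + assert (Hs : (0 < sqrt ((1 + t * a) ^ 2 + (t * b) ^ 2))%R) by now apply sqrt_lt_R0.
      assert (Hs2 := sqrt_sqrt _ (Rlt_le _ _ Hp)).
      replace ((1 + t * a) * ((1 + t * a) * 1) + t * b * (t * b * 1))%R
        with ((1 + t * a) ^ 2 + (t * b) ^ 2)%R by (simpl; ring).
      rewrite <- Hs2 at 3. field. lra.
  - eapply is_derive_ext_loc with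
      (f := fun u => Im (ln (sqrt ((1 + u * a) ^ 2 + (u * b) ^ 2)), atan (u * b / (1 + u * a)))%R).
    { revert Hloc. apply filter_imp. intros u ->. reflexivity. }
    unfold Im. simpl snd. auto_derive.
    + lra.
    + field. split; [|lra].
      replace (_ + _)%R with ((1 + t * a) ^ 2 + (t * b) ^ 2)%R by ring. lra.
Qed.

(** A crude bound: [ln x <= x] for the real part, and [PI / 2 <= 2] for the argument. *)
Lemma Cmod_Clog_le (z : C) : (0 < Re z)%R -> (1 <= Cmod z)%R -> (Cmod (Clog z) <= Cmod z + 2)%R.
Proof.
  intros Hr Hm. rewrite Clog_atan by assumption.
  eapply Rle_trans; [apply Cmod_le_Re_Im|]. unfold Re at 1, Im at 1. simpl.
  assert (L1 : (0 <= ln (Cmod z))%R) by (rewrite <- ln_1; apply ln_le; lra).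
  assert (L2 : (ln (Cmod z) <= Cmod z)%R).
  { rewrite <- (ln_exp (Cmod z)) at 2. apply ln_le; [lra|].
    assert (H := exp_ineq1_le (Cmod z)). lra. }
  rewrite Rabs_pos_eq by assumption.
  assert (HA := atan_bound (Im z / Re z)). assert (HPI := PI_4).
  assert (Rabs (atan (Im z / Re z)) <= 2)%R by (apply Rabs_le; lra). unfold Re, Im in *. lra.
Qed.

Lemma Cpower_plus (z a b : C) : Cpower z (a + b) = Cpower z a * Cpower z b.
Proof. unfold Cpower. now rewrite Cmult_plus_distr_r, Cexp_plus. Qed.

Lemma Cpower_INR (z : C) (n : nat) : z <> 0 -> Cpower z (RtoC (INR n)) = z ^ n.
Proof. intros Hz. unfold Cpower. now rewrite Cexp_INR, Cexp_Clog. Qed.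

Lemma Cpower_opp_INR (z : C) (n : nat) : z <> 0 -> Cpower z (- RtoC (INR n)) = / z ^ n.
Proof.
  intros Hz. unfold Cpower. replace (- RtoC (INR n) * Clog z) with (- (RtoC (INR n) * Clog z)) by ring.
  now rewrite Cexp_opp, Cexp_INR, Cexp_Clog.
Qed.

Lemma Cpower_scal (r : R) (z a : C) :
  (0 < r)%R -> (0 < Re z)%R -> Cpower (RtoC r * z) a = Cpower (RtoC r) a * Cpower z a.
Proof.
  intros Hr Hz. unfold Cpower. rewrite Clog_scal, Clog_RtoC, <- Cexp_plus by assumption.
  f_equal. ring.
Qed.

Lemma Cmod_Cpower_RtoC (r : R) (a : C) :
  (0 < r)%R -> Cmod (Cpower (RtoC r) a) = exp (Re a * ln r).
Proof.
  intros Hr. unfold Cpower. rewrite Clog_RtoC, Cmod_Cexp, re_scal_r by assumption. reflexivity.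
Qed.

Lemma is_C_derive_Cpower (z : C) (f : C -> C) (s l : C) :
  is_C_derive f s l ->
  is_C_derive (fun y => Cpower z (f y)) s (l * Clog z * Cpower z (f s)).
Proof.
  intros Hf. unfold Cpower.
  apply (is_C_derive_comp Cexp (fun y => f y * Clog z)); [apply is_C_derive_Cexp|].
  eapply C_derive_eq; [|apply is_C_derive_mult; [exact Hf|apply is_C_derive_const]].
  cbv beta. ring.
Qed.

(** * Goursat's theorem on rectangles *)

Lemma norm_C_R (z : C) : @norm R_AbsRing C_R_NormedModule z = Cmod z.
Proof.
  unfold norm, Cmod. simpl. unfold prod_norm, norm. simpl. unfold abs. simpl.
  f_equal. rewrite !Rmult_1_r, <- !Rabs_mult, !Rabs_pos_eq by apply Rle_0_sqr. reflexivity.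
Qed.

Lemma is_path_derive_R (g : R -> C) (t : R) (l : C) :
  is_path_derive g t l -> @is_derive R_AbsRing C_R_NormedModule g t l.
Proof.
  rewrite is_path_derive_eps. intros H. split; [apply is_linear_scal_l|].
  intros y Hy.
  apply (is_filter_lim_locally_unique (V := AbsRing_NormedModule R_AbsRing)) in Hy.
  rewrite <- Hy.
  intros e. destruct (H e (cond_pos e)) as [d [Hd Hf]].
  exists (mkposreal d Hd). intros u Hu.
  rewrite norm_C_R. specialize (Hf u Hu).
  match goal with |- (Cmod ?A <= _)%R => replace A with (g u - g t - RtoC (u - t) * l) end.
  - exact Hf.
  - rewrite <- scal_R_Cmult. reflexivity.
Qed.

Lemma path_continuous (g : R -> C) (t : R) (l : C) :
  is_path_derive g t l -> @continuous R_UniformSpace C_UniformSpace g t.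
Proof.
  intros H. apply (ex_derive_continuous (K := R_AbsRing) (V := C_R_NormedModule)).
  exists l. now apply is_path_derive_R.
Qed.

Definition path_int (g : R -> C) (a b : R) : C := @RInt C_R_CompleteNormedModule g a b.

(** Integrability only uses the continuity that this implies; differentiability is what a
    holomorphic function provides directly along the sides of a rectangle. *)
Definition path_smooth (g : R -> C) (a b : R) : Prop :=
  forall t, (a <= t <= b)%R -> exists l, is_path_derive g t l.

Lemma path_int_correct (g : R -> C) (a b : R) :
  (a <= b)%R -> path_smooth g a b ->
  @is_RInt C_R_NormedModule g a b (path_int g a b).
Proof.
  intros Hab H. apply (RInt_correct (V := C_R_CompleteNormedModule)).
  apply (ex_RInt_continuous (V := C_R_CompleteNormedModule)). intros t.
  rewrite Rmin_left, Rmax_right by assumption. intros Ht.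
  destruct (H t Ht) as [l Hl]. exact (path_continuous g t l Hl).
Qed.

Lemma path_int_unique (g : R -> C) (a b : R) (l : C) :
  @is_RInt C_R_NormedModule g a b l -> path_int g a b = l.
Proof. apply (is_RInt_unique (V := C_R_CompleteNormedModule)). Qed.

Lemma path_int_minus (g h : R -> C) (a b : R) :
  (a <= b)%R -> path_smooth g a b -> path_smooth h a b ->
  path_int (fun t => g t - h t) a b = path_int g a b - path_int h a b.
Proof.
  intros Hab Hg Hh. apply path_int_unique.
  exact (is_RInt_minus g h a b _ _ (path_int_correct g a b Hab Hg) (path_int_correct h a b Hab Hh)).
Qed.

Lemma path_int_Chasles (g : R -> C) (a b c : R) :
  (a <= b)%R -> (b <= c)%R -> path_smooth g a c ->
  path_int g a c = path_int g a b + path_int g b c.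
Proof.
  intros Hab Hbc H. apply path_int_unique.
  apply (is_RInt_Chasles g a b c); apply path_int_correct; trivial;
    intros t Ht; apply H; lra.
Qed.

Lemma Cmod_path_int_le (g : R -> C) (a b M : R) :
  (a <= b)%R -> path_smooth g a b ->
  (forall t, (a <= t <= b)%R -> (Cmod (g t) <= M)%R) ->
  (Cmod (path_int g a b) <= (b - a) * M)%R.
Proof.
  intros Hab H HM. rewrite <- norm_C_R.
  apply (norm_RInt_le_const g a b); [assumption| |now apply path_int_correct].
  intros t Ht. rewrite norm_C_R. now apply HM.
Qed.

Lemma path_int_derive (g dg : R -> C) (a b : R) :
  (a <= b)%R ->
  (forall t, (a <= t <= b)%R -> is_path_derive g t (dg t)) ->
  path_smooth dg a b ->
  path_int dg a b = g b - g a.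
Proof.
  intros Hab H Hs. apply path_int_unique.
  apply (is_RInt_derive (V := C_R_CompleteNormedModule) g dg).
  - intros t. rewrite Rmin_left, Rmax_right by assumption. intros Ht.
    now apply is_path_derive_R, H.
  - intros t. rewrite Rmin_left, Rmax_right by assumption. intros Ht.
    destruct (Hs t Ht) as [l Hl]. exact (path_continuous dg t l Hl).
Qed.

(** The contour integral around the boundary of [[a, b] x [c, d]], counterclockwise; [Ci] is the
    velocity on the vertical sides. *)
Definition rect_int (f : C -> C) (a b c d : R) : C :=
  path_int (fun x => f (x, c)) a b + path_int (fun y => Ci * f (b, y)) c d
  - path_int (fun x => f (x, d)) a b - path_int (fun y => Ci * f (a, y)) c d.

Definition holo_rect (f : C -> C) (a b c d : R) : Prop :=
  forall x y, (a <= x <= b)%R -> (c <= y <= d)%R -> exists l, is_C_derive f (x, y) l.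

Lemma is_path_derive_horizontal (f : C -> C) (x y : R) (l : C) :
  is_C_derive f (x, y) l -> is_path_derive (fun t => f (t, y)) x l.
Proof.
  intros H. rewrite <- (Cmult_1_l l). apply (is_path_derive_comp f (fun t => (t, y))); trivial.
  split; simpl; auto_derive; trivial.
Qed.

Lemma is_path_derive_vertical (f : C -> C) (x y : R) (l : C) :
  is_C_derive f (x, y) l -> is_path_derive (fun t => f (x, t)) y (Ci * l).
Proof.
  intros H. apply (is_path_derive_comp f (fun t => (x, t))); trivial.
  split; simpl; auto_derive; trivial.
Qed.

Lemma is_path_derive_Ci (g : R -> C) (t : R) (l : C) :
  is_path_derive g t l -> is_path_derive (fun u => Ci * g u) t (Ci * l).
Proof.
  intros H. replace (Ci * l) with (l * Ci) by ring.
  apply (is_path_derive_comp (fun z => Ci * z)); trivial.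
  eapply C_derive_eq; [|apply is_C_derive_mult; [apply is_C_derive_const|apply is_C_derive_id]].
  cbv beta. ring.
Qed.

Lemma holo_rect_sides (f : C -> C) (a b c d : R) :
  holo_rect f a b c d ->
  (forall y, (c <= y <= d)%R -> path_smooth (fun x => f (x, y)) a b) /\
  (forall x, (a <= x <= b)%R -> path_smooth (fun y => Ci * f (x, y)) c d).
Proof.
  intros H. split.
  - intros y Hy x Hx. destruct (H x y Hx Hy) as [l Hl]. exists l. now apply is_path_derive_horizontal.
  - intros x Hx y Hy. destruct (H x y Hx Hy) as [l Hl]. exists (Ci * (Ci * l)).
    now apply is_path_derive_Ci, is_path_derive_vertical.
Qed.

Lemma rect_int_split_x (f : C -> C) (a m b c d : R) :
  (a <= m <= b)%R -> (c <= d)%R -> holo_rect f a b c d ->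
  rect_int f a b c d = rect_int f a m c d + rect_int f m b c d.
Proof.
  intros Hm Hcd H. destruct (holo_rect_sides _ _ _ _ _ H) as [Hh _]. unfold rect_int.
  rewrite (path_int_Chasles (fun x => f (x, c)) a m b); [|lra|lra|apply Hh; lra].
  rewrite (path_int_Chasles (fun x => f (x, d)) a m b); [|lra|lra|apply Hh; lra].
  ring.
Qed.

Lemma rect_int_split_y (f : C -> C) (a b c m d : R) :
  (a <= b)%R -> (c <= m <= d)%R -> holo_rect f a b c d ->
  rect_int f a b c d = rect_int f a b c m + rect_int f a b m d.
Proof.
  intros Hab Hm H. destruct (holo_rect_sides _ _ _ _ _ H) as [_ Hv]. unfold rect_int.
  rewrite (path_int_Chasles (fun y => Ci * f (a, y)) c m d); [|lra|lra|apply Hv; lra].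
  rewrite (path_int_Chasles (fun y => Ci * f (b, y)) c m d); [|lra|lra|apply Hv; lra].
  ring.
Qed.

Lemma rect_int_minus (f g : C -> C) (a b c d : R) :
  (a <= b)%R -> (c <= d)%R -> holo_rect f a b c d -> holo_rect g a b c d ->
  rect_int (fun z => f z - g z) a b c d = rect_int f a b c d - rect_int g a b c d.
Proof.
  intros Hab Hcd Hf Hg.
  destruct (holo_rect_sides _ _ _ _ _ Hf) as [F1 F2].
  destruct (holo_rect_sides _ _ _ _ _ Hg) as [G1 G2].
  unfold rect_int.
  rewrite (path_int_minus (fun x => f (x, c)) (fun x => g (x, c))); [|lra|apply F1; lra|apply G1; lra].
  rewrite (path_int_minus (fun x => f (x, d)) (fun x => g (x, d))); [|lra|apply F1; lra|apply G1; lra].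
  assert (E : forall x, (a <= x <= b)%R ->
    path_int (fun y => Ci * (f (x, y) - g (x, y))) c d =
    path_int (fun y => Ci * f (x, y)) c d - path_int (fun y => Ci * g (x, y)) c d).
  { intros x Hx.
    rewrite <- (path_int_minus (fun y => Ci * f (x, y)) (fun y => Ci * g (x, y)));
      [|lra|apply F2; lra|apply G2; lra].
    apply (RInt_ext (V := C_R_CompleteNormedModule)). intros y _. simpl. ring. }
  rewrite !E by lra. ring.
Qed.

Lemma rect_int_derive (P p : C -> C) (a b c d : R) :
  (a <= b)%R -> (c <= d)%R ->
  (forall z, is_C_derive P z (p z)) -> holo_rect p a b c d ->
  rect_int p a b c d = 0.
Proof.
  intros Hab Hcd HP Hp. destruct (holo_rect_sides _ _ _ _ _ Hp) as [H1 H2].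
  unfold rect_int.
  rewrite (path_int_derive (fun x => P (x, c)) (fun x => p (x, c)));
    [|lra|intros; now apply is_path_derive_horizontal|apply H1; lra].
  rewrite (path_int_derive (fun x => P (x, d)) (fun x => p (x, d)));
    [|lra|intros; now apply is_path_derive_horizontal|apply H1; lra].
  rewrite (path_int_derive (fun y => P (a, y)) (fun y => Ci * p (a, y)));
    [|lra|intros; now apply is_path_derive_vertical|apply H2; lra].
  rewrite (path_int_derive (fun y => P (b, y)) (fun y => Ci * p (b, y)));
    [|lra|intros; now apply is_path_derive_vertical|apply H2; lra].
  ring.
Qed.

Lemma rect_int_le (f : C -> C) (a b c d M : R) :
  (a <= b)%R -> (c <= d)%R -> holo_rect f a b c d ->
  (forall x y, (a <= x <= b)%R -> (c <= y <= d)%R -> (Cmod (f (x, y)) <= M)%R) ->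
  (Cmod (rect_int f a b c d) <= 2 * ((b - a) + (d - c)) * M)%R.
Proof.
  intros Hab Hcd H HM. destruct (holo_rect_sides _ _ _ _ _ H) as [H1 H2].
  unfold rect_int, Cminus.
  assert (B1 : forall y, (c <= y <= d)%R -> (Cmod (path_int (fun x => f (x, y)) a b) <= (b - a) * M)%R).
  { intros y Hy. apply Cmod_path_int_le; [assumption|now apply H1|]. intros x Hx. now apply HM. }
  assert (B2 : forall x, (a <= x <= b)%R -> (Cmod (path_int (fun y => Ci * f (x, y))%C c d) <= (d - c) * M)%R).
  { intros x Hx. apply Cmod_path_int_le; [assumption|now apply H2|]. intros y Hy.
    rewrite Cmod_mult, Cmod_Ci, Rmult_1_l. now apply HM. }
  eapply Rle_trans; [apply Cmod_triangle|]. rewrite Cmod_opp.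
  eapply Rle_trans; [apply Rplus_le_compat_r, Cmod_triangle|]. rewrite Cmod_opp.
  eapply Rle_trans; [apply Rplus_le_compat_r, Rplus_le_compat_r, Cmod_triangle|].
  assert (E1 := B1 c ltac:(lra)). assert (E2 := B1 d ltac:(lra)).
  assert (E3 := B2 a ltac:(lra)). assert (E4 := B2 b ltac:(lra)). lra.
Qed.

(** The affine approximation [p] of [f] at the point has the primitive [P] and integrates to 0. The
    rest is at most [e] times the diameter, itself at most width plus height, integrated over the
    perimeter. *)
Lemma rect_int_local (f : C -> C) (a b c d x0 y0 e : R) (l : C) :
  (a <= x0 <= b)%R -> (c <= y0 <= d)%R -> (0 <= e)%R -> holo_rect f a b c d ->
  (forall x y, (a <= x <= b)%R -> (c <= y <= d)%R ->
    (Cmod (f (x, y) - f (x0, y0) - ((x, y) - (x0, y0)) * l) <= e * Cmod ((x, y) - (x0, y0)))%R) ->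
  (Cmod (rect_int f a b c d) <= 2 * e * ((b - a) + (d - c)) ^ 2)%R.
Proof.
  intros Hx0 Hy0 He H HL.
  set (z0 := (x0, y0) : C).
  set (p := fun z : C => f z0 + (z - z0) * l).
  set (P := fun z : C => f z0 * z + (z * z / 2 - z0 * z) * l).
  assert (HP : forall z, is_C_derive P z (p z)).
  { intros z. unfold P, p. eapply C_derive_eq.
    2:{ apply is_C_derive_plus.
        - apply is_C_derive_mult; [apply is_C_derive_const|apply is_C_derive_id].
        - apply is_C_derive_mult; [|apply is_C_derive_const].
          apply is_C_derive_minus.
          + apply is_C_derive_mult; [|apply is_C_derive_const].
            apply is_C_derive_mult; apply is_C_derive_id.
          + apply is_C_derive_mult; [apply is_C_derive_const|apply is_C_derive_id]. }
    cbv beta. field. }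
  assert (Hp : forall z, is_C_derive p z l).
  { intros z. unfold p. eapply C_derive_eq.
    2:{ apply is_C_derive_plus; [apply is_C_derive_const|].
        apply is_C_derive_mult; [|apply is_C_derive_const].
        apply is_C_derive_minus; [apply is_C_derive_id|apply is_C_derive_const]. }
    cbv beta. ring. }
  assert (Hpr : holo_rect p a b c d) by (intros x y _ _; now exists l).
  assert (E : rect_int f a b c d = rect_int (fun z => f z - p z) a b c d).
  { rewrite rect_int_minus, (rect_int_derive P p); trivial; try lra. ring. }
  rewrite E.
  assert (Hab : (a <= b)%R) by lra. assert (Hcd : (c <= d)%R) by lra.
  replace (2 * e * (b - a + (d - c)) ^ 2)%R with
    (2 * ((b - a) + (d - c)) * (e * ((b - a) + (d - c))))%R by ring.
  apply rect_int_le; try assumption.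
  - intros x y Hx Hy. destruct (H x y Hx Hy) as [k Hk]. exists (k - l).
    apply is_C_derive_minus; trivial.
  - intros x y Hx Hy. unfold p.
    replace (f (x, y) - (f z0 + ((x, y) - z0) * l)) with (f (x, y) - f z0 - ((x, y) - z0) * l) by ring.
    eapply Rle_trans; [apply HL; assumption|].
    apply Rmult_le_compat_l; [assumption|].
    eapply Rle_trans; [apply Cmod_le_Re_Im|]. simpl.
    apply Rplus_le_compat; apply Rabs_le; lra.
Qed.

(** Compactness of the rectangle in the form of an induction principle: a failure would pass to some
    quarter each time, and the nested quarters would shrink to a point where [P] holds on all small
    rectangles. *)
Lemma rect_bisection (P : R -> R -> R -> R -> Prop) (A B C D : R) :
  (forall a b c d, (a <= b)%R -> (c <= d)%R ->
     P a ((a + b) / 2)%R c ((c + d) / 2)%R -> P ((a + b) / 2)%R b c ((c + d) / 2)%R ->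
     P a ((a + b) / 2)%R ((c + d) / 2)%R d -> P ((a + b) / 2)%R b ((c + d) / 2)%R d ->
     P a b c d) ->
  (forall x y, (A <= x <= B)%R -> (C <= y <= D)%R -> exists e, (0 < e)%R /\
     forall a b c d, (a <= x <= b)%R -> (c <= y <= d)%R ->
       (b - a < e)%R -> (d - c < e)%R -> P a b c d) ->
  (A <= B)%R -> (C <= D)%R -> P A B C D.
Proof.
  intros Hstep Hloc HAB HCD. apply NNPP. intros HN.
  set (T := ((R * R) * (R * R))%type).
  set (ok := fun q : T => (fst (fst q) <= snd (fst q))%R /\ (fst (snd q) <= snd (snd q))%R /\
    ~ P (fst (fst q)) (snd (fst q)) (fst (snd q)) (snd (snd q))).
  set (sub := fun I J : R * R => (fst I <= fst J)%R /\ (snd J <= snd I)%R /\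
    (snd J - fst J = (snd I - fst I) / 2)%R).
  (* The premise [ok q] stands inside the existential, so that choice yields a total function [next]
     that can be iterated. *)
  assert (Hnext : forall q : T, exists q' : T,
    ok q -> ok q' /\ sub (fst q) (fst q') /\ sub (snd q) (snd q')).
  { intros [[a b] [c d]]. destruct (classic (ok ((a, b), (c, d)))) as [Hok|]; [|exists ((a, b), (c, d)); tauto].
    assert (K := Hok). destruct K as [H1 [H2 H3]]. simpl in *.
    apply NNPP. intros Hno. apply H3.
    assert (Q : forall J K, (fst J <= snd J)%R -> (fst K <= snd K)%R -> sub (a, b) J -> sub (c, d) K ->
      P (fst J) (snd J) (fst K) (snd K)).
    { intros J K HJ HK SJ SK. apply NNPP. intros HP. apply Hno. exists (J, K). intros _.
      unfold ok. simpl. tauto. }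
    apply Hstep; trivial.
    - apply (Q (a, (a + b) / 2)%R (c, (c + d) / 2)%R); unfold sub; simpl; lra.
    - apply (Q ((a + b) / 2, b)%R (c, (c + d) / 2)%R); unfold sub; simpl; lra.
    - apply (Q (a, (a + b) / 2)%R ((c + d) / 2, d)%R); unfold sub; simpl; lra.
    - apply (Q ((a + b) / 2, b)%R ((c + d) / 2, d)%R); unfold sub; simpl; lra. }
  set (next := fun q => proj1_sig (constructive_indefinite_description _ (Hnext q))).
  assert (Enext : forall q, ok q -> ok (next q) /\ sub (fst q) (fst (next q)) /\ sub (snd q) (snd (next q))).
  { intros q. unfold next. now destruct (constructive_indefinite_description _ (Hnext q)). }
  set (q := fun k => Nat.iter k next ((A, B), (C, D))).
  assert (Hq : forall k, ok (q k)).
  { induction k as [|k IH]; [now repeat split|]. now apply Enext. }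
  (* Nested intervals for both coordinates at once: [pr] will be [fst] or [snd]. The common point is
     the supremum of the left ends. *)
  assert (Hsub : forall (pr : T -> R * R) (I0 : R * R), q 0%nat = q 0%nat -> pr (q 0%nat) = I0 ->
    (forall k, sub (pr (q k)) (pr (q (S k)))) -> (forall k, (fst (pr (q k)) <= snd (pr (q k)))%R) ->
    exists x, forall k, (fst (pr (q k)) <= x <= snd (pr (q k)))%R /\
      (snd (pr (q k)) - fst (pr (q k)) = (snd I0 - fst I0) / 2 ^ k)%R).
  { intros pr I0 _ E0 Hs Hle.
    assert (Hmono : forall k j, (fst (pr (q k)) <= fst (pr (q (j + k)%nat)))%R /\
                                (snd (pr (q (j + k)%nat)) <= snd (pr (q k)))%R).
    { intros k. induction j as [|j IH]; [simpl; lra|].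
      destruct (Hs (j + k)%nat) as [S1 [S2 _]]. change (S j + k)%nat with (S (j + k)). lra. }
    assert (Hcross : forall k j, (fst (pr (q k)) <= snd (pr (q j)))%R).
    { intros k j. destruct (Hmono k j) as [M1 _]. destruct (Hmono j k) as [_ M2].
      rewrite Nat.add_comm in M2. specialize (Hle (j + k)%nat). lra. }
    destruct (completeness (fun r => exists k, r = fst (pr (q k)))) as [x [Hx1 Hx2]].
    - exists (snd (pr (q 0%nat))). intros r [k ->]. apply Hcross.
    - now exists (fst (pr (q 0%nat))), 0%nat.
    - exists x. intros k. split.
      + split.
        * apply Hx1. now exists k.
        * apply Hx2. intros r [j ->]. apply Hcross.
      + induction k as [|k IH].
        * rewrite E0. simpl. field.
        * destruct (Hs k) as [_ [_ S3]]. rewrite S3, IH. simpl. field. apply pow_nonzero. lra. }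
  destruct (Hsub fst (A, B) eq_refl eq_refl) as [x Hx].
  { intros k. now apply Enext. }
  { intros k. apply Hq. }
  destruct (Hsub snd (C, D) eq_refl eq_refl) as [y Hy].
  { intros k. now apply Enext. }
  { intros k. apply Hq. }
  destruct (Hloc x y) as [e [He HP]].
  { apply (Hx 0%nat). }
  { apply (Hy 0%nat). }
  assert (Hpow : exists k, ((B - A + (D - C)) / 2 ^ k < e)%R).
  { destruct (pow_lt_1_zero (/ 2) ltac:(rewrite Rabs_pos_eq; lra) (e / (B - A + (D - C) + 1))%R) as [k Hk].
    { apply Rdiv_lt_0_compat; lra. }
    exists k. specialize (Hk k (le_n k)). rewrite pow_inv, Rabs_pos_eq in Hk.
    2:{ apply Rlt_le, Rinv_0_lt_compat, pow_lt. lra. }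
    apply Rlt_div_r in Hk; [|lra].
    assert (0 < / 2 ^ k)%R by (apply Rinv_0_lt_compat, pow_lt; lra).
    unfold Rdiv. nra. }
  destruct Hpow as [k Hk].
  destruct (Hx k) as [Hx1 Hx2]. destruct (Hy k) as [Hy1 Hy2]. simpl in Hx2, Hy2.
  destruct (Hq k) as [_ [_ HNk]]. apply HNk.
  assert (0 < / 2 ^ k)%R by (apply Rinv_0_lt_compat, pow_lt; lra).
  apply HP; try assumption; unfold Rdiv in *; nra.
Qed.

(** The local bound is quadratic in the size of the rectangle, so that the bounds of the four
    quarters add up exactly to that of the whole, and it holds globally for every [e > 0]. *)
Theorem Goursat (f : C -> C) (a b c d : R) :
  (a <= b)%R -> (c <= d)%R -> holo_rect f a b c d -> rect_int f a b c d = 0.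
Proof.
  intros Hab Hcd H.
  assert (Hsmall : forall e, (0 < e)%R ->
    (Cmod (rect_int f a b c d) <= 2 * e * ((b - a) + (d - c)) ^ 2)%R).
  { intros e He.
    (* Containment is a premise inside [P], because the local hypothesis of [rect_bisection] also
       ranges over rectangles that leave the original one. *)
    set (P := fun a' b' c' d' : R => (a <= a')%R -> (b' <= b)%R -> (c <= c')%R -> (d' <= d)%R ->
      (Cmod (rect_int f a' b' c' d') <= 2 * e * ((b' - a') + (d' - c')) ^ 2)%R).
    assert (HP : P a b c d); [|apply HP; lra].
    apply rect_bisection; trivial.
    - intros a' b' c' d' Hab' Hcd' Q1 Q2 Q3 Q4 Ia Ib Ic Id.
      assert (Q1' := Q1 ltac:(lra) ltac:(lra) ltac:(lra) ltac:(lra)).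
      assert (Q2' := Q2 ltac:(lra) ltac:(lra) ltac:(lra) ltac:(lra)).
      assert (Q3' := Q3 ltac:(lra) ltac:(lra) ltac:(lra) ltac:(lra)).
      assert (Q4' := Q4 ltac:(lra) ltac:(lra) ltac:(lra) ltac:(lra)).
      assert (Hh : forall s t u v, (a' <= s)%R -> (t <= b')%R -> (c' <= u)%R -> (v <= d')%R ->
        holo_rect f s t u v).
      { intros s t u v Hs Ht Hu Hv x y Hx Hy. apply H; lra. }
      rewrite (rect_int_split_x f a' ((a' + b') / 2)%R b'); [|lra|lra|apply Hh; lra].
      rewrite (rect_int_split_y f a' ((a' + b') / 2)%R c' ((c' + d') / 2)%R d'); [|lra|lra|apply Hh; lra].
      rewrite (rect_int_split_y f ((a' + b') / 2)%R b' c' ((c' + d') / 2)%R d'); [|lra|lra|apply Hh; lra].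
      eapply Rle_trans; [apply Cmod_triangle|].
      eapply Rle_trans; [apply Rplus_le_compat; apply Cmod_triangle|].
      eapply Rle_trans; [exact (Rplus_le_compat _ _ _ _ (Rplus_le_compat _ _ _ _ Q1' Q3') (Rplus_le_compat _ _ _ _ Q2' Q4'))|].
      apply Req_le. field.
    - intros x y Hx Hy. destruct (H x y Hx Hy) as [l Hl].
      rewrite is_C_derive_eps in Hl. destruct (Hl e He) as [r [Hr Kr]].
      exists (r / 2)%R. split; [lra|].
      intros a' b' c' d' Hx' Hy' Sab Scd Ia Ib Ic Id.
      apply (rect_int_local f a' b' c' d' x y e l); trivial; [lra| |].
      + intros x1 y1 Hx1 Hy1. apply H; lra.
      + intros x1 y1 Hx1 Hy1. apply Kr.
        eapply Rle_lt_trans; [apply Cmod_le_Re_Im|]. simpl.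
        assert (T1 : (Rabs (x1 + - x) <= b' - a')%R) by (apply Rabs_le; lra).
        assert (T2 : (Rabs (y1 + - y) <= d' - c')%R) by (apply Rabs_le; lra). lra. }
  apply Cmod_eq_0.
  assert (H0 := Cmod_ge_0 (rect_int f a b c d)).
  destruct (Rle_lt_or_eq_dec _ _ H0) as [Hpos|]; [exfalso|congruence].
  set (K := (b - a + (d - c))%R) in *.
  assert (HK : (0 <= K ^ 2)%R) by apply pow2_ge_0.
  (* With this [e] the bound is at most half of the modulus itself; [K ^ 2 + 1] guards against a
     degenerate rectangle. *)
  assert (T := Hsmall (Cmod (rect_int f a b c d) / (4 * (K ^ 2 + 1)))%R).
  assert (T1 : (0 < Cmod (rect_int f a b c d) / (4 * (K ^ 2 + 1)))%R) by (apply Rdiv_lt_0_compat; lra).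
  specialize (T T1).
  set (m := Cmod (rect_int f a b c d)) in *.
  assert (T2 : (2 * (m / (4 * (K ^ 2 + 1))) * K ^ 2 <= m / 2)%R).
  { replace (m / 2)%R with (2 * (m / (4 * (K ^ 2 + 1))) * (K ^ 2 + 1))%R by (field; lra). nra. }
  lra.
Qed.

(** * Consequences of Goursat's theorem *)

Lemma C_derive_spec (f : C -> C) (z : C) :
  (exists l, is_C_derive f z l) -> is_C_derive f z (C_derive f z).
Proof. intros H. apply C_derive_correct; [exact 0|exact H]. Qed.

Lemma path_int_const (a b : R) (z : C) : path_int (fun _ => z) a b = RtoC (b - a) * z.
Proof.
  apply path_int_unique. rewrite <- scal_R_Cmult. apply (is_RInt_const (V := C_R_NormedModule)).
Qed.

Lemma path_int_ext (g h : R -> C) (a b : R) :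
  (forall t, g t = h t) -> path_int g a b = path_int h a b.
Proof. intros H. apply (RInt_ext (V := C_R_CompleteNormedModule)). intros t _. apply H. Qed.

Lemma path_smooth_bounded (g : R -> C) (a b : R) :
  path_smooth g a b -> exists M, forall t, (a <= t <= b)%R -> (Cmod (g t) <= M)%R.
Proof.
  intros H.
  destruct (bounded_continuity (V := C_R_NormedModule) g a b) as [M HM].
  - intros t Ht. destruct (H t Ht) as [l Hl]. exact (path_continuous g t l Hl).
  - exists M. intros t Ht. rewrite <- norm_C_R. apply Rlt_le, HM, Ht.
Qed.

(** A lower bound, out of reach of modulus estimates. It concerns [Im] because vertical sides carry
    the factor [Ci], which turns the real part of the function into the imaginary part. *)
Lemma Im_path_int_ge (g : R -> C) (a b m : R) :
  (a <= b)%R -> path_smooth g a b ->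
  (forall t, (a <= t <= b)%R -> (m <= Im (g t))%R) ->
  ((b - a) * m <= Im (path_int g a b))%R.
Proof.
  intros Hab H Hm.
  assert (I := is_RInt_fct_extend_snd (U := R_NormedModule) (V := R_NormedModule)
                 g a b _ (path_int_correct g a b Hab H)).
  apply (is_RInt_le (fun _ => m) (fun t => snd (g t)) a b); trivial.
  - apply (is_RInt_const (V := R_NormedModule)).
  - intros t Ht. apply Hm. lra.
Qed.

(* Multiply [f(s0 + z)] by the Gaussian [exp(N z^2)], which peaks at [z = 0] on the
   imaginary axis and is exponentially small on the horizontal sides of a tall
   rectangle whose right side lies where [f] vanishes. *)
Theorem entire_eq_0_of_half_plane (f : C -> C) :
  (forall z, exists l, is_C_derive f z l) ->
  (forall z, (1 < Re z)%R -> f z = 0) -> forall z, f z = 0.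
Proof.
  intros Hf Hz s0. apply NNPP. intros Hs0.
  set (h := fun z : C => f (s0 + z) / f s0).
  assert (Hh : forall z, exists l, is_C_derive h z l).
  { intros z. destruct (Hf (s0 + z)) as [l Hl]. eexists. unfold h, Cdiv.
    apply is_C_derive_mult; [|apply is_C_derive_const].
    apply (is_C_derive_comp f (fun z => s0 + z)); [exact Hl|].
    apply is_C_derive_plus; [apply is_C_derive_const|apply is_C_derive_id]. }
  assert (Hh0 : h 0 = 1) by (unfold h; rewrite Cplus_0_r; now apply Cinv_r).
  (* The width [b] puts [s0 + b + i y] into the half plane where [f] vanishes. The height [Y > b]
     makes [Re (z^2) = x^2 - Y^2] at most -1 on the horizontal sides. *)
  set (b := (Rabs (Re s0) + 2)%R). set (Y := (b + 1)%R).
  assert (Hb : (2 <= b)%R) by (unfold b; assert (T := Rabs_pos (Re s0)); lra).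
  assert (Hhb : forall y, h (b, y) = 0).
  { intros y. unfold h. rewrite Hz; [unfold Cdiv; ring|]. simpl. unfold b.
    assert (T := Rabs_maj2 (Re s0)). unfold Re in *. lra. }
  assert (Hhr : holo_rect h 0 b (-Y) Y) by (intros x y _ _; apply Hh).
  destruct (holo_rect_sides _ _ _ _ _ Hhr) as [S1 S2].
  destruct (path_smooth_bounded _ _ _ (S1 (-Y)%R ltac:(unfold Y; lra))) as [M1 HM1].
  destruct (path_smooth_bounded _ _ _ (S1 Y ltac:(unfold Y; lra))) as [M2 HM2].
  destruct (path_smooth_bounded _ _ _ (S2 0%R ltac:(lra))) as [M3 HM3].
  set (M := Rmax (Rmax M1 M2) M3).
  assert (HM1' : (M1 <= M)%R) by (eapply Rle_trans; [apply Rmax_l|apply Rmax_l]).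
  assert (HM2' : (M2 <= M)%R) by (eapply Rle_trans; [apply Rmax_r|apply Rmax_l]).
  assert (HM3' : (M3 <= M)%R) by apply Rmax_r.
  assert (HM : (0 <= M)%R).
  { eapply Rle_trans; [apply Cmod_ge_0|]. eapply Rle_trans; [apply (HM1 0%R); lra|assumption]. }
  destruct (Hh 0) as [l0 Hl0].
  destruct (is_C_derive_continuous _ _ _ Hl0 (/ 2)%R ltac:(lra)) as [d [Hd Hcont]].
  set (eta := Rmin 1 (d / 2)).
  assert (He1 : (eta <= 1)%R) by apply Rmin_l.
  assert (Hed : (eta <= d / 2)%R) by apply Rmin_r.
  assert (He0 : (0 < eta)%R) by (unfold eta; apply Rmin_case; lra).
  assert (Hre : forall y, (Rabs y <= eta)%R -> (/ 2 <= Re (h (0%R, y)))%R).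
  { intros y Hy. specialize (Hcont (0%R, y)).
    assert (T : (Cmod (h (0%R, y) - h 0) < / 2)%R).
    { apply Hcont. replace ((0%R, y) - 0) with (Ci * RtoC y).
      - rewrite Cmod_mult, Cmod_Ci, Cmod_R. lra.
      - apply injective_projections; simpl; ring. }
    rewrite Hh0 in T. assert (T2 := re_le_Cmod (h (0%R, y) - 1)).
    apply Rle_lt_trans with (1 := T2) in T. apply Rabs_def2 in T.
    change (Re (h (0%R, y) - 1)) with (Re (h (0%R, y)) - 1)%R in T. lra. }
  set (K := (2 * b * M + 2 * Y * M)%R).
  assert (HK : (0 <= K)%R) by (unfold K, Y; nra).
  (* The left side is the contribution of [|y| <= eta / 2], where [Re h >= 1/2]. Everything else on
     the contour is of order [exp (- N eta^2)], and Goursat's theorem makes the total zero. *)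
  assert (Main : forall N : nat, (eta * (/ 2 * exp (- (INR N * (eta / 2) ^ 2))) <= K * exp (- (INR N * eta ^ 2)))%R).
  { intros N. assert (HN := pos_INR N).
    set (g := fun z : C => h z * Cexp (RtoC (INR N) * (z * z))).
    assert (Hg : forall z, exists l, is_C_derive g z l).
    { intros z. destruct (Hh z) as [l Hl]. eexists. unfold g.
      apply is_C_derive_mult; [exact Hl|].
      apply (is_C_derive_comp Cexp (fun z => RtoC (INR N) * (z * z))); [apply is_C_derive_Cexp|].
      apply is_C_derive_mult; [apply is_C_derive_const|].
      apply is_C_derive_mult; apply is_C_derive_id. }
    assert (Hgr : holo_rect g 0 b (-Y) Y) by (intros x y _ _; apply Hg).
    destruct (holo_rect_sides _ _ _ _ _ Hgr) as [T1 T2].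
    assert (Hmg : forall x y, Cmod (g (x, y)) = (Cmod (h (x, y)) * exp (INR N * (x * x - y * y)))%R).
    { intros x y. unfold g. rewrite Cmod_mult, Cmod_Cexp, re_scal_l. reflexivity. }
    assert (G := Goursat g 0 b (-Y) Y ltac:(lra) ltac:(unfold Y; lra) Hgr).
    unfold rect_int in G.
    rewrite (path_int_ext (fun y => Ci * g (b, y)) (fun _ => 0)) in G.
    2:{ intros y. unfold g. rewrite Hhb. ring. }
    rewrite path_int_const, Cmult_0_r in G.
    set (I := path_int (fun y => Ci * g (0%R, y)) (-Y) Y) in *.
    set (I1 := path_int (fun x => g (x, (-Y)%R)) 0 b) in *.
    set (I2 := path_int (fun x => g (x, Y)) 0 b) in *.
    assert (EI : I = I1 - I2) by (rewrite <- (Cplus_0_l I), <- G; ring).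
    assert (Hexp : forall x, (0 <= x <= b)%R -> (exp (INR N * (x * x - Y * Y)) <= exp (- (INR N * eta ^ 2)))%R).
    { intros x Hx. apply exp_le.
      assert (x * x - Y * Y <= - (eta ^ 2))%R by (unfold Y; simpl; nra). nra. }
    assert (B1 : (Cmod I1 <= b * (M * exp (- (INR N * eta ^ 2))))%R).
    { rewrite <- (Rminus_0_r b) at 1. apply Cmod_path_int_le; [lra|apply T1; unfold Y; lra|].
      intros x Hx. rewrite Hmg. apply Rmult_le_compat; [apply Cmod_ge_0|apply Rlt_le, exp_pos| |].
      - eapply Rle_trans; [now apply HM1|assumption].
      - replace (- Y * - Y)%R with (Y * Y)%R by ring. now apply Hexp. }
    assert (B2 : (Cmod I2 <= b * (M * exp (- (INR N * eta ^ 2))))%R).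
    { rewrite <- (Rminus_0_r b) at 1. apply Cmod_path_int_le; [lra|apply T1; unfold Y; lra|].
      intros x Hx. rewrite Hmg. apply Rmult_le_compat; [apply Cmod_ge_0|apply Rlt_le, exp_pos| |].
      - eapply Rle_trans; [now apply HM2|assumption].
      - now apply Hexp. }
    assert (BI : (Im I <= 2 * b * M * exp (- (INR N * eta ^ 2)))%R).
    { eapply Rle_trans; [apply Rle_abs|]. eapply Rle_trans; [apply im_le_Cmod|].
      rewrite EI. unfold Cminus. eapply Rle_trans; [apply Cmod_triangle|].
      rewrite Cmod_opp. lra. }
    assert (Hsm : path_smooth (fun y => Ci * g (0%R, y)) (-Y) Y) by (apply T2; lra).
    assert (EIm : forall y, Im (Ci * g (0%R, y)) = (Re (h (0%R, y)) * exp (- (INR N * y ^ 2)))%R).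
    { intros y. unfold g.
      replace (RtoC (INR N) * ((0%R, y) * (0%R, y))) with (RtoC (- (INR N * y ^ 2))).
      2:{ apply injective_projections; simpl; ring. }
      unfold Cexp. rewrite re_RtoC, im_RtoC, cos_0, sin_0.
      unfold Re. simpl. ring. }
    (* Between [eta / 2] and [eta] the integrand is positive because [Re h] is; beyond [eta] its
       Gaussian factor is at most [exp (- N eta^2)]. *)
    assert (Hout : forall y, (Rabs y <= Y)%R -> (eta / 2 <= Rabs y)%R ->
      (- (M * exp (- (INR N * eta ^ 2))) <= Im (Ci * g (0%R, y)))%R).
    { intros y HyY Hy. rewrite EIm.
      assert (P1 := exp_pos (- (INR N * y ^ 2))). assert (P2 := exp_pos (- (INR N * eta ^ 2))).
      destruct (Rle_dec (Rabs y) eta) as [Hle|Hgt].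
      - assert (T := Hre y Hle). nra.
      - assert (T : (Rabs (Re (h (0%R, y))) <= M)%R).
        { eapply Rle_trans; [apply re_le_Cmod|].
          assert (T := HM3 y). rewrite Cmod_mult, Cmod_Ci, Rmult_1_l in T.
          eapply Rle_trans; [apply T|assumption]. apply Rabs_le_between in HyY. lra. }
        assert (T3 : (exp (- (INR N * y ^ 2)) <= exp (- (INR N * eta ^ 2)))%R).
        { apply exp_le. rewrite <- (pow2_abs y).
          assert (eta ^ 2 <= Rabs y ^ 2)%R by (apply pow_incr; lra). nra. }
        apply Rabs_le_between in T. nra. }
    assert (LI : (eta * (/ 2 * exp (- (INR N * (eta / 2) ^ 2))) - 2 * Y * (M * exp (- (INR N * eta ^ 2))) <= Im I)%R).
    { set (m := (M * exp (- (INR N * eta ^ 2)))%R).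
      assert (Hm : (0 <= m)%R).
      { apply Rmult_le_pos; [assumption|apply Rlt_le, exp_pos]. }
      unfold I. rewrite (path_int_Chasles _ (-Y) (- (eta / 2)) Y); [|unfold Y; lra|unfold Y; lra|assumption].
      rewrite (path_int_Chasles _ (- (eta / 2)) (eta / 2) Y); [|lra|unfold Y; lra|].
      2:{ intros t Ht. apply Hsm. unfold Y in *. lra. }
      rewrite !im_plus.
      assert (L1 := Im_path_int_ge (fun y => Ci * g (0%R, y)) (-Y) (- (eta / 2)) (- m)
        ltac:(unfold Y; lra) ltac:(intros t Ht; apply Hsm; unfold Y in *; lra)
        ltac:(intros t Ht; apply Hout; rewrite Rabs_left1 by (unfold Y in *; lra); unfold Y in *; lra)).
      assert (L3 := Im_path_int_ge (fun y => Ci * g (0%R, y)) (eta / 2) Y (- m)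
        ltac:(unfold Y; lra) ltac:(intros t Ht; apply Hsm; unfold Y in *; lra)
        ltac:(intros t Ht; apply Hout; rewrite Rabs_pos_eq by (unfold Y in *; lra); unfold Y in *; lra)).
      assert (L2 := Im_path_int_ge (fun y => Ci * g (0%R, y)) (- (eta / 2)) (eta / 2)
        (/ 2 * exp (- (INR N * (eta / 2) ^ 2)))
        ltac:(lra) ltac:(intros t Ht; apply Hsm; unfold Y; lra)).
      assert (L2' : ((eta / 2 - - (eta / 2)) * (/ 2 * exp (- (INR N * (eta / 2) ^ 2)))
        <= Im (path_int (fun y => (Ci * g (0%R, y))%C) (- (eta / 2)) (eta / 2)))%R).
      { apply L2. intros t Ht. rewrite EIm.
        assert (Ha : (Rabs t <= eta / 2)%R) by (apply Rabs_le; lra).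
        apply Rmult_le_compat; [lra|apply Rlt_le, exp_pos|apply Hre; lra|].
        apply exp_le. rewrite <- (pow2_abs t).
        assert (Rabs t ^ 2 <= (eta / 2) ^ 2)%R by (apply pow_incr; split; [apply Rabs_pos|lra]). nra. }
      assert (0 <= eta * m)%R by (apply Rmult_le_pos; lra). nra. }
    unfold K. lra. }
  set (q := (eta ^ 2)%R).
  assert (Hq : (0 < q)%R) by (unfold q; apply pow_lt; lra).
  (* The two exponents in [Main] differ by [N (3 q / 4)]. This [N] makes [eta] times that difference
     exceed [2 K], against [1 + x <= exp x]. *)
  destruct (INR_unbounded (2 * K / eta / (3 * q / 4))%R) as [N HN].
  specialize (Main N).
  replace (- (INR N * (eta / 2) ^ 2))%R with (- (INR N * q) + INR N * (3 * q / 4))%R in Main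
    by (unfold q; field).
  fold q in Main. rewrite exp_plus in Main.
  assert (P := exp_pos (- (INR N * q))).
  assert (Hq' : (0 < 3 * q / 4)%R) by lra.
  apply (proj1 (Rlt_div_l _ _ _ Hq')) in HN. apply (proj1 (Rlt_div_l _ _ _ He0)) in HN.
  assert (E := exp_ineq1_le (INR N * (3 * q / 4))).
  assert (T : (eta * / 2 * exp (INR N * (3 * q / 4)) <= K)%R).
  { apply Rmult_le_reg_l with (1 := P). lra. }
  assert (T2 : (eta * (1 + INR N * (3 * q / 4)) <= eta * exp (INR N * (3 * q / 4)))%R).
  { apply Rmult_le_compat_l; lra. }
  lra.
Qed.

(* In the coordinate [u] with [y = c + exp u], circles around [c] are vertical segments
   and the two horizontal sides of [u1, u2] x [0, 2 pi] carry the same values. *)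
Lemma Cauchy_estimate (f : C -> C) (c l : C) (r M : R) :
  (0 < r)%R ->
  (forall y, (Cmod (y - c) < r)%R -> exists k, is_C_derive f y k) ->
  (forall y, (Cmod (y - c) < r)%R -> (Cmod (f y) <= M)%R) ->
  is_C_derive f c l -> (Cmod l <= 4 * M / r)%R.
Proof.
  intros Hr Hf HM Hl. apply le_epsilon. intros e He.
  assert (Hl' := Hl). rewrite is_C_derive_eps in Hl'. destruct (Hl' e He) as [d [Hd Kd]].
  (* The inner circle has radius [r1 < d], where the difference quotient is within [e] of [l]; the
     outer one has radius [r / 2], where only [M] is known. *)
  set (r1 := Rmin (d / 2) (r / 2)).
  assert (Hr1 : (0 < r1)%R) by (unfold r1; apply Rmin_case; lra).
  assert (Hr1d : (r1 <= d / 2)%R) by apply Rmin_l.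
  assert (Hr1r : (r1 <= r / 2)%R) by apply Rmin_r.
  set (u1 := ln r1). set (u2 := ln (r / 2)).
  assert (Hu : (u1 <= u2)%R) by (apply ln_le; assumption).
  (* The difference quotient of [f] at [c], pulled back by [y = c + exp u]. *)
  set (H := fun u : C => (f (c + Cexp u) - f c) * Cexp (- u)).
  assert (Hin : forall x y, (x <= u2)%R -> (Cmod (c + Cexp (x, y) - c) < r)%R).
  { intros x y Hx. replace (c + Cexp (x, y) - c) with (Cexp (x, y)) by ring.
    rewrite Cmod_Cexp. simpl. apply Rle_lt_trans with (r / 2)%R; [|lra].
    rewrite <- (exp_ln (r / 2)) by lra. now apply exp_le. }
  assert (HH : holo_rect H u1 u2 0 (2 * PI)).
  { intros x y Hx Hy. destruct (Hf (c + Cexp (x, y))) as [k Hk]; [apply Hin; lra|].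
    eexists. unfold H. apply is_C_derive_mult.
    - apply is_C_derive_minus; [|apply is_C_derive_const].
      apply (is_C_derive_comp f (fun u => c + Cexp u)); [exact Hk|].
      apply is_C_derive_plus; [apply is_C_derive_const|apply is_C_derive_Cexp].
    - apply (is_C_derive_comp Cexp (fun u => - u)); [apply is_C_derive_Cexp|].
      apply is_C_derive_opp, is_C_derive_id. }
  assert (HPI := PI_RGT_0).
  assert (G := Goursat H u1 u2 0 (2 * PI) Hu ltac:(lra) HH). unfold rect_int in G.
  rewrite (path_int_ext (fun x => H (x, (2 * PI)%R)) (fun x => H (x, 0%R))) in G.
  2:{ intros x.
      assert (E1 : Cexp (x, (2 * PI)%R) = Cexp (x, 0%R)).
      { unfold Cexp. simpl. now rewrite cos_2PI, sin_2PI, cos_0, sin_0. }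
      unfold H. rewrite !Cexp_opp, E1. reflexivity. }
  destruct (holo_rect_sides _ _ _ _ _ HH) as [_ S2].
  set (J1 := path_int (fun y => Ci * H (u1, y)) 0 (2 * PI)) in *.
  set (J2 := path_int (fun y => Ci * H (u2, y)) 0 (2 * PI)) in *.
  assert (EJ : J1 = J2) by (rewrite <- (Cplus_0_l J1), <- G; ring).
  (* The numerator [f y - f c] is at most [2 M] and is divided by the radius [r / 2], whence the
     constant 4. *)
  assert (B2 : (Cmod J2 <= (2 * PI - 0) * (4 * M / r))%R).
  { apply Cmod_path_int_le; [lra|apply S2; lra|]. intros y Hy.
    rewrite Cmod_mult, Cmod_Ci, Rmult_1_l. unfold H.
    rewrite Cmod_mult, Cmod_Cexp. replace (Re (- (u2, y))) with (- u2)%R by reflexivity.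
    rewrite exp_Ropp. unfold u2. rewrite exp_ln by lra.
    replace (4 * M / r)%R with (2 * M * / (r / 2))%R by (field; lra).
    apply Rmult_le_compat_r; [apply Rlt_le, Rinv_0_lt_compat; lra|].
    unfold Cminus. eapply Rle_trans; [apply Cmod_triangle|]. rewrite Cmod_opp.
    assert (T1 : (Cmod (f (c + Cexp (ln (r / 2)%R, y))%C) <= M)%R).
    { apply HM. apply Hin. apply Rle_refl. }
    assert (T2 : (Cmod (f c) <= M)%R).
    { apply HM. replace (c - c) with (RtoC 0) by ring. now rewrite Cmod_0. }
    lra. }
  assert (B1 : (Cmod (J1 - RtoC (2 * PI - 0) * (Ci * l)) <= (2 * PI - 0) * e)%R).
  { rewrite <- path_int_const. unfold J1.
    assert (Sc : path_smooth (fun _ => Ci * l) 0 (2 * PI)).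
    { intros t _. exists 0. split; simpl; apply (is_derive_const (K := R_AbsRing) (V := R_NormedModule)). }
    rewrite <- (path_int_minus (fun y => Ci * H (u1, y)) (fun _ => Ci * l));
      [|lra|apply S2; lra|exact Sc].
    apply Cmod_path_int_le; [lra| |].
    - intros t Ht. destruct (S2 u1 ltac:(lra) t Ht) as [k1 Hk1]. destruct (Sc t Ht) as [k2 Hk2].
      exists (k1 - k2). now apply is_path_derive_minus.
    - intros y Hy. replace (Ci * H (u1, y) - Ci * l) with
        (Ci * ((f (c + Cexp (u1, y)) - f c - (c + Cexp (u1, y) - c) * l) * Cexp (- (u1, y)))).
      2:{ unfold H. rewrite Cexp_opp. field. apply Cexp_neq_0. }
      rewrite !Cmod_mult, Cmod_Ci, Rmult_1_l.
      assert (E : Cmod (c + Cexp (u1, y) - c) = r1).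
      { replace (c + Cexp (u1, y) - c) with (Cexp (u1, y)) by ring.
        rewrite Cmod_Cexp. simpl. now apply exp_ln. }
      specialize (Kd (c + Cexp (u1, y))). rewrite E in Kd. specialize (Kd ltac:(lra)).
      rewrite Cmod_Cexp. replace (Re (- (u1, y))) with (- u1)%R by reflexivity.
      rewrite exp_Ropp. replace (exp u1) with r1 by (symmetry; now apply exp_ln).
      apply Rle_div_l; assumption. }
  assert (E : (2 * PI * Cmod l <= 2 * PI * (4 * M / r + e))%R).
  { replace (2 * PI * Cmod l)%R with (Cmod (RtoC (2 * PI - 0) * (Ci * l))).
    2:{ rewrite !Cmod_mult, Cmod_Ci, Cmod_R, Rabs_pos_eq by lra. ring. }
    replace (RtoC (2 * PI - 0) * (Ci * l)) with (J1 - (J1 - RtoC (2 * PI - 0) * (Ci * l))) by ring.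
    unfold Cminus at 1. eapply Rle_trans; [apply Cmod_triangle|]. rewrite Cmod_opp, EJ.
    rewrite EJ in B1. lra. }
  apply Rmult_le_reg_l in E; lra.
Qed.

(** Each point of the segment from [c] to [c + h] is the centre of a disk of radius [r / 2] inside
    the given one. Cauchy's estimate there bounds the derivative by [8 M / r]. *)
Lemma Cauchy_Lipschitz (f : C -> C) (c h : C) (r M : R) :
  (0 < r)%R ->
  (forall y, (Cmod (y - c) < r)%R -> exists k, is_C_derive f y k) ->
  (forall y, (Cmod (y - c) < r)%R -> (Cmod (f y) <= M)%R) ->
  (Cmod h < r / 2)%R -> (Cmod (f (c + h)%C - f c) <= 8 * M / r * Cmod h)%R.
Proof.
  intros Hr Hf HM Hh.
  assert (T := path_mean_value (fun t => f (c + RtoC t * h)) (fun t => h * C_derive f (c + RtoC t * h))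
    (8 * M / r * Cmod h)%R).
  cbv beta in T. rewrite Cmult_1_l, Cmult_0_l, Cplus_0_r in T. apply T.
  intros t Ht.
  assert (Hth := Cmod_scal_le t h Ht).
  assert (Hd : is_C_derive f (c + RtoC t * h) (C_derive f (c + RtoC t * h))).
  { apply C_derive_spec, Hf. replace (c + RtoC t * h - c) with (RtoC t * h) by ring. lra. }
  split.
  - apply is_path_derive_comp; [exact Hd|apply is_path_derive_line].
  - rewrite Cmod_mult, Rmult_comm. apply Rmult_le_compat_r; [apply Cmod_ge_0|].
    replace (8 * M / r)%R with (4 * M / (r / 2))%R by (field; lra).
    assert (Hin : forall y, (Cmod (y - (c + RtoC t * h)) < r / 2)%R -> (Cmod (y - c) < r)%R).
    { intros y Hy. replace (y - c) with (y - (c + RtoC t * h) + RtoC t * h) by ring.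
      eapply Rle_lt_trans; [apply Cmod_triangle|]. lra. }
    apply (Cauchy_estimate f (c + RtoC t * h)); [lra| | |exact Hd]; intros y Hy; auto.
Qed.

(** * Uniform limits of holomorphic functions *)

Lemma le_of_le_plus_null (x y : R) (e : nat -> R) :
  is_lim_seq e 0 -> (forall n, (x <= y + e n)%R) -> (x <= y)%R.
Proof.
  intros He H. apply (is_lim_seq_le (fun _ => x) (fun n => (y + e n)%R) x y); trivial.
  - apply is_lim_seq_const.
  - replace (Finite y) with (Finite (y + 0)) by (f_equal; ring).
    apply is_lim_seq_plus'; [apply is_lim_seq_const|exact He].
Qed.

(** Completeness in a form that keeps the rate: letting [m] tend to infinity in the hypothesis
    leaves exactly [e n]. *)
Lemma C_Cauchy_limit (u : nat -> C) (e : nat -> R) :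
  is_lim_seq e 0 -> (forall n m, (Cmod (u n - u m) <= e n + e m)%R) ->
  exists l, forall n, (Cmod (u n - l) <= e n)%R.
Proof.
  intros He H.
  assert (HC : forall p : C -> R, (forall x y, (Rabs (p x - p y) <= Cmod (x - y))%R) ->
    ex_finite_lim_seq (fun n => p (u n))).
  { intros p Hp. apply ex_lim_seq_cauchy_corr. intros eps.
    apply is_lim_seq_spec in He. destruct (He (pos_div_2 eps)) as [N HN].
    exists N. intros n m Hn Hm. eapply Rle_lt_trans; [apply Hp|].
    eapply Rle_lt_trans; [apply H|].
    assert (T1 := HN n Hn). assert (T2 := HN m Hm). simpl in T1, T2.
    rewrite Rminus_0_r in T1, T2. apply Rabs_def2 in T1. apply Rabs_def2 in T2. lra. }
  destruct (HC Re) as [x Hx].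
  { intros a b. eapply Rle_trans; [|apply re_le_Cmod]. apply Req_le. reflexivity. }
  destruct (HC Im) as [y Hy].
  { intros a b. eapply Rle_trans; [|apply im_le_Cmod]. apply Req_le. reflexivity. }
  exists (x, y). intros n.
  apply (le_of_le_plus_null _ _ (fun m => e m + (Rabs (Re (u m) - x) + Rabs (Im (u m) - y)))%R).
  - replace (Finite 0) with (Finite (0 + (0 + 0))) by (f_equal; ring).
    apply is_lim_seq_plus'; [exact He|]. apply is_lim_seq_plus'.
    + apply (proj1 (is_lim_seq_abs_0 _)). replace (Finite 0) with (Finite (x - x)) by (f_equal; ring).
      apply is_lim_seq_minus'; [exact Hx|apply is_lim_seq_const].
    + apply (proj1 (is_lim_seq_abs_0 _)). replace (Finite 0) with (Finite (y - y)) by (f_equal; ring).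
      apply is_lim_seq_minus'; [exact Hy|apply is_lim_seq_const].
  - intros m. replace (u n - (x, y)) with ((u n - u m) + (u m - (x, y))) by ring.
    eapply Rle_trans; [apply Cmod_triangle|].
    assert (T := Cmod_le_Re_Im (u m - (x, y))). specialize (H n m).
    change (Re (u m - (x, y))) with (Re (u m) - x)%R in T.
    change (Im (u m - (x, y))) with (Im (u m) - y)%R in T. lra.
Qed.

(** Cauchy's estimate on [F n - F m] makes the derivatives at [c] a Cauchy sequence, and its
    Lipschitz form bounds the increments of [Y - F n]. The limit is thus differentiated without
    integrating it. *)
Theorem Weierstrass_limit (F : nat -> C -> C) (Y : C -> C) (c : C) (r : R) (e : nat -> R) :
  (0 < r)%R -> is_lim_seq e 0 ->
  (forall n y, (Cmod (y - c) < r)%R -> exists k, is_C_derive (F n) y k) ->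
  (forall n y, (Cmod (y - c) < r)%R -> (Cmod (F n y - Y y) <= e n)%R) ->
  exists l, is_C_derive Y c l.
Proof.
  intros Hr He HF HY.
  assert (Hcc : (Cmod (c - c) < r)%R) by (replace (c - c) with (RtoC 0) by ring; now rewrite Cmod_0).
  assert (He0 : forall n, (0 <= e n)%R).
  { intros n. eapply Rle_trans; [apply Cmod_ge_0|exact (HY n c Hcc)]. }
  assert (HFF : forall n m y, (Cmod (y - c) < r)%R -> (Cmod (F n y - F m y) <= e n + e m)%R).
  { intros n m y Hy. replace (F n y - F m y) with ((F n y - Y y) + - (F m y - Y y)) by ring.
    eapply Rle_trans; [apply Cmod_triangle|]. rewrite Cmod_opp.
    apply Rplus_le_compat; now apply HY. }
  assert (HFd : forall n m y, (Cmod (y - c) < r)%R ->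
    exists k, is_C_derive (fun z => F n z - F m z) y k).
  { intros n m y Hy. destruct (HF n y Hy) as [k Hk]. destruct (HF m y Hy) as [k' Hk'].
    exists (k - k'). now apply is_C_derive_minus. }
  set (D := fun n => C_derive (F n) c).
  assert (HD : forall n, is_C_derive (F n) c (D n)) by (intros n; now apply C_derive_spec, HF).
  destruct (C_Cauchy_limit D (fun n => 4 / r * e n)%R) as [l Hl].
  { replace (Finite 0) with (Rbar_mult (4 / r)%R 0) by (simpl; f_equal; ring).
    now apply is_lim_seq_scal_l. }
  { intros n m. replace (4 / r * e n + 4 / r * e m)%R with (4 * (e n + e m) / r)%R by (field; lra).
    apply (Cauchy_estimate (fun z => F n z - F m z) c); trivial; [apply HFd|apply HFF|].
    apply is_C_derive_minus; apply HD. }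
  exists l. apply is_C_derive_eps. intros eps Heps.
  (* Nothing is yet known about derivatives of [Y], so the Lipschitz bound is proved for [F m - F n]
     and passed to the limit in [m]. *)
  assert (HL : forall n h, (Cmod h < r / 2)%R ->
    (Cmod ((Y (c + h)%C - F n (c + h)%C) - (Y c - F n c)) <= 8 / r * e n * Cmod h)%R).
  { intros n h Hh.
    assert (Hch : (Cmod (c + h - c) < r)%R) by (replace (c + h - c) with h by ring; lra).
    apply (le_of_le_plus_null _ _ (fun m => (2 + 8 / r * Cmod h) * e m)%R).
    - replace (Finite 0) with (Rbar_mult (2 + 8 / r * Cmod h)%R 0) by (simpl; f_equal; ring).
      now apply is_lim_seq_scal_l.
    - intros m.
      replace (Y (c + h) - F n (c + h) - (Y c - F n c)) with
        ((F m (c + h) - F n (c + h) - (F m c - F n c)) + (- (F m (c + h) - Y (c + h)) + (F m c - Y c))) by ring.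
      eapply Rle_trans; [apply Cmod_triangle|].
      assert (T1 := Cauchy_Lipschitz (fun z => F m z - F n z) c h r (e m + e n) Hr (HFd m n) (HFF m n) Hh).
      cbv beta in T1.
      assert (T2 := Cmod_triangle (- (F m (c + h) - Y (c + h))) (F m c - Y c)).
      rewrite Cmod_opp in T2. assert (T3 := HY m _ Hch). assert (T4 := HY m _ Hcc).
      replace (8 * (e m + e n) / r * Cmod h)%R with (8 / r * Cmod h * e m + 8 / r * e n * Cmod h)%R in T1
        by (field; lra). lra. }
  apply is_lim_seq_spec in He.
  (* Two errors of sizes [8 / r] and [4 / r] times [e n] must fit in [eps / 3], hence
     [36 = 3 * 12]. *)
  assert (Hk : (0 < eps * r / 36)%R) by (apply Rdiv_lt_0_compat; [now apply Rmult_lt_0_compat|lra]).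
  destruct (He (mkposreal _ Hk)) as [n Hn]. specialize (Hn n (le_n n)). simpl in Hn.
  rewrite Rminus_0_r in Hn. apply Rabs_def2 in Hn. destruct Hn as [Hn _].
  assert (Hn' : (12 / r * e n <= eps / 3)%R).
  { replace (eps / 3)%R with (12 / r * (eps * r / 36))%R by (field; lra).
    apply Rmult_le_compat_l; [|lra]. apply Rlt_le, Rdiv_lt_0_compat; lra. }
  specialize (HD n). rewrite is_C_derive_eps in HD.
  destruct (HD (eps / 3)%R ltac:(lra)) as [d [Hd Kd]].
  exists (Rmin d (r / 2)). split; [apply Rmin_case; lra|].
  intros y Hy.
  assert (Hy1 := Rlt_le_trans _ _ _ Hy (Rmin_l _ _)).
  assert (Hy2 := Rlt_le_trans _ _ _ Hy (Rmin_r _ _)).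
  specialize (Kd y Hy1). specialize (HL n (y - c) Hy2).
  replace (c + (y - c)) with y in HL by ring.
  replace (Y y - Y c - (y - c) * l) with
    ((Y y - F n y - (Y c - F n c)) + ((F n y - F n c - (y - c) * D n) + (y - c) * (D n - l))) by ring.
  eapply Rle_trans; [apply Cmod_triangle|].
  eapply Rle_trans; [apply Rplus_le_compat_l, Cmod_triangle|].
  rewrite Cmod_mult. specialize (Hl n).
  assert (H0 := Cmod_ge_0 (y - c)).
  assert (T1 : (8 / r * e n * Cmod (y - c) + Cmod (y - c) * Cmod (D n - l) <= eps / 3 * Cmod (y - c))%R).
  { apply Rle_trans with ((12 / r * e n) * Cmod (y - c))%R; [|apply Rmult_le_compat_r; assumption].
    replace (12 / r * e n)%R with (8 / r * e n + 4 / r * e n)%R by (field; lra). nra. }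
  assert (0 <= eps * Cmod (y - c))%R by (apply Rmult_le_pos; lra). lra.
Qed.

(** * Modified Bernoulli numbers *)

Notation Cfact m := (RtoC (INR (fact m))).

(** Both sides run over the triangle [k + i < N], by rows on the left and by antidiagonals on the
    right. *)
Lemma Csum_exchange (F : nat -> nat -> C) (N : nat) :
  Csum (fun k => Csum (fun i => F k i) (N - k)) N =
  Csum (fun m => Csum (fun k => F k (m - k)%nat) (S m)) N.
Proof.
  induction N as [|N IH]; [reflexivity|].
  change (Csum (fun m => Csum (fun k => F k (m - k)%nat) (S m)) (S N)) with
    (Csum (fun m => Csum (fun k => F k (m - k)%nat) (S m)) N
     + Csum (fun k => F k (N - k)%nat) (S N)).
  rewrite <- IH.
  change (Csum (fun k => Csum (fun i => F k i) (S N - k)) (S N)) with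
    (Csum (fun k => Csum (fun i => F k i) (S N - k)) N + Csum (fun i => F N i) (S N - N)).
  rewrite (Csum_ext _ (fun k => Csum (fun i => F k i) (N - k) + F k (N - k)%nat)).
  - rewrite Csum_plus. replace (S N - N)%nat with 1%nat by lia. simpl.
    replace (N - N)%nat with 0%nat by lia. ring.
  - intros k Hk. replace (S N - k)%nat with (S (N - k)) by lia. reflexivity.
Qed.

(* The coefficient of [t^(m+1)] in
   [exp(-w t) = (1 - exp(-t)) (1/t + sum_k b_k t^k)]. *)
Definition bernoulli_rec (w : C) (b : nat -> C) : Prop :=
  forall m : nat, (- w) ^ S m / Cfact (S m) =
    (- (1)) ^ S m / Cfact (S (S m))
    - Csum (fun k => b k * ((- (1)) ^ S (m - k) / Cfact (S (m - k)))) (S m).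

(* The umbral form of the defining identity: the powers [t^m] are replaced by
   arbitrary weights [c m]. *)
Lemma bernoulli_rec_weighted (w : C) (b c : nat -> C) (N : nat) :
  bernoulli_rec w b ->
  Csum (fun m => c m * ((- w) ^ m / Cfact m)) (S N) =
  Csum (fun m => c m * ((- (1)) ^ m / Cfact (S m))) (S N)
  - Csum (fun k => b k * Csum (fun i => c (k + S i)%nat * ((- (1)) ^ S i / Cfact (S i))) (N - k)) N.
Proof.
  intros H. rewrite !Csum_S_l.
  rewrite (Csum_ext (fun m => c (S m) * ((- w) ^ S m / Cfact (S m)))
    (fun m => c (S m) * ((- (1)) ^ S m / Cfact (S (S m))) -
      Csum (fun k => b k * (c (k + S (m - k))%nat * ((- (1)) ^ S (m - k) / Cfact (S (m - k))))) (S m))).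
  - rewrite Csum_minus.
    rewrite (Csum_ext (fun k => b k * Csum (fun i => c (k + S i)%nat * ((- (1)) ^ S i / Cfact (S i))) (N - k))
      (fun k => Csum (fun i => b k * (c (k + S i)%nat * ((- (1)) ^ S i / Cfact (S i)))) (N - k))).
    + rewrite (Csum_exchange (fun k i => b k * (c (k + S i)%nat * ((- (1)) ^ S i / Cfact (S i))))).
      simpl. unfold Cdiv. replace (1 + 0)%R with 1%R by ring. ring.
    + intros k _. now rewrite Csum_scal.
  - intros m _. rewrite (H m). unfold Cminus. rewrite Cmult_plus_distr_l. f_equal.
    replace (c (S m) * - Csum (fun k => b k * ((- (1)) ^ S (m - k) / Cfact (S (m - k)))) (S m))
      with (- (c (S m) * Csum (fun k => b k * ((- (1)) ^ S (m - k) / Cfact (S (m - k)))) (S m))) by ring.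
    f_equal. rewrite <- Csum_scal. apply Csum_ext. intros k Hk.
    replace (k + S (m - k))%nat with (S m) by lia. ring.
Qed.

(** Course-of-values recursion: a function correct at the arguments below [n]. The last branch is
    [bernoulli_rec] solved for [b_m], whose coefficient [(-1)^1 / 1!] is -1. *)
Fixpoint bernoulli_upto (w : C) (n : nat) : nat -> C :=
  match n with
  | O => fun _ => 0
  | S m => fun k =>
      if (k <? m)%nat then bernoulli_upto w m k
      else (- w) ^ S m / Cfact (S m) - (- (1)) ^ S m / Cfact (S (S m))
        + Csum (fun k => bernoulli_upto w m k * ((- (1)) ^ S (m - k) / Cfact (S (m - k)))) m
  end.

Definition bernoulli (w : C) (k : nat) : C := bernoulli_upto w (S k) k.

Lemma bernoulli_upto_eq (w : C) (n k : nat) :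
  (k < n)%nat -> bernoulli_upto w n k = bernoulli w k.
Proof.
  induction n as [|n IH]; intros Hk; [lia|].
  destruct (Nat.eq_dec k n) as [->|Hne]; [reflexivity|].
  simpl. replace (k <? n)%nat with true by (symmetry; apply Nat.ltb_lt; lia).
  apply IH. lia.
Qed.

Lemma bernoulli_eq (w : C) (m : nat) :
  bernoulli w m = (- w) ^ S m / Cfact (S m) - (- (1)) ^ S m / Cfact (S (S m))
    + Csum (fun k => bernoulli w k * ((- (1)) ^ S (m - k) / Cfact (S (m - k)))) m.
Proof.
  unfold bernoulli at 1. cbn [bernoulli_upto]. rewrite Nat.ltb_irrefl. f_equal.
  apply Csum_ext. intros k Hk. now rewrite bernoulli_upto_eq.
Qed.

Lemma bernoulli_rec_bernoulli (w : C) : bernoulli_rec w (bernoulli w).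
Proof.
  intros m. cbn [Csum]. rewrite (bernoulli_eq w m).
  rewrite Nat.sub_diag.
  replace ((- (1)) ^ 1 / Cfact 1) with (- (1)) by (simpl; field). ring.
Qed.

Lemma Cmod_div_fact_le (z : C) (m : nat) : (Cmod (z / Cfact m) <= Cmod z)%R.
Proof.
  rewrite Cmod_div, Cmod_R by apply RtoC_fact_neq_0.
  assert (H : (1 <= INR (fact m))%R).
  { change 1%R with (INR 1). apply le_INR. assert (T := lt_O_fact m). lia. }
  rewrite Rabs_pos_eq by lra. apply Rle_div_l; [lra|].
  assert (T := Cmod_ge_0 z). nra.
Qed.

Lemma Cmod_pow_m1 (n : nat) : Cmod ((- (1)) ^ n) = 1%R.
Proof. rewrite Cmod_pow, Cmod_m1. apply pow1. Qed.

(** Geometric growth is enough for a positive radius of convergence. With [A = 2 |w| + 4] the two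
    explicit terms of the recursion take at most half of [A ^ S m]; the convolution takes the other
    half, since every factorial in it is at least 2. *)
Lemma Cmod_bernoulli_le (w : C) (m : nat) :
  (Cmod (bernoulli w m) <= (2 * Cmod w + 4) ^ S m)%R.
Proof.
  assert (Hw := Cmod_ge_0 w). set (A := (2 * Cmod w + 4)%R).
  induction m as [m IH] using (well_founded_induction Nat.lt_wf_0).
  rewrite bernoulli_eq.
  assert (B0 : (Cmod w ^ S m + 1 <= A ^ S m / 2)%R).
  { assert (E : (A ^ S m = 2 ^ S m * (Cmod w + 2) ^ S m)%R).
    { rewrite <- Rpow_mult_distr. f_equal. unfold A. ring. }
    rewrite E.
    assert (P1 : (1 <= 2 ^ m)%R) by (apply pow_R1_Rle; lra).
    assert (P2 : (1 <= (Cmod w + 2) ^ m)%R) by (apply pow_R1_Rle; lra).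
    assert (P3 : (Cmod w ^ m <= (Cmod w + 2) ^ m)%R) by (apply pow_incr; lra).
    simpl. replace (2 * 2 ^ m * ((Cmod w + 2) * (Cmod w + 2) ^ m) / 2)%R with
      (2 ^ m * ((Cmod w + 2) * (Cmod w + 2) ^ m))%R by field.
    apply Rle_trans with ((Cmod w + 2) * (Cmod w + 2) ^ m)%R; [nra|].
    assert (P4 : (0 <= (Cmod w + 2) * (Cmod w + 2) ^ m)%R) by (apply Rmult_le_pos; lra).
    rewrite <- (Rmult_1_l ((Cmod w + 2) * _)) at 1. now apply Rmult_le_compat_r. }
  assert (B1 : (Cmod ((- w) ^ S m / Cfact (S m)) <= Cmod w ^ S m)%R).
  { eapply Rle_trans; [apply Cmod_div_fact_le|]. rewrite Cmod_pow, Cmod_opp. lra. }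
  assert (B2 : (Cmod ((- (1)) ^ S m / Cfact (S (S m))) <= 1)%R).
  { eapply Rle_trans; [apply Cmod_div_fact_le|]. rewrite Cmod_pow_m1. lra. }
  assert (B3 : (Cmod (Csum (fun k => bernoulli w k * ((- (1)) ^ S (m - k) / Cfact (S (m - k))))%C m)
    <= A ^ S m / 2)%R).
  { eapply Rle_trans; [apply (Cmod_Csum_le _ (fun k => A ^ S k / 2)%R)|].
    - intros k Hk. rewrite Cmod_mult.
      unfold Rdiv. apply Rmult_le_compat; try apply Cmod_ge_0; [now apply IH|].
      rewrite Cmod_div, Cmod_pow_m1, Cmod_R by apply RtoC_fact_neq_0.
      assert (H : (2 <= INR (fact (S (m - k))))%R).
      { change 2%R with (INR 2). apply le_INR.
        replace (m - k)%nat with (S (m - k - 1)) by lia. rewrite !fact_simpl.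
        assert (T := lt_O_fact (m - k - 1)). nia. }
      rewrite Rabs_pos_eq by lra. unfold Rdiv. rewrite Rmult_1_l. apply Rinv_le_contravar; lra.
    - clear. assert (HA : (2 <= A)%R) by (unfold A; assert (T := Cmod_ge_0 w); lra).
      induction m as [|m IH]; [simpl; lra|].
      cbn [Csum]. rewrite re_plus, re_RtoC.
      assert (P : (0 <= A ^ S m)%R) by (apply pow_le; lra).
      change (A ^ S (S m))%R with (A * A ^ S m)%R. nra. }
  eapply Rle_trans; [apply Cmod_triangle|].
  unfold Cminus. eapply Rle_trans; [apply Rplus_le_compat_r, Cmod_triangle|].
  rewrite Cmod_opp. lra.
Qed.

Lemma C_lim_seq_eps (u : nat -> C) (l : C) :
  @filterlim nat C_UniformSpace u eventually (@locally C_UniformSpace l) <->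
  forall e : R, (0 < e)%R -> exists N, forall n, (N <= n)%nat -> (Cmod (u n - l) < e)%R.
Proof.
  split.
  - intros H e He. apply (H (fun z => (Cmod (z - l) < e)%R)).
    apply locally_Cmod. exists e. split; trivial.
  - intros H P HP. apply locally_Cmod in HP. destruct HP as [e [He HP]].
    destruct (H e He) as [N HN]. exists N. intros n Hn. now apply HP, HN.
Qed.

Lemma C_lim_seq_le (u : nat -> C) (l : C) (e : nat -> R) (N0 : nat) :
  is_lim_seq e 0 -> (forall n, (N0 <= n)%nat -> (Cmod (u n - l) <= e n)%R) ->
  @filterlim nat C_UniformSpace u eventually (@locally C_UniformSpace l).
Proof.
  intros He H. apply C_lim_seq_eps. intros eps Heps.
  apply is_lim_seq_spec in He. destruct (He (mkposreal eps Heps)) as [N HN].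
  exists (max N N0). intros n Hn. eapply Rle_lt_trans; [apply H; lia|].
  specialize (HN n ltac:(lia)). simpl in HN. rewrite Rminus_0_r in HN.
  now apply Rabs_def2 in HN.
Qed.

Lemma sum_n_Csum (f : nat -> C) (n : nat) : @sum_n C_AbelianMonoid f n = Csum f (S n).
Proof.
  induction n as [|n IH].
  - rewrite sum_O. simpl. ring.
  - rewrite sum_Sn, IH. reflexivity.
Qed.

(** The umbral identity with weights [t^m]: after clearing the denominator, the partial sums of the
    generating function miss the exponential only by Taylor remainders, and no product of series has
    to be formed. *)
Lemma modified_bernoulli_remainder (w t : C) (N : nat) :
  t <> 0 ->
  (1 / t + Csum (fun k => bernoulli w k * t ^ k) N) * (1 - Cexp (- t)) - Cexp (- (w * t)) =
  - (Cexp_rem (S (S N)) (- t) / t)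
  - Csum (fun k => bernoulli w k * (t ^ k * Cexp_rem (S (N - k)) (- t))) N
  - Cexp_rem (S N) (- (w * t)).
Proof.
  intros Ht.
  assert (HW := bernoulli_rec_weighted w (bernoulli w) (fun m => t ^ m) N (bernoulli_rec_bernoulli w)).
  cbv beta in HW.
  assert (E1 : Csum (fun m => t ^ m * ((- w) ^ m / Cfact m)) (S N) =
    Cexp (- (w * t)) - Cexp_rem (S N) (- (w * t))).
  { unfold Cexp_rem. ring_simplify. apply Csum_ext. intros m _.
    replace (- (w * t)) with (t * - w) by ring. rewrite Cpow_mult_l. unfold Cdiv. ring. }
  assert (E2 : t * Csum (fun m => t ^ m * ((- (1)) ^ m / Cfact (S m))) (S N) =
    1 - Cexp (- t) + Cexp_rem (S (S N)) (- t)).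
  { unfold Cexp_rem. rewrite (Csum_S_l _ (S N)).
    rewrite (Csum_ext (fun k => (- t) ^ S k / Cfact (S k))
      (fun k => - (1) * (t * (t ^ k * ((- (1)) ^ k / Cfact (S k)))))).
    - rewrite !Csum_scal. replace ((- t) ^ 0 / Cfact 0) with (RtoC 1) by (simpl; field). ring.
    - intros k _. rewrite Cpow_S. replace (- t) with (t * - (1)) at 2 by ring.
      rewrite Cpow_mult_l. unfold Cdiv. ring. }
  assert (E3 : forall k, t ^ k * (1 - Cexp (- t)) =
    - Csum (fun i => t ^ (k + S i) * ((- (1)) ^ S i / Cfact (S i))) (N - k)
    - t ^ k * Cexp_rem (S (N - k)) (- t)).
  { intros k. unfold Cexp_rem. rewrite Csum_S_l.
    rewrite (Csum_ext (fun i => t ^ (k + S i) * ((- (1)) ^ S i / Cfact (S i)))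
      (fun i => t ^ k * ((- t) ^ S i / Cfact (S i)))).
    - rewrite Csum_scal. replace ((- t) ^ 0 / Cfact 0) with (RtoC 1) by (simpl; field). ring.
    - intros i _. replace (- t) with (t * - (1)) by ring.
      rewrite Cpow_mult_l, Cpow_add_r. unfold Cdiv. ring. }
  rewrite E1 in HW.
  replace (Cexp (- (w * t))) with
    (Cexp (- (w * t)) - Cexp_rem (S N) (- (w * t)) + Cexp_rem (S N) (- (w * t))) at 1 by ring.
  rewrite HW.
  replace (Csum (fun m => t ^ m * ((- (1)) ^ m / Cfact (S m))) (S N)) with
    ((1 - Cexp (- t) + Cexp_rem (S (S N)) (- t)) / t) by (rewrite <- E2; field; exact Ht).
  rewrite Cmult_plus_distr_r, (Cmult_comm (Csum _ N)), <- Csum_scal.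
  rewrite (Csum_ext (fun k => (1 - Cexp (- t)) * (bernoulli w k * t ^ k))
    (fun k => - (1) * (bernoulli w k * Csum (fun i => t ^ (k + S i) * ((- (1)) ^ S i / Cfact (S i))) (N - k))
      - bernoulli w k * (t ^ k * Cexp_rem (S (N - k)) (- t)))).
  - rewrite Csum_minus, Csum_scal. field. exact Ht.
  - intros k _. rewrite <- (Cmult_1_l (bernoulli w k * Csum _ _)).
    replace ((1 - Cexp (- t)) * (bernoulli w k * t ^ k)) with
      (bernoulli w k * (t ^ k * (1 - Cexp (- t)))) by ring.
    rewrite E3. ring.
Qed.

Lemma modified_bernoulli_exists (w : C) : is_modified_bernoulli w (bernoulli w).
Proof.
  assert (Hw := Cmod_ge_0 w). set (A := (2 * Cmod w + 4)%R).
  assert (HA : (4 <= A)%R) by (unfold A; lra).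
  (* This radius makes [q = A |t| <= 1/4], so that the factor [N + 2 <= 2 ^ S N] from the number of
     remainders is absorbed and geometric decay of ratio 1/2 is left. *)
  apply locally_Cmod. exists (/ (4 * A))%R.
  split; [apply Rinv_0_lt_compat; lra|].
  intros t Hd Ht. replace (t - 0) with t in Hd by ring.
  assert (Ht0 : (0 < Cmod t)%R) by now apply Cmod_gt_0.
  assert (HAt : (A * Cmod t <= / 4)%R).
  { replace (/ 4)%R with (A * / (4 * A))%R by (field; lra). apply Rmult_le_compat_l; lra. }
  assert (Hxt : (Cmod t <= / 16)%R) by nra.
  set (q := (A * Cmod t)%R) in *.
  assert (Hq : (0 < q)%R) by (unfold q; nra).
  assert (Htq : (Cmod t <= q)%R) by (unfold q; nra).
  assert (Hwtq : (Cmod w * Cmod t <= q)%R) by (unfold q, A; nra).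
  assert (He3 : forall z, (Cmod z <= 1)%R -> (exp (Cmod z) <= 3)%R).
  { intros z Hz. apply Rle_trans with (exp 1); [now apply exp_le|exact exp_le_3]. }
  (* If [exp(-t) = 1], the second-order remainder at [-t] would be [t] itself, yet it is at most
     [3 |t|^2], which is too small for [|t| <= 1/16]. *)
  assert (Hden : 1 - Cexp (- t) <> 0).
  { intros E.
    assert (R2 := Cmod_Cexp_rem 2 (- t)). rewrite Cmod_opp in R2.
    assert (R2' := He3 t ltac:(lra)).
    replace (Cexp_rem 2 (- t)) with t in R2.
    2:{ unfold Cexp_rem. simpl. replace (Cexp (- t)) with (1 - (1 - Cexp (- t))) by ring.
        rewrite E. field. }
    simpl in R2. rewrite Rmult_1_r in R2.
    assert (Cmod t * Cmod t * exp (Cmod t) <= Cmod t * Cmod t * 3)%R by (apply Rmult_le_compat_l; nra).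
    nra. }
  assert (HB : forall N,
    (Cmod ((1 / t + Csum (fun k => bernoulli w k * t ^ k) N) * (1 - Cexp (- t)) - Cexp (- (w * t)))%C
     <= 3 * (/ 2) ^ S N)%R).
  { intros N. rewrite modified_bernoulli_remainder by assumption.
    assert (Hqn : forall n, (0 <= q ^ n)%R) by (intros n; apply pow_le; lra).
    assert (B1 : (Cmod (Cexp_rem (S (S N)) (- t) / t) <= 3 * q ^ S N)%R).
    { rewrite Cmod_div by assumption. apply Rle_div_l; [assumption|].
      eapply Rle_trans; [apply Cmod_Cexp_rem|]. rewrite Cmod_opp.
      change (Cmod t ^ S (S N))%R with (Cmod t * Cmod t ^ S N)%R.
      assert (P := pow_incr (Cmod t) q (S N) ltac:(lra)).
      assert (P0 : (0 <= Cmod t ^ S N)%R) by (apply pow_le; lra).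
      replace (3 * q ^ S N * Cmod t)%R with (Cmod t * q ^ S N * 3)%R by ring.
      apply Rmult_le_compat; [nra|apply Rlt_le, exp_pos|nra|apply He3; lra]. }
    assert (B3 : (Cmod (Cexp_rem (S N) (- (w * t))) <= 3 * q ^ S N)%R).
    { eapply Rle_trans; [apply Cmod_Cexp_rem|]. rewrite Cmod_opp, Rmult_comm.
      apply Rmult_le_compat; [apply Rlt_le, exp_pos|apply pow_le, Cmod_ge_0| |].
      - apply He3. rewrite Cmod_mult. lra.
      - apply pow_incr. split; [apply Cmod_ge_0|]. now rewrite Cmod_mult. }
    assert (B2 : (Cmod (Csum (fun k => bernoulli w k * (t ^ k * Cexp_rem (S (N - k)) (- t)))%C N)
      <= INR N * (3 * q ^ S N))%R).
    { eapply Rle_trans; [apply (Cmod_Csum_le _ (fun _ => 3 * q ^ S N)%R)|].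
      - intros k Hk. rewrite !Cmod_mult, Cmod_pow.
        assert (P1 := Cmod_bernoulli_le w k). fold A in P1.
        assert (P2 := Cmod_Cexp_rem (S (N - k)) (- t)). rewrite Cmod_opp in P2.
        assert (P3 : (A ^ S k <= A ^ S N)%R) by (apply Rle_pow; [lra|lia]).
        apply Rle_trans with (A ^ S N * (Cmod t ^ k * (Cmod t ^ S (N - k) * 3)))%R.
        + apply Rmult_le_compat; [apply Cmod_ge_0| |lra|].
          * apply Rmult_le_pos; [apply pow_le; lra|apply Cmod_ge_0].
          * apply Rmult_le_compat_l; [apply pow_le; lra|].
            eapply Rle_trans; [exact P2|]. apply Rmult_le_compat_l; [apply pow_le; lra|].
            apply He3. lra.
        + unfold q. rewrite Rpow_mult_distr.
          replace (S N) with (k + S (N - k))%nat at 3 by lia. rewrite pow_add. lra.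
      - assert (T : forall (x : R) j, Re (Csum (fun _ => RtoC x) j) = (INR j * x)%R).
        { intros x j. induction j as [|j IH]; [simpl; ring|].
          cbn [Csum]. rewrite re_plus, IH, re_RtoC, S_INR. ring. }
        rewrite T. apply Rle_refl. }
    unfold Cminus. eapply Rle_trans; [apply Cmod_triangle|]. rewrite Cmod_opp.
    eapply Rle_trans; [apply Rplus_le_compat_r, Cmod_triangle|]. rewrite !Cmod_opp.
    apply Rle_trans with ((INR N + 2) * (3 * q ^ S N))%R; [lra|].
    assert (P1 : (INR N + 2 <= 2 ^ S N)%R).
    { clear. induction N as [|N IH]; [simpl; lra|].
      rewrite S_INR. change (2 ^ S (S N))%R with (2 * 2 ^ S N)%R. assert (T := pos_INR N). lra. }
    assert (P2 : (q ^ S N <= (/ 2) ^ S N * (/ 2) ^ S N)%R).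
    { rewrite <- Rpow_mult_distr. apply pow_incr. lra. }
    apply Rle_trans with (2 ^ S N * (3 * ((/ 2) ^ S N * (/ 2) ^ S N)))%R.
    - apply Rmult_le_compat; [assert (T := pos_INR N); lra| |assumption|].
      + specialize (Hqn (S N)). lra.
      + lra.
    - assert (E : (2 ^ S N * (/ 2) ^ S N = 1)%R).
      { rewrite <- Rpow_mult_distr. replace (2 * / 2)%R with 1%R by field. apply pow1. }
      apply Req_le. replace (2 ^ S N * (3 * ((/ 2) ^ S N * (/ 2) ^ S N)))%R with
        (3 * (2 ^ S N * (/ 2) ^ S N) * (/ 2) ^ S N)%R by ring. rewrite E. ring. }
  unfold is_pseries, is_series.
  assert (Hm : (0 < Cmod (1 - Cexp (- t)))%R) by now apply Cmod_gt_0.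
  apply (C_lim_seq_le _ _ (fun n => 3 / Cmod (1 - Cexp (- t)) * (/ 2) ^ n)%R 0).
  - replace (Finite 0) with (Rbar_mult (3 / Cmod (1 - Cexp (- t)))%R 0) by (simpl; f_equal; ring).
    apply is_lim_seq_scal_l, is_lim_seq_geom. rewrite Rabs_pos_eq; lra.
  - intros n _. rewrite (sum_n_Csum (fun k => scal (pow_n t k) (bernoulli w k))).
    rewrite (Csum_ext _ (fun k => bernoulli w k * t ^ k)).
    2:{ intros k _. apply Cmult_comm. }
    specialize (HB (S n)).
    replace (Csum (fun k => bernoulli w k * t ^ k) (S n) - (Cexp (- (w * t)) / (1 - Cexp (- t)) - 1 / t))
      with (((1 / t + Csum (fun k => bernoulli w k * t ^ k) (S n)) * (1 - Cexp (- t)) - Cexp (- (w * t)))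
        / (1 - Cexp (- t))) by (field; split; assumption).
    rewrite Cmod_div by assumption. unfold Rdiv.
    replace (3 * / Cmod (1 - Cexp (- t)) * (/ 2) ^ n)%R with (3 * (/ 2) ^ n * / Cmod (1 - Cexp (- t)))%R by ring.
    apply Rmult_le_compat_r; [apply Rlt_le, Rinv_0_lt_compat; assumption|].
    eapply Rle_trans; [exact HB|]. simpl.
    assert (0 < (/ 2) ^ n)%R by (apply pow_lt; lra). lra.
Qed.

(** * Uniqueness of the modified Bernoulli numbers *)

Lemma pseries_punctured_eq_0 (a : nat -> R) (d : R) :
  (0 < d)%R -> (forall t : R, (0 < Rabs t < d)%R -> is_pseries a t 0) -> forall n, a n = 0%R.
Proof.
  intros Hd H n.
  assert (Hr : Rbar_lt 0 (CV_radius a)).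
  (* Convergence at the single point [d / 2] bounds the terms there, and hence the radius from
     below. *)
  { apply Rbar_lt_le_trans with (Finite (d / 2)); [simpl; lra|].
    apply (CV_radius_bounded a).
    assert (Hs : ex_series (fun k => a k * (d / 2) ^ k)%R).
    { exists 0%R. assert (T := H (d / 2)%R). rewrite Rabs_pos_eq in T by lra.
      specialize (T ltac:(lra)). revert T. apply is_series_ext. intros k.
      rewrite pow_n_pow. apply Rmult_comm. }
    apply ex_series_lim_0 in Hs.
    destruct (filterlim_bounded (K := R_AbsRing) (V := R_NormedModule) (fun k => a k * (d / 2) ^ k)%R) as [M HM].
    - exists 0%R. exact Hs.
    - exists M. exact HM. }
  (* The hypothesis omits [t = 0], where the generating function has no value, so [a 0] is recovered
     by continuity of the sum. *)
  assert (H0 : a 0%nat = 0%R).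
  { rewrite <- PSeries_0.
    assert (Hc : continuity_pt (PSeries a) 0) by (apply PSeries_continuity; rewrite Rabs_R0; exact Hr).
    apply NNPP. intros Hne.
    destruct (Hc (Rabs (PSeries a 0))) as [e [He Ke]]; [now apply Rabs_pos_lt|].
    set (t := (Rmin d e / 2)%R).
    assert (Hm : (0 < Rmin d e)%R) by (now apply Rmin_case).
    assert (Hm1 := Rmin_l d e). assert (Hm2 := Rmin_r d e).
    specialize (Ke t). unfold dist in Ke. simpl in Ke. unfold Rdist in Ke.
    rewrite Rminus_0_r, Rabs_pos_eq in Ke by (unfold t; lra).
    assert (E : PSeries a t = 0%R).
    { apply is_pseries_unique, H. rewrite Rabs_pos_eq; unfold t; lra. }
    rewrite E, Rminus_0_l, Rabs_Ropp in Ke.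
    apply (Rlt_irrefl (Rabs (PSeries a 0))). apply Ke. split; [|unfold t; lra].
    split; [exact I|]. unfold t. lra. }
  apply (PSeries_ext_recip a (fun _ => 0%R)); trivial.
  - now rewrite CV_radius_const_0.
  - exists (mkposreal d Hd). intros t Ht.
    rewrite PSeries_const_0.
    destruct (Req_dec t 0) as [->|Hne]; [now rewrite PSeries_0|].
    apply is_pseries_unique, H. split; [now apply Rabs_pos_lt|].
    change (Rabs (t - 0) < d)%R in Ht. now rewrite Rminus_0_r in Ht.
Qed.

(** Restricting to real [t] and splitting the coefficients into real and imaginary parts reduces the
    claim to real power series. *)
Lemma modified_bernoulli_unique (w : C) (b b' : nat -> C) (n : nat) :
  is_modified_bernoulli w b -> is_modified_bernoulli w b' -> b n = b' n.
Proof.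
  intros H H'. apply locally_Cmod in H. apply locally_Cmod in H'.
  destruct H as [d [Hd H]]. destruct H' as [d' [Hd' H']].
  set (e := Rmin d d').
  assert (He : (0 < e)%R) by (unfold e; now apply Rmin_case).
  assert (HD : forall t : R, (0 < Rabs t < e)%R ->
    @is_pseries C_AbsRing C_NormedModule (fun k => b k - b' k) (RtoC t) (RtoC 0)).
  { intros t [Ht1 Ht2].
    assert (Hm1 := Rmin_l d d'). assert (Hm2 := Rmin_r d d'). fold e in Hm1, Hm2.
    assert (Hc : Cmod (RtoC t - 0) = Rabs t) by (replace (RtoC t - 0) with (RtoC t) by ring; apply Cmod_R).
    assert (Hne : RtoC t <> 0).
    { apply RtoC_inj_neq. intros ->. rewrite Rabs_R0 in Ht1. lra. }
    assert (S1 := H (RtoC t) ltac:(rewrite Hc; lra) Hne).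
    assert (S2 := H' (RtoC t) ltac:(rewrite Hc; lra) Hne).
    assert (S3 := is_pseries_minus _ _ _ _ _ S1 S2).
    match type of S3 with is_pseries _ _ ?v => assert (E : v = RtoC 0) by apply Cplus_opp_r end.
    rewrite E in S3. exact S3. }
  (* A real-linear form that does not increase the modulus commutes with the partial sums and with
     their limit; it will be [Re], then [Im]. *)
  assert (HP : forall p : C -> R, p 0 = 0%R -> (forall (x : R) z, p (RtoC x * z) = (x * p z)%R) ->
    (forall y z, p (y + z) = (p y + p z)%R) -> (forall z, (Rabs (p z) <= Cmod z)%R) ->
    p (b n - b' n) = 0%R).
  { intros p p0 ps pa pn.
    apply (pseries_punctured_eq_0 (fun k => p (b k - b' k)) e); trivial.
    intros t Ht. specialize (HD t Ht).
    unfold is_pseries, is_series in *. assert (HD' := proj1 (C_lim_seq_eps _ (RtoC 0)) HD). clear HD.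
    apply (is_lim_seq_spec _ 0). intros eps. destruct (HD' eps (cond_pos eps)) as [N HN].
    exists N. intros m Hm. specialize (HN m Hm). eapply Rle_lt_trans; [|exact HN].
    rewrite (sum_n_Csum (fun k => scal (pow_n (RtoC t) k) (b k - b' k))).
    eapply Rle_trans; [|apply pn]. apply Req_le. f_equal.
    replace (Csum (fun k => scal (pow_n (RtoC t) k) (b k - b' k)) (S m) - 0) with
      (Csum (fun k => RtoC (t ^ k) * (b k - b' k)) (S m)).
    2:{ unfold Cminus at 2. rewrite Copp_0, Cplus_0_r. apply Csum_ext. intros k _.
        now rewrite RtoC_pow. }
    rewrite Rminus_0_r. clear HN Hm. induction m as [|m IH].
    - rewrite sum_O. cbn [Csum]. rewrite pa, ps, p0, pow_n_pow.
      unfold scal. simpl. unfold mult. simpl. ring.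
    - rewrite sum_Sn, IH. cbn [Csum]. rewrite (pa _ (RtoC (t ^ S m) * _)), ps. reflexivity. }
  assert (HRe := HP Re eq_refl re_scal_l re_plus re_le_Cmod).
  assert (HIm := HP Im eq_refl im_scal_l im_plus im_le_Cmod).
  apply Ceq_minus. apply injective_projections; assumption.
Qed.

Lemma modified_bernoulli_eq (w : C) (n : nat) : modified_bernoulli n w = bernoulli w n.
Proof.
  apply (modified_bernoulli_unique w).
  - apply (epsilon_spec (inhabits (fun _ : nat => RtoC 0)) (is_modified_bernoulli w)).
    exists (bernoulli w). apply modified_bernoulli_exists.
  - apply modified_bernoulli_exists.
Qed.

(** * The binomial series with remainder *)

(** The factor is peeled off at [s], with [s + 1] below it, to match differentiation of
    [(1 + v)^(-s)], which yields [-s (1 + v)^(-(s+1))]. *)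
Fixpoint poch (s : C) (k : nat) : C :=
  match k with
  | O => 1
  | S j => s * poch (s + 1) j
  end.

Fixpoint dpoch (s : C) (k : nat) : C :=
  match k with
  | O => 0
  | S j => poch (s + 1) j + s * dpoch (s + 1) j
  end.

Lemma is_C_derive_poch (k : nat) (s : C) : is_C_derive (fun y => poch y k) s (dpoch s k).
Proof.
  revert s. induction k as [|k IH]; intros s; simpl.
  - apply is_C_derive_const.
  - eapply C_derive_eq; [|apply is_C_derive_mult; [apply is_C_derive_id|]].
    2:{ apply (is_C_derive_comp (fun y => poch y k) (fun y => y + 1)); [apply IH|].
        apply is_C_derive_plus; [apply is_C_derive_id|apply is_C_derive_const]. }
    cbv beta. ring.
Qed.

Lemma poch_add (k m : nat) (s : C) :
  poch s (k + m) = poch s k * poch (s + RtoC (INR k)) m.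
Proof.
  revert s. induction k as [|k IH]; intros s.
  - simpl. replace (s + 0) with s by ring. ring.
  - change (S k + m)%nat with (S (k + m)). cbn [poch]. rewrite IH, S_INR, RtoC_plus.
    replace (s + 1 + RtoC (INR k)) with (s + (RtoC (INR k) + 1)) by ring. ring.
Qed.

Definition pow_rem (M : nat) (s v : C) : C :=
  Cpower (1 + v) (- s) - Csum (fun m => poch s m * ((- v) ^ m / Cfact m)) M.

Lemma Re_1_plus_pos (t : R) (v : C) :
  (0 <= t)%R -> (0 <= Re v)%R -> (1 <= Re (1 + RtoC t * v))%R.
Proof. intros Ht Hv. rewrite re_plus, re_scal_l, re_RtoC. nra. Qed.

Lemma is_path_derive_Cpower_line (s v : C) (t : R) :
  (0 <= t)%R -> (0 <= Re v)%R ->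
  is_path_derive (fun u => Cpower (1 + RtoC u * v) (- s)) t
    (- s * v * Cpower (1 + RtoC t * v) (- (s + 1))).
Proof.
  intros Ht Hv. assert (HR := Re_1_plus_pos t v Ht Hv).
  set (z := 1 + RtoC t * v) in *.
  assert (Hz : z <> 0) by (intros E; rewrite E in HR; simpl in HR; lra).
  replace (- s * v * Cpower z (- (s + 1))) with (v / z * (- s * Cpower z (- s))).
  2:{ replace (- (s + 1)) with (- s + - RtoC (INR 1)) by (simpl; ring).
      rewrite Cpower_plus, Cpower_opp_INR, Cpow_1_r by assumption. field. exact Hz. }
  apply (is_path_derive_comp (fun y => Cexp (- s * y)) (fun u => Clog (1 + RtoC u * v))).
  - apply (is_C_derive_comp Cexp (fun y => - s * y)); [apply is_C_derive_Cexp|].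
    eapply C_derive_eq; [|apply is_C_derive_mult; [apply is_C_derive_const|apply is_C_derive_id]].
    cbv beta. ring.
  - apply is_path_derive_Clog_line. fold z. lra.
Qed.

Lemma is_C_derive_binomial_sum (s y : C) (M : nat) :
  is_C_derive (fun v => Csum (fun m => poch s m * ((- v) ^ m / Cfact m)) (S M)) y
    (- s * Csum (fun m => poch (s + 1) m * ((- y) ^ m / Cfact m)) M).
Proof.
  eapply is_C_derive_ext; [intros v; symmetry; apply Csum_S_l|].
  eapply C_derive_eq.
  2:{ apply is_C_derive_plus.
      - apply (is_C_derive_const (poch s 0 * (1 / Cfact 0))).
      - apply (is_C_derive_Csum (fun m v => poch s (S m) * ((- v) ^ S m / Cfact (S m)))
             (fun m v => - s * (poch (s + 1) m * ((- v) ^ m / Cfact m)))).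
        intros m _. eapply C_derive_eq.
        2:{ apply is_C_derive_mult; [apply is_C_derive_const|].
            apply is_C_derive_mult; [|apply is_C_derive_const].
            apply (is_C_derive_comp (fun z => z ^ S m) (fun z => - z)); [apply is_C_derive_pow|].
            apply is_C_derive_opp, is_C_derive_id. }
        cbv beta. cbn [poch]. rewrite RtoC_fact_S. field.
        split; [apply RtoC_fact_neq_0|apply RtoC_S_neq_0]. }
  rewrite Csum_scal. ring.
Qed.

(* Differentiating [t |-> pow_rem (S M) s (t v)] gives [- s v pow_rem M (s + 1) (t v)]. *)
Lemma pow_rem_bound (M : nat) (B V : R) :
  (0 <= V)%R -> exists K, (0 <= K)%R /\ forall s v : C,
    (Cmod s <= B)%R -> (Cmod v <= V)%R -> (0 <= Re v)%R ->
    (Cmod (pow_rem M s v) <= K * Cmod v ^ M)%R.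
Proof.
  intros HV. revert B. induction M as [|M IH]; intros B.
  (* The modulus of [Clog (1 + v)] is at most [|1 + v| + 2], hence at most [V + 3]. *)
  - exists (exp (B * (V + 3))). split; [apply Rlt_le, exp_pos|].
    intros s v Hs Hv HR. unfold pow_rem, Cpower. simpl Csum.
    replace (Cexp (- s * Clog (1 + v)) - 0) with (Cexp (- s * Clog (1 + v))) by ring.
    simpl. rewrite Rmult_1_r. eapply Rle_trans; [apply Cmod_Cexp_le|]. apply exp_le.
    rewrite Cmod_mult, Cmod_opp.
    assert (HR1 := Re_1_plus_pos 1 v ltac:(lra) HR). rewrite Cmult_1_l in HR1.
    assert (HC1 : (1 <= Cmod (1 + v))%R).
    { eapply Rle_trans; [exact HR1|]. eapply Rle_trans; [apply Rle_abs|apply re_le_Cmod]. }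
    apply Rmult_le_compat; try apply Cmod_ge_0; [assumption|].
    eapply Rle_trans; [apply Cmod_Clog_le; lra|].
    assert (T := Cmod_triangle 1 v). rewrite Cmod_1 in T. lra.
  (* The derivative involves the exponent [s + 1], so the bound on [|s|] must be free to grow along
     the induction. *)
  - destruct (IH (B + 1)%R) as [K [HK HI]].
    exists (Rabs B * K)%R. split; [apply Rmult_le_pos; [apply Rabs_pos|assumption]|].
    intros s v Hs Hv HR.
    assert (HB : (B <= Rabs B)%R) by apply Rle_abs.
    replace (pow_rem (S M) s v) with (pow_rem (S M) s (RtoC 1 * v) - pow_rem (S M) s (RtoC 0 * v)).
    2:{ rewrite Cmult_1_l, Cmult_0_l.
        replace (pow_rem (S M) s 0) with (RtoC 0); [ring|].
        unfold pow_rem, Cpower. rewrite Csum_S_l, Cplus_0_r, Clog_RtoC, ln_1, Cmult_0_r, Cexp_0 by lra.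
        rewrite (Csum_ext _ (fun k => 0 * 0)).
        - rewrite Csum_scal. simpl. field.
        - intros k _. rewrite Copp_0, Cpow_S. unfold Cdiv. rewrite !Cmult_0_l. ring. }
    apply (path_mean_value (fun t => pow_rem (S M) s (RtoC t * v))
             (fun t => - s * v * pow_rem M (s + 1) (RtoC t * v))).
    intros t Ht. split.
    + unfold pow_rem.
      replace (- s * v * (Cpower (1 + RtoC t * v) (- (s + 1)) -
          Csum (fun m => poch (s + 1) m * ((- (RtoC t * v)) ^ m / Cfact m)) M))
        with (- s * v * Cpower (1 + RtoC t * v) (- (s + 1)) -
          v * (- s * Csum (fun m => poch (s + 1) m * ((- (RtoC t * v)) ^ m / Cfact m)) M)) by ring.
      apply is_path_derive_minus; [apply is_path_derive_Cpower_line; [lra|assumption]|].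
      apply (is_path_derive_comp (fun y => Csum (fun m => poch s m * ((- y) ^ m / Cfact m)) (S M))
               (fun u => RtoC u * v)).
      * apply is_C_derive_binomial_sum.
      * destruct (is_path_derive_line 0 v t) as [H1 H2].
        split; [revert H1|revert H2]; apply is_derive_ext; intros u; now rewrite Cplus_0_l.
    + rewrite !Cmod_mult, Cmod_opp.
      assert (Hsc := Cmod_scal_le t v Ht).
      assert (T : (Cmod (pow_rem M (s + 1) (RtoC t * v)) <= K * Cmod v ^ M)%R).
      { eapply Rle_trans; [apply HI|].
        - eapply Rle_trans; [apply Cmod_triangle|]. rewrite Cmod_1. lra.
        - lra.
        - rewrite re_scal_l. nra.
        - apply Rmult_le_compat_l; [assumption|]. apply pow_incr. split; [apply Cmod_ge_0|assumption]. }
      assert (H0 := Cmod_ge_0 s). assert (H1 := Cmod_ge_0 v).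
      replace (Rabs B * K * Cmod v ^ S M)%R with (Rabs B * Cmod v * (K * Cmod v ^ M))%R by (simpl; ring).
      apply Rmult_le_compat; [nra|apply Cmod_ge_0|apply Rmult_le_compat_r; lra|exact T].
Qed.

(** * The Euler-Maclaurin approximants of the Hurwitz zeta function *)

(* [(s - 1)] times the approximant, so that the function is entire. *)
Definition hurwitz_approx (w : C) (N n : nat) (s : C) : C :=
  (s - 1) * Csum (fun k => Cpower (RtoC (INR k) + w) (- s)) n
  + Cpower (RtoC (INR n)) (1 - s)
  + (s - 1) * Csum (fun k => bernoulli w k * (poch s k * Cpower (RtoC (INR n)) (- (s + RtoC (INR k))))) N.

Lemma Cpower_INR_succ (n : nat) (a : C) :
  (1 <= n)%nat ->
  Cpower (RtoC (INR (S n))) a = Cpower (RtoC (INR n)) a * Cpower (1 + / RtoC (INR n)) a.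
Proof.
  intros Hn. assert (Hx : (0 < INR n)%R) by (apply lt_0_INR; lia).
  rewrite <- Cpower_scal; trivial.
  - f_equal. rewrite S_INR, RtoC_plus. field. apply RtoC_inj_neq. lra.
  - rewrite <- RtoC_inv by lra. rewrite <- RtoC_plus, re_RtoC.
    assert (0 < / INR n)%R by now apply Rinv_0_lt_compat. lra.
Qed.

Lemma Cpower_INR_shift (n : nat) (w a : C) :
  (1 <= n)%nat -> (0 < Re w)%R ->
  Cpower (RtoC (INR n) + w) a = Cpower (RtoC (INR n)) a * Cpower (1 + w * / RtoC (INR n)) a.
Proof.
  intros Hn Hw. assert (Hx : (0 < INR n)%R) by (apply lt_0_INR; lia).
  rewrite <- Cpower_scal; trivial.
  - f_equal. field. apply RtoC_inj_neq. lra.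
  - rewrite <- RtoC_inv, re_plus, re_scal_r, re_RtoC by lra.
    assert (0 < / INR n)%R by now apply Rinv_0_lt_compat. nra.
Qed.

Lemma pow_rem_eq (M : nat) (s v : C) :
  Cpower (1 + v) (- s) = Csum (fun m => poch s m * ((- v) ^ m / Cfact m)) M + pow_rem M s v.
Proof. unfold pow_rem. ring. Qed.

(** With [n^(-s)] factored out, all polynomial parts cancel by [bernoulli_rec_weighted] with weights
    [(s)_m u^m]. The orders of the remainders are chosen so that each of the three terms in the
    bracket is [O(u^(N+1))]. *)
Lemma hurwitz_approx_step (w : C) (N n : nat) (s : C) :
  (1 <= n)%nat -> (0 < Re w)%R ->
  let x := RtoC (INR n) in
  let u := / x in
  hurwitz_approx w N (S n) s - hurwitz_approx w N n s =
  Cpower x (- s) *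
  ((s - 1) * pow_rem (S N) s (w * u)
   + x * pow_rem (S (S N)) (s - 1) u
   + (s - 1) * Csum (fun k => bernoulli w k * (poch s k * u ^ k *
        pow_rem (S (N - k)) (s + RtoC (INR k)) u)) N).
Proof.
  intros Hn Hw x u.
  assert (Hx : x <> 0) by (apply RtoC_inj_neq; assert (0 < INR n)%R by (apply lt_0_INR; lia); lra).
  set (c := fun m => poch s m * u ^ m).
  assert (HW := bernoulli_rec_weighted w (bernoulli w) c N (bernoulli_rec_bernoulli w)).
  assert (X1 : Cpower x (1 - s) = Cpower x (- s) * x).
  { unfold Cminus. rewrite Cplus_comm, Cpower_plus. f_equal.
    change (RtoC 1) with (RtoC (INR 1)). rewrite Cpower_INR by assumption. ring. }
  assert (Xk : forall k, Cpower x (- (s + RtoC (INR k))) = Cpower x (- s) * u ^ k).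
  { intros k. replace (- (s + RtoC (INR k))) with (- s + - RtoC (INR k)) by ring.
    rewrite Cpower_plus, Cpower_opp_INR by assumption. unfold u. now rewrite Cpow_inv. }
  assert (E1 : Csum (fun m => c m * ((- w) ^ m / Cfact m)) (S N) =
    Csum (fun m => poch s m * ((- (w * u)) ^ m / Cfact m)) (S N)).
  { apply Csum_ext. intros m _. unfold c. replace (- (w * u)) with (- w * u) by ring.
    rewrite Cpow_mult_l. unfold Cdiv. ring. }
  (* The term [x^(1-s)] plays the part of [1/t]: the binomial expansion at [s - 1] produces
     [(s-1) (s)_m], and the lost power of [u] shifts the factorial by one. *)
  assert (E2 : x * (Cpower (1 + u) (1 - s) - 1) =
    - (s - 1) * Csum (fun m => c m * ((- (1)) ^ m / Cfact (S m))) (S N)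
    + x * pow_rem (S (S N)) (s - 1) u).
  { replace (1 - s) with (- (s - 1)) by ring.
    rewrite (pow_rem_eq (S (S N))), Csum_S_l.
    rewrite (Csum_ext (fun k => poch (s - 1) (S k) * ((- u) ^ S k / Cfact (S k)))
      (fun m => - (s - 1) * u * (c m * ((- (1)) ^ m / Cfact (S m))))).
    - rewrite Csum_scal.
      replace (poch (s - 1) 0 * ((- u) ^ 0 / Cfact 0)) with (RtoC 1) by (simpl; field).
      unfold u. field. exact Hx.
    - intros k _. unfold c. cbn [poch]. replace (s - 1 + 1) with s by ring.
      rewrite Cpow_S. replace (- u) with (- (1) * u) at 2 by ring. rewrite Cpow_mult_l.
      unfold Cdiv. ring. }
  assert (E3 : forall k, poch s k * (u ^ k * (Cpower (1 + u) (- (s + RtoC (INR k))) - 1)) =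
    Csum (fun i => c (k + S i)%nat * ((- (1)) ^ S i / Cfact (S i))) (N - k)
    + poch s k * u ^ k * pow_rem (S (N - k)) (s + RtoC (INR k)) u).
  { intros k. rewrite (pow_rem_eq (S (N - k))), Csum_S_l.
    replace (poch (s + RtoC (INR k)) 0 * ((- u) ^ 0 / Cfact 0)) with (RtoC 1) by (simpl; field).
    rewrite (Csum_ext (fun i => c (k + S i)%nat * ((- (1)) ^ S i / Cfact (S i)))
      (fun i => poch s k * u ^ k * (poch (s + RtoC (INR k)) (S i) *
         ((- u) ^ S i / Cfact (S i))))).
    - rewrite Csum_scal. ring.
    - intros i _. unfold c. rewrite poch_add, Cpow_add_r.
      replace (- u) with (- (1) * u) by ring. rewrite Cpow_mult_l. unfold Cdiv. ring. }
  unfold hurwitz_approx. cbn [Csum].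
  rewrite Cpower_INR_succ, Cpower_INR_shift by assumption. fold x. fold u.
  rewrite (pow_rem_eq (S N) s (w * u)), <- E1, HW.
  rewrite (Csum_ext (fun k => bernoulli w k * (poch s k * Cpower (RtoC (INR (S n))) (- (s + RtoC (INR k)))))
    (fun k => bernoulli w k * (poch s k * Cpower x (- (s + RtoC (INR k)))) +
      Cpower x (- s) * (bernoulli w k * Csum (fun i => c (k + S i)%nat *
          ((- (1)) ^ S i / Cfact (S i))) (N - k)
        + bernoulli w k * (poch s k * u ^ k * pow_rem (S (N - k)) (s + RtoC (INR k)) u)))).
  - rewrite Csum_plus, Csum_scal, Csum_plus, X1.
    replace (x * pow_rem (S (S N)) (s - 1) u) with
      (x * (Cpower (1 + u) (1 - s) - 1) +
        (s - 1) * Csum (fun m => c m * ((- (1)) ^ m / Cfact (S m))) (S N))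
      by (rewrite E2; ring).
    ring.
  - intros k _. rewrite Cpower_INR_succ by assumption. fold x. fold u.
    rewrite <- Cmult_plus_distr_l, <- E3, Xk. ring.
Qed.

Lemma poch_bound (k : nat) (B : R) :
  exists P, (0 <= P)%R /\ forall s, (Cmod s <= B)%R -> (Cmod (poch s k) <= P)%R.
Proof.
  revert B. induction k as [|k IH]; intros B.
  - exists 1%R. split; [lra|]. intros s _. simpl. rewrite Cmod_1. lra.
  - destruct (IH (B + 1)%R) as [P [HP H]]. exists (Rabs B * P)%R.
    split; [apply Rmult_le_pos; [apply Rabs_pos|assumption]|].
    intros s Hs. cbn [poch]. rewrite Cmod_mult.
    apply Rmult_le_compat; try apply Cmod_ge_0.
    + eapply Rle_trans; [exact Hs|apply Rle_abs].
    + apply H. eapply Rle_trans; [apply Cmod_triangle|]. rewrite Cmod_1. lra.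
Qed.

(** Moves the existential constant outside the sum while it stays independent of the parameter,
    below a pair of an index and an exponent. *)
Lemma Csum_uniform_bound (X : Type) (P : X -> Prop) (f : nat -> X -> C) (g : X -> R) (n : nat) :
  (forall k, (k < n)%nat -> exists K, (0 <= K)%R /\ forall x, P x -> (Cmod (f k x) <= K * g x)%R) ->
  exists K, (0 <= K)%R /\ forall x, P x -> (Cmod (Csum (fun k => f k x) n) <= K * g x)%R.
Proof.
  induction n as [|n IH]; intros H.
  - exists 0%R. split; [lra|]. intros x _. simpl. rewrite Cmod_0. lra.
  - destruct IH as [K1 [HK1 H1]]; [intros k Hk; apply H; lia|].
    destruct (H n) as [K2 [HK2 H2]]; [lia|].
    exists (K1 + K2)%R. split; [lra|]. intros x Hx. simpl.
    eapply Rle_trans; [apply Cmod_triangle|].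
    specialize (H1 x Hx). specialize (H2 x Hx). lra.
Qed.

Lemma exp_mult_ln (n p : nat) :
  (1 <= n)%nat -> exp (- INR p * ln (INR n)) = ((/ INR n) ^ p)%R.
Proof.
  intros Hn. assert (Hx : (0 < INR n)%R) by (apply lt_0_INR; lia).
  rewrite <- Rpower_pow by now apply Rinv_0_lt_compat.
  unfold Rpower. rewrite ln_Rinv by assumption. f_equal. ring.
Qed.

(** The true size is [n^(-Re s - N - 1)]. It is weakened to an integer power [p] so that later rates
    are plain powers of [1 / n], with one constant for all [|s| <= B]. *)
Lemma hurwitz_approx_step_bound (w : C) (N : nat) (B : R) :
  (0 < Re w)%R -> exists K, (0 <= K)%R /\ forall (n p : nat) (s : C),
    (1 <= n)%nat -> (Cmod s <= B)%R -> (INR p <= Re s + INR (S N))%R ->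
    (Cmod (hurwitz_approx w N (S n) s - hurwitz_approx w N n s) <= K * (/ INR n) ^ p)%R.
Proof.
  intros Hw.
  destruct (pow_rem_bound (S N) B (Cmod w) (Cmod_ge_0 w)) as [K1 [HK1 H1]].
  destruct (pow_rem_bound (S (S N)) (B + 1) 1 ltac:(lra)) as [K2 [HK2 H2]].
  assert (HU : forall n, (1 <= n)%nat -> (0 < / INR n <= 1)%R /\ Cmod (/ RtoC (INR n)) = (/ INR n)%R
    /\ (0 <= Re (/ RtoC (INR n)))%R /\ (1 <= INR n)%R).
  { intros n Hn. assert (Hx : (1 <= INR n)%R) by (change 1%R with (INR 1); now apply le_INR).
    assert (Hi : (0 < / INR n)%R) by (apply Rinv_0_lt_compat; lra).
    rewrite <- RtoC_inv, Cmod_R, Rabs_pos_eq, re_RtoC by lra.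
    repeat split; try lra. rewrite <- Rinv_1. apply Rinv_le_contravar; lra. }
  destruct (Csum_uniform_bound (nat * C) (fun x => (1 <= fst x)%nat /\ (Cmod (snd x) <= B)%R)
    (fun k x => bernoulli w k * (poch (snd x) k * (/ RtoC (INR (fst x))) ^ k *
        pow_rem (S (N - k)) (snd x + RtoC (INR k)) (/ RtoC (INR (fst x)))))
    (fun x => ((/ INR (fst x)) ^ S N)%R) N) as [K3 [HK3 H3]].
  { intros k Hk.
    destruct (poch_bound k B) as [P [HP HPB]].
    destruct (pow_rem_bound (S (N - k)) (B + INR k) 1 ltac:(lra)) as [K [HK HKB]].
    exists (Cmod (bernoulli w k) * (P * K))%R.
    split; [apply Rmult_le_pos; [apply Cmod_ge_0|now apply Rmult_le_pos]|].
    intros [n s] [Hn Hs]. simpl fst in *. simpl snd in *.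
    destruct (HU n Hn) as [U1 [U2 [U3 U4]]].
    rewrite !Cmod_mult, (Rmult_assoc (Cmod (bernoulli w k)) (P * K)).
    apply Rmult_le_compat_l; [apply Cmod_ge_0|].
    rewrite Cmod_pow, U2.
    assert (T : (Cmod (pow_rem (S (N - k)) (s + RtoC (INR k)) (/ RtoC (INR n))) <= K * (/ INR n) ^ S (N - k))%R).
    { rewrite <- U2. apply HKB; [|rewrite U2; lra|assumption].
      eapply Rle_trans; [apply Cmod_triangle|]. rewrite Cmod_R, Rabs_pos_eq by apply pos_INR. lra. }
    replace (S N) with (k + S (N - k))%nat by lia. rewrite pow_add.
    replace (P * K * ((/ INR n) ^ k * (/ INR n) ^ S (N - k)))%R with
      (P * (/ INR n) ^ k * (K * (/ INR n) ^ S (N - k)))%R by ring.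
    assert (Pk : (0 <= (/ INR n) ^ k)%R) by (apply pow_le; lra).
    apply Rmult_le_compat; [apply Rmult_le_pos; [apply Cmod_ge_0|assumption]|apply Cmod_ge_0| |exact T].
    apply Rmult_le_compat_r; [assumption|now apply HPB]. }
  exists ((Rabs B + 1) * (K1 * Cmod w ^ S N) + K2 + (Rabs B + 1) * K3)%R.
  assert (HB0 := Rabs_pos B). assert (HB1 := Rle_abs B).
  assert (Hw0 : (0 <= K1 * Cmod w ^ S N)%R) by (apply Rmult_le_pos; [assumption|apply pow_le, Cmod_ge_0]).
  split; [nra|].
  intros n p s Hn Hs Hp.
  destruct (HU n Hn) as [U1 [U2 [U3 U4]]].
  assert (U5 : (0 <= (/ INR n) ^ S N)%R) by (apply pow_le; lra).
  rewrite hurwitz_approx_step, Cmod_mult, Cmod_Cpower_RtoC by (trivial; lra).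
  assert (HX : (exp (Re (- s) * ln (INR n)) * (/ INR n) ^ S N <= (/ INR n) ^ p)%R).
  { rewrite <- !exp_mult_ln, <- exp_plus by assumption. apply exp_le.
    rewrite re_opp. rewrite <- Rmult_plus_distr_r. apply Rmult_le_compat_r; [|lra].
    rewrite <- ln_1. apply ln_le; lra. }
  assert (Hs1 : (Cmod (s - 1) <= Rabs B + 1)%R).
  { unfold Cminus. eapply Rle_trans; [apply Cmod_triangle|]. rewrite Cmod_opp, Cmod_1. lra. }
  assert (B1 : (Cmod ((s - 1) * pow_rem (S N) s (w * / RtoC (INR n))) <=
    (Rabs B + 1) * (K1 * Cmod w ^ S N) * (/ INR n) ^ S N)%R).
  { rewrite Cmod_mult, Rmult_assoc. apply Rmult_le_compat; try apply Cmod_ge_0; [assumption|].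
    eapply Rle_trans; [apply H1|].
    - assumption.
    - rewrite Cmod_mult, U2. assert (T := Cmod_ge_0 w). nra.
    - rewrite <- RtoC_inv, re_scal_r by lra. nra.
    - rewrite Cmod_mult, U2, Rpow_mult_distr. lra. }
  assert (B2 : (Cmod (RtoC (INR n) * pow_rem (S (S N)) (s - 1) (/ RtoC (INR n))) <=
    K2 * (/ INR n) ^ S N)%R).
  { rewrite Cmod_mult, Cmod_R, Rabs_pos_eq by lra.
    assert (T : (Cmod (pow_rem (S (S N)) (s - 1) (/ RtoC (INR n))) <= K2 * (/ INR n) ^ S (S N))%R).
    { rewrite <- U2. apply H2; [|rewrite U2; lra|assumption].
      unfold Cminus. eapply Rle_trans; [apply Cmod_triangle|]. rewrite Cmod_opp, Cmod_1. lra. }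
    apply Rle_trans with (INR n * (K2 * (/ INR n) ^ S (S N)))%R.
    - apply Rmult_le_compat_l; lra.
    - apply Req_le. simpl. field. lra. }
  assert (B3 := H3 (n, s) (conj Hn Hs)). simpl fst in B3. simpl snd in B3.
  assert (B4 : (Cmod ((s - 1) * Csum (fun k => bernoulli w k * (poch s k * (/ RtoC (INR n)) ^ k *
        pow_rem (S (N - k)) (s + RtoC (INR k)) (/ RtoC (INR n))))%C N) <=
    (Rabs B + 1) * K3 * (/ INR n) ^ S N)%R).
  { rewrite Cmod_mult, Rmult_assoc. apply Rmult_le_compat; try apply Cmod_ge_0; assumption. }
  set (KK := ((Rabs B + 1) * (K1 * Cmod w ^ S N) + K2 + (Rabs B + 1) * K3)%R).
  assert (HKK : (0 <= KK)%R) by (unfold KK; nra).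
  apply Rle_trans with (exp (Re (- s) * ln (INR n)) * (KK * (/ INR n) ^ S N))%R.
  - apply Rmult_le_compat_l; [apply Rlt_le, exp_pos|].
    eapply Rle_trans; [apply Cmod_triangle|].
    eapply Rle_trans; [apply Rplus_le_compat_r, Cmod_triangle|]. unfold KK. lra.
  - replace (exp (Re (- s) * ln (INR n)) * (KK * (/ INR n) ^ S N))%R with
      (KK * (exp (Re (- s) * ln (INR n)) * (/ INR n) ^ S N))%R by ring.
    now apply Rmult_le_compat_l.
Qed.

(** Summing steps of size [n^(-p-2)] costs one power: [p] factors are frozen at the starting index
    and the other two telescope. *)
Lemma hurwitz_approx_tail_bound (w : C) (N : nat) (B : R) :
  (0 < Re w)%R -> exists K, (0 <= K)%R /\ forall (n j p : nat) (s : C),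
    (1 <= n)%nat -> (Cmod s <= B)%R -> (INR (S (S p)) <= Re s + INR (S N))%R ->
    (Cmod (hurwitz_approx w N (n + j) s - hurwitz_approx w N n s) <= K * (/ INR n) ^ S p)%R.
Proof.
  intros Hw. destruct (hurwitz_approx_step_bound w N B Hw) as [K [HK H]].
  exists (2 * K)%R. split; [lra|]. intros n j p s Hn Hs Hp.
  assert (Hx : (1 <= INR n)%R) by (change 1%R with (INR 1); now apply le_INR).
  assert (Hi : (0 < / INR n)%R) by (apply Rinv_0_lt_compat; lra).
  assert (Hip : (0 <= (/ INR n) ^ p)%R) by (apply pow_le; lra).
  assert (T : (Cmod (hurwitz_approx w N (n + j) s - hurwitz_approx w N n s)
    <= 2 * K * (/ INR n) ^ p * (/ INR n - / INR (n + j)))%R).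
  { induction j as [|j IH].
    - rewrite Nat.add_0_r. replace (_ - _) with (RtoC 0) by ring. rewrite Cmod_0. lra.
    - replace (n + S j)%nat with (S (n + j)) by lia.
      replace (hurwitz_approx w N (S (n + j)) s - hurwitz_approx w N n s) with
        ((hurwitz_approx w N (S (n + j)) s - hurwitz_approx w N (n + j) s) +
         (hurwitz_approx w N (n + j) s - hurwitz_approx w N n s)) by ring.
      eapply Rle_trans; [apply Cmod_triangle|].
      assert (Hy : (1 <= INR (n + j))%R) by (rewrite plus_INR; assert (T := pos_INR j); lra).
      assert (S1 := H (n + j)%nat (S (S p)) s ltac:(lia) Hs Hp).
      set (y := INR (n + j)) in *. rewrite S_INR. fold y.
      assert (Hpy : ((/ y) ^ p <= (/ INR n) ^ p)%R).
      { apply pow_incr. split; [apply Rlt_le, Rinv_0_lt_compat; lra|].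
        apply Rinv_le_contravar; [lra|]. unfold y. rewrite plus_INR. assert (T := pos_INR j). lra. }
      (* The comparison that telescopes; it amounts to [y + 1 <= 2 y]. *)
      assert (Hyy : (/ y * / y <= 2 * (/ y - / (y + 1)))%R).
      { replace (2 * (/ y - / (y + 1)))%R with (/ y * (2 * / (y + 1)))%R by (field; lra).
        apply Rmult_le_compat_l; [apply Rlt_le, Rinv_0_lt_compat; lra|].
        replace (2 * / (y + 1))%R with (/ ((y + 1) / 2))%R by (field; lra).
        apply Rinv_le_contravar; lra. }
      assert (Hyp : (0 <= (/ y) ^ p)%R) by (apply pow_le, Rlt_le, Rinv_0_lt_compat; lra).
      assert (S2 : (K * (/ y) ^ S (S p) <= 2 * K * (/ INR n) ^ p * (/ y - / (y + 1)))%R).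
      { replace (K * (/ y) ^ S (S p))%R with (K * ((/ y) ^ p * (/ y * / y)))%R by (simpl; ring).
        replace (2 * K * (/ INR n) ^ p * (/ y - / (y + 1)))%R with
          (K * ((/ INR n) ^ p * (2 * (/ y - / (y + 1)))))%R by ring.
        apply Rmult_le_compat_l; [assumption|].
        apply Rmult_le_compat; trivial.
        assert (0 < / y)%R by (apply Rinv_0_lt_compat; lra). nra. }
      lra. }
  eapply Rle_trans; [exact T|].
  replace (2 * K * (/ INR n) ^ S p)%R with (2 * K * (/ INR n) ^ p * / INR n)%R by (simpl; ring).
  apply Rmult_le_compat_l; [nra|].
  assert (0 < / INR (n + j))%R by (apply Rinv_0_lt_compat, lt_0_INR; lia). lra.
Qed.

(* [(s - 1) * zeta(s, w)], characterized as the common limit of all approximants of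
   high enough order. *)
Definition hurwitz_num (w s : C) : C :=
  epsilon (inhabits (RtoC 0)) (fun l => exists N0, forall N, (N0 <= N)%nat ->
    @filterlim nat C_UniformSpace (fun n => hurwitz_approx w N n s) eventually (@locally C_UniformSpace l)).

Lemma is_lim_seq_inv_INR : is_lim_seq (fun n => (/ INR n)%R) 0.
Proof.
  apply (is_lim_seq_inv (fun n => INR n) p_infty); [apply is_lim_seq_INR|discriminate].
Qed.

Lemma C_lim_seq_unique (u : nat -> C) (l l' : C) :
  @filterlim nat C_UniformSpace u eventually (@locally C_UniformSpace l) ->
  @filterlim nat C_UniformSpace u eventually (@locally C_UniformSpace l') -> l = l'.
Proof. apply (filterlim_locally_unique (K := C_AbsRing) (V := C_NormedModule)). Qed.

Lemma hurwitz_approx_lim (w : C) (N : nat) (s : C) :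
  (0 < Re w)%R -> (1 <= Re s + INR N)%R ->
  exists l, @filterlim nat C_UniformSpace (fun n => hurwitz_approx w N n s) eventually (@locally C_UniformSpace l).
Proof.
  intros Hw Hs. destruct (hurwitz_approx_tail_bound w N (Cmod s) Hw) as [K [HK H]].
  assert (HT : forall n j, (Cmod (hurwitz_approx w N (S n + j) s - hurwitz_approx w N (S n) s) <= K * / INR (S n))%R).
  { intros n j. rewrite <- (pow_1 (/ INR (S n))). apply H; [lia|lra|]. rewrite (S_INR N). simpl. lra. }
  assert (He : is_lim_seq (fun n => (K * / INR (S n))%R) 0).
  { replace (Finite 0) with (Rbar_mult K 0) by (simpl; f_equal; ring).
    apply is_lim_seq_scal_l. apply (is_lim_seq_incr_1 (fun n => (/ INR n)%R)). exact is_lim_seq_inv_INR. }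
  destruct (C_Cauchy_limit (fun n => hurwitz_approx w N (S n) s) (fun n => (K * / INR (S n))%R) He) as [l Hl].
  - assert (Hpos : forall n, (0 <= K * / INR (S n))%R).
    { intros n. apply Rmult_le_pos; [assumption|]. apply Rlt_le, Rinv_0_lt_compat, lt_0_INR. lia. }
    intros n m. destruct (Nat.le_ge_cases n m) as [Hnm|Hnm].
    + assert (T := HT n (m - n)%nat). replace (S n + (m - n))%nat with (S m) in T by lia.
      replace (_ - _) with (- (hurwitz_approx w N (S m) s - hurwitz_approx w N (S n) s)) by ring.
      rewrite Cmod_opp. specialize (Hpos m). lra.
    + assert (T := HT m (n - m)%nat). replace (S m + (n - m))%nat with (S n) in T by lia.
      specialize (Hpos n). lra.
  - exists l. apply (C_lim_seq_le _ _ (fun n => (K * / INR n)%R) 1).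
    + replace (Finite 0) with (Rbar_mult K 0) by (simpl; f_equal; ring).
      apply is_lim_seq_scal_l, is_lim_seq_inv_INR.
    + intros n Hn. destruct n as [|n]; [lia|]. apply Hl.
Qed.

(** Raising the order adds a single term, of size [n^(-Re s - N)], which the hypothesis makes
    [O(1/n)]. *)
Lemma hurwitz_approx_order_step (w : C) (N : nat) (s l : C) :
  (1 <= Re s + INR N)%R ->
  @filterlim nat C_UniformSpace (fun n => hurwitz_approx w N n s) eventually (@locally C_UniformSpace l) ->
  @filterlim nat C_UniformSpace (fun n => hurwitz_approx w (S N) n s) eventually (@locally C_UniformSpace l).
Proof.
  intros Hs H.
  set (D := ((Cmod ((s - 1) * (bernoulli w N * poch s N))))%R).
  assert (HD : (0 <= D)%R) by apply Cmod_ge_0.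
  assert (HL : is_lim_seq (fun n => (D * / INR n)%R) 0).
  { replace (Finite 0) with (Rbar_mult D 0) by (simpl; f_equal; ring).
    apply is_lim_seq_scal_l, is_lim_seq_inv_INR. }
  apply C_lim_seq_eps. intros e He.
  destruct (proj1 (C_lim_seq_eps _ _) H (e / 2)%R ltac:(lra)) as [N1 HN1].
  apply is_lim_seq_spec in HL. destruct (HL (mkposreal (e / 2) ltac:(lra))) as [N2 HN2].
  exists (S (N1 + N2)). intros n Hn. specialize (HN1 n ltac:(lia)). specialize (HN2 n ltac:(lia)).
  simpl in HN2. rewrite Rminus_0_r in HN2. apply Rabs_def2 in HN2.
  assert (Hx : (1 <= INR n)%R) by (change 1%R with (INR 1); apply le_INR; lia).
  replace (hurwitz_approx w (S N) n s - l) with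
    ((hurwitz_approx w N n s - l) +
     (s - 1) * (bernoulli w N * poch s N) * Cpower (RtoC (INR n)) (- (s + RtoC (INR N)))).
  2:{ unfold hurwitz_approx. cbn [Csum]. ring. }
  eapply Rle_lt_trans; [apply Cmod_triangle|].
  rewrite (Cmod_mult ((s - 1) * _)). fold D. rewrite Cmod_Cpower_RtoC by lra.
  assert (T : (exp (Re (- (s + RtoC (INR N))) * ln (INR n)) <= / INR n)%R).
  { rewrite <- (pow_1 (/ INR n)), <- exp_mult_ln by lia. apply exp_le.
    apply Rmult_le_compat_r; [rewrite <- ln_1; apply ln_le; lra|].
    rewrite re_opp, re_plus, re_RtoC. simpl. lra. }
  assert (T2 : (D * exp (Re (- (s + RtoC (INR N))) * ln (INR n)) <= D * / INR n)%R) by now apply Rmult_le_compat_l.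
  lra.
Qed.

(** One function of [s] is the limit for every admissible order, so that [N] can be chosen anew in
    each region of the plane. *)
Lemma hurwitz_num_lim (w : C) (N : nat) (s : C) :
  (0 < Re w)%R -> (1 <= Re s + INR N)%R ->
  @filterlim nat C_UniformSpace (fun n => hurwitz_approx w N n s) eventually
    (@locally C_UniformSpace (hurwitz_num w s)).
Proof.
  intros Hw Hs. destruct (hurwitz_approx_lim w N s Hw Hs) as [l Hl].
  assert (HA : forall j, @filterlim nat C_UniformSpace (fun n => hurwitz_approx w (j + N) n s) eventually
    (@locally C_UniformSpace l)).
  { induction j as [|j IH]; [exact Hl|]. apply (hurwitz_approx_order_step w (j + N)); trivial.
    rewrite plus_INR. assert (T := pos_INR j). lra. }
  assert (HS : exists N0, forall N, (N0 <= N)%nat -> @filterlim nat C_UniformSpace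
    (fun n => hurwitz_approx w N n s) eventually (@locally C_UniformSpace (hurwitz_num w s))).
  { unfold hurwitz_num. apply epsilon_spec. exists l, N. intros M HM.
    replace M with ((M - N) + N)%nat by lia. apply HA. }
  destruct HS as [N0 HN0].
  assert (E : l = hurwitz_num w s); [|now rewrite <- E].
  apply (C_lim_seq_unique _ _ _ (HA N0)). apply HN0. lia.
Qed.

Lemma hurwitz_num_bound (w : C) (N : nat) (B : R) :
  (0 < Re w)%R -> exists K, (0 <= K)%R /\ forall (n p : nat) (s : C),
    (1 <= n)%nat -> (Cmod s <= B)%R -> (INR (S (S p)) <= Re s + INR (S N))%R ->
    (Cmod (hurwitz_num w s - hurwitz_approx w N n s) <= K * (/ INR n) ^ S p)%R.
Proof.
  intros Hw. destruct (hurwitz_approx_tail_bound w N B Hw) as [K [HK H]].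
  exists K. split; [assumption|]. intros n p s Hn Hs Hp.
  apply le_epsilon. intros e He.
  assert (Hs1 : (1 <= Re s + INR N)%R).
  { rewrite !S_INR in Hp. assert (T := pos_INR p). lra. }
  destruct (proj1 (C_lim_seq_eps _ _) (hurwitz_num_lim w N s Hw Hs1) e He) as [N1 HN1].
  specialize (HN1 (n + N1)%nat ltac:(lia)).
  specialize (H n N1 p s Hn Hs Hp).
  replace (hurwitz_num w s - hurwitz_approx w N n s) with
    (- (hurwitz_approx w N (n + N1) s - hurwitz_num w s) + (hurwitz_approx w N (n + N1) s - hurwitz_approx w N n s)) by ring.
  eapply Rle_trans; [apply Cmod_triangle|]. rewrite Cmod_opp. lra.
Qed.

(** * Holomorphy of the limit and existence of the continuation *)

Lemma is_C_derive_Cpower_opp (z c s : C) :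
  is_C_derive (fun y => Cpower z (- (y + c))) s (- Clog z * Cpower z (- (s + c))).
Proof.
  eapply C_derive_eq; [|apply (is_C_derive_Cpower z (fun y => - (y + c)))].
  2:{ apply is_C_derive_opp, is_C_derive_plus; [apply is_C_derive_id|apply is_C_derive_const]. }
  ring.
Qed.

Lemma hurwitz_sum_derive (w s : C) (N n : nat) :
  is_C_derive
    (fun y => Csum (fun k => bernoulli w k * (poch y k * Cpower (RtoC (INR n)) (- (y + RtoC (INR k))))) N) s
    (Csum (fun k => bernoulli w k * (dpoch s k * Cpower (RtoC (INR n)) (- (s + RtoC (INR k)))
       + poch s k * (- Clog (RtoC (INR n)) * Cpower (RtoC (INR n)) (- (s + RtoC (INR k)))))) N).
Proof.
  apply (is_C_derive_Csum
    (fun k y => bernoulli w k * (poch y k * Cpower (RtoC (INR n)) (- (y + RtoC (INR k)))))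
    (fun k y => bernoulli w k * (dpoch y k * Cpower (RtoC (INR n)) (- (y + RtoC (INR k)))
       + poch y k * (- Clog (RtoC (INR n)) * Cpower (RtoC (INR n)) (- (y + RtoC (INR k))))))).
  intros k _. eapply C_derive_eq; [|apply is_C_derive_mult; [apply is_C_derive_const|]].
  2:{ apply is_C_derive_mult; [apply is_C_derive_poch|apply is_C_derive_Cpower_opp]. }
  cbv beta. ring.
Qed.

Lemma hurwitz_approx_ex_derive (w : C) (N n : nat) (s : C) :
  exists l, is_C_derive (hurwitz_approx w N n) s l.
Proof.
  eexists. unfold hurwitz_approx.
  apply is_C_derive_plus; [apply is_C_derive_plus|].
  - apply is_C_derive_mult.
    + apply is_C_derive_minus; [apply is_C_derive_id|apply is_C_derive_const].
    + apply (is_C_derive_Csum (fun k y => Cpower (RtoC (INR k) + w) (- y))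
        (fun k y => - (1) * Clog (RtoC (INR k) + w) * Cpower (RtoC (INR k) + w) (- y))).
      intros k _. apply is_C_derive_Cpower, is_C_derive_opp, is_C_derive_id.
  - apply is_C_derive_Cpower. apply is_C_derive_minus; [apply is_C_derive_const|apply is_C_derive_id].
  - apply is_C_derive_mult.
    + apply is_C_derive_minus; [apply is_C_derive_id|apply is_C_derive_const].
    + apply hurwitz_sum_derive.
Qed.

Lemma nat_above (x : R) : exists N : nat, (x <= INR N)%R.
Proof. destruct (INR_unbounded x) as [N HN]. exists N. lra. Qed.

Lemma hurwitz_num_ex_derive (w s : C) :
  (0 < Re w)%R -> exists l, is_C_derive (hurwitz_num w) s l.
Proof.
  (* On the unit disk around [s] the real part drops by at most 1, so this order still gives the
     rate [1 / n] throughout the disk. *)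
  intros Hw. destruct (nat_above (2 - Re s)%R) as [N HN].
  destruct (hurwitz_num_bound w N (Cmod s + 1) Hw) as [K [HK H]].
  apply (Weierstrass_limit (fun n => hurwitz_approx w N (S n)) _ s 1 (fun n => (K * / INR (S n))%R)); [lra| | |].
  - replace (Finite 0) with (Rbar_mult K 0) by (simpl; f_equal; ring).
    apply is_lim_seq_scal_l. apply (is_lim_seq_incr_1 (fun n => (/ INR n)%R)). exact is_lim_seq_inv_INR.
  - intros n y _. apply hurwitz_approx_ex_derive.
  - intros n y Hy. replace (_ - _) with (- (hurwitz_num w y - hurwitz_approx w N (S n) y)) by ring.
    rewrite Cmod_opp, <- (pow_1 (/ INR (S n))). apply H; [lia| |].
    + replace y with ((y - s) + s) by ring. eapply Rle_trans; [apply Cmod_triangle|]. lra.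
    + assert (T := re_le_Cmod (y - s)). apply Rabs_le_between in T.
      change (Re (y - s)) with (Re y - Re s)%R in T. rewrite !S_INR. simpl. lra.
Qed.

Lemma is_hurwitz_zeta_exists (w : C) :
  (0 < Re w)%R -> is_hurwitz_zeta w (fun s => hurwitz_num w s / (s - 1)).
Proof.
  intros Hw. repeat split.
  - intros s Hs.
    assert (Hne : s - 1 <> 0).
    { intros E. assert (E2 : s = 1) by (rewrite <- (Cplus_0_l 1), <- E; ring).
      rewrite E2 in Hs. simpl in Hs. lra. }
    (* At order 0 the approximant is [s - 1] times the partial sum plus [n^(1-s)], and the latter
       vanishes in the limit for [Re s > 1]. *)
    assert (HL := hurwitz_num_lim w 0 s Hw ltac:(simpl; lra)).
    assert (Hm : (0 < Cmod (s - 1))%R) by now apply Cmod_gt_0.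
    unfold is_series. apply C_lim_seq_eps. intros e He.
    assert (Hem : (0 < e * Cmod (s - 1))%R) by now apply Rmult_lt_0_compat.
    destruct (proj1 (C_lim_seq_eps _ _) HL (e * Cmod (s - 1) / 2)%R ltac:(lra)) as [N1 HN1].
    assert (HT : is_lim_seq (fun n => exp (- ((Re s - 1) * ln (INR n)))) 0).
    { apply (is_lim_comp_seq exp (fun n => (- ((Re s - 1) * ln (INR n)))%R) m_infty 0).
      - exact is_lim_exp_m.
      - exists 0%nat. discriminate.
      - assert (HM : Rbar_mult (Re s - 1)%R p_infty = p_infty).
        { apply is_Rbar_mult_unique, is_Rbar_mult_sym, is_Rbar_mult_p_infty_pos. simpl. lra. }
        apply (proj1 (is_lim_seq_opp (fun n => (Re s - 1) * ln (INR n))%R p_infty)).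
        rewrite <- HM. apply is_lim_seq_scal_l.
        apply (is_lim_comp_seq ln (fun n => INR n) p_infty p_infty).
        + exact is_lim_ln_p.
        + exists 0%nat. discriminate.
        + exact is_lim_seq_INR. }
    apply is_lim_seq_spec in HT. destruct (HT (mkposreal (e * Cmod (s - 1) / 2)%R ltac:(lra))) as [N2 HN2].
    exists (S (N1 + N2)). intros n Hn.
    rewrite (sum_n_Csum (fun k => Cpower (RtoC (INR k) + w) (- s))).
    specialize (HN1 (S n) ltac:(lia)). specialize (HN2 (S n) ltac:(lia)). cbv beta in HN2.
    rewrite Rminus_0_r, Rabs_pos_eq in HN2 by apply Rlt_le, exp_pos. simpl pos in HN2.
    set (X := Csum (fun k => Cpower (RtoC (INR k) + w) (- s)) (S n)) in *.
    replace (X - hurwitz_num w s / (s - 1)) with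
      (((hurwitz_approx w 0 (S n) s - hurwitz_num w s) + - Cpower (RtoC (INR (S n))) (1 - s)) / (s - 1)).
    2:{ unfold hurwitz_approx. fold X. cbn [Csum]. field. exact Hne. }
    rewrite Cmod_div by assumption. apply Rlt_div_l; [assumption|].
    eapply Rle_lt_trans; [apply Cmod_triangle|]. rewrite Cmod_opp.
    rewrite Cmod_Cpower_RtoC by (apply lt_0_INR; lia).
    replace (Re (1 - s) * ln (INR (S n)))%R with (- ((Re s - 1) * ln (INR (S n))))%R.
    + lra.
    + change (Re (1 - s)) with (1 - Re s)%R. ring.
  - intros s Hs. destruct (hurwitz_num_ex_derive w s Hw) as [l Hl].
    eexists. apply is_C_derive_mult; [exact Hl|].
    apply (is_C_derive_comp Cinv (fun s => s - 1)).
    + apply is_C_derive_inv. now apply Cminus_eq_contra.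
    + apply is_C_derive_minus; [apply is_C_derive_id|apply is_C_derive_const].
  - exists 1%nat, (hurwitz_num w). split.
    + apply locally_Cmod. exists 1%R. split; [lra|]. intros y _. exact (hurwitz_num_ex_derive w y Hw).
    + apply locally_Cmod. exists 1%R. split; [lra|]. intros y _ _. now rewrite Cpow_1_r.
Qed.

(** * Uniqueness of the continuation *)

Lemma ex_derive_sub_pow (c z : C) (m : nat) : exists l, is_C_derive (fun y => (y - c) ^ m) z l.
Proof.
  destruct m as [|m]; [exists 0; apply (is_C_derive_const 1)|].
  eexists. apply (is_C_derive_comp (fun y => y ^ S m) (fun y => y - c)); [apply is_C_derive_pow|].
  apply is_C_derive_minus; [apply is_C_derive_id|apply is_C_derive_const].
Qed.

Lemma locally_neq (z c : C) : z <> c -> @locally C_UniformSpace z (fun y : C => y <> c).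
Proof.
  intros H. apply locally_Cmod. exists (Cmod (z - c)). split.
  - apply Cmod_gt_0. now apply Cminus_eq_contra.
  - intros y Hy ->. rewrite <- Cmod_opp in Hy.
    replace (- (c - z)) with (z - c) in Hy by ring. lra.
Qed.

(* [(s - 1)^(m1 + m2) (Z1 s - Z2 s)] extends to an entire function. *)
Lemma is_hurwitz_zeta_unique (w : C) (Z1 Z2 : C -> C) (s : C) :
  is_hurwitz_zeta w Z1 -> is_hurwitz_zeta w Z2 -> s <> 1 -> Z1 s = Z2 s.
Proof.
  intros [S1 [D1 [m1 [g1 [G1 P1]]]]] [S2 [D2 [m2 [g2 [G2 P2]]]]] Hs.
  (* The values [Z1 1] and [Z2 1] are arbitrary, so the product is patched at 1 by the numerators
     [g1], [g2], with which it agrees on a punctured neighbourhood. *)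
  set (E := fun z : C => if excluded_middle_informative (z = 1)
    then g1 z * (z - 1) ^ m2 - g2 z * (z - 1) ^ m1
    else (z - 1) ^ (m1 + m2) * (Z1 z - Z2 z)).
  assert (HE : forall z, E z = 0).
  { apply entire_eq_0_of_half_plane.
    - intros z. destruct (excluded_middle_informative (z = 1)) as [->|Hz].
      + apply (locally_singleton (T := C_UniformSpace)) in G1 as G1'.
        apply (locally_singleton (T := C_UniformSpace)) in G2 as G2'.
        destruct G1' as [l1 Hl1]. destruct G2' as [l2 Hl2].
        destruct (ex_derive_sub_pow 1 1 m1) as [q1 Hq1]. destruct (ex_derive_sub_pow 1 1 m2) as [q2 Hq2].
        eexists. eapply is_C_derive_ext_loc.
        2:{ apply is_C_derive_minus; apply is_C_derive_mult; [exact Hl1|exact Hq2|exact Hl2|exact Hq1]. }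
        unfold locally', within in P1, P2. generalize (filter_and _ _ P1 P2). apply filter_imp. intros y [Y1 Y2]. unfold E.
        destruct (excluded_middle_informative _) as [->|Hy]; [reflexivity|].
        rewrite (Y1 Hy), (Y2 Hy), Cpow_add_r.
        assert (T : y - 1 <> 0) by now apply Cminus_eq_contra.
        field. split; now apply Cpow_nz.
      + destruct (D1 z Hz) as [l1 Hl1]. destruct (D2 z Hz) as [l2 Hl2].
        destruct (ex_derive_sub_pow 1 z (m1 + m2)) as [q Hq].
        eexists. eapply is_C_derive_ext_loc.
        2:{ apply is_C_derive_mult; [exact Hq|]. apply is_C_derive_minus; [exact Hl1|exact Hl2]. }
        generalize (locally_neq z 1 Hz). apply filter_imp. intros y Hy. unfold E.
        destruct (excluded_middle_informative _); [contradiction|reflexivity].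
    - intros z Hz. unfold E. destruct (excluded_middle_informative (z = 1)) as [->|Hn].
      + simpl in Hz. lra.
      + rewrite (C_lim_seq_unique _ _ _ (S1 z Hz) (S2 z Hz)). ring. }
  specialize (HE s). unfold E in HE.
  destruct (excluded_middle_informative (s = 1)) as [|Hn]; [contradiction|].
  apply Ceq_minus. apply NNPP. intros Hne. revert HE.
  apply Cmult_neq_0; [|assumption]. apply Cpow_nz. now apply Cminus_eq_contra.
Qed.

Lemma hurwitz_zeta_eq (w s : C) :
  (0 < Re w)%R -> s <> 1 -> hurwitz_zeta s w = hurwitz_num w s / (s - 1).
Proof.
  intros Hw Hs. apply (is_hurwitz_zeta_unique w (fun s => hurwitz_zeta s w) (fun s => hurwitz_num w s / (s - 1))); trivial.
  - unfold hurwitz_zeta. apply (epsilon_spec (inhabits (fun _ : C => RtoC 0)) (is_hurwitz_zeta w)).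
    exists (fun s => hurwitz_num w s / (s - 1)). now apply is_hurwitz_zeta_exists.
  - now apply is_hurwitz_zeta_exists.
Qed.

(** * Logarithmic expansions *)

Notation C_null u :=
  (@filterlim nat C_UniformSpace u eventually (@locally C_UniformSpace (RtoC 0))).

Lemma C_null_eps (u : nat -> C) :
  C_null u <-> forall e : R, (0 < e)%R -> exists N, forall n, (N <= n)%nat -> (Cmod (u n) < e)%R.
Proof.
  rewrite C_lim_seq_eps. split; intros H e He; destruct (H e He) as [N HN]; exists N; intros n Hn;
    specialize (HN n Hn); [|replace (u n - 0) with (u n) by ring; exact HN].
  replace (u n - 0) with (u n) in HN by ring. exact HN.
Qed.

Lemma C_null_ext (u v : nat -> C) (N0 : nat) :
  (forall n, (N0 <= n)%nat -> u n = v n) -> C_null u -> C_null v.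
Proof.
  intros E H. apply (filterlim_ext_loc (T := nat)) with (f := u); [|exact H].
  now exists N0.
Qed.

Lemma C_null_doubling (u : nat -> C) (k : C) :
  C_null u -> C_null (fun n => u (2 * n)%nat - k * u n).
Proof.
  rewrite !C_null_eps. intros H e He.
  assert (Hk := Cmod_ge_0 k).
  destruct (H (e / (2 + Cmod k))%R) as [N HN]; [apply Rdiv_lt_0_compat; lra|].
  exists N. intros n Hn.
  unfold Cminus. eapply Rle_lt_trans; [apply Cmod_triangle|]. rewrite Cmod_opp, Cmod_mult.
  assert (H1 := HN (2 * n)%nat ltac:(lia)). assert (H2 := HN n Hn).
  apply Rlt_div_r in H1; [|lra]. apply Rlt_div_r in H2; [|lra].
  assert (P1 := Cmod_ge_0 (u (2 * n)%nat)). assert (P2 := Cmod_ge_0 (u n)). nra.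
Qed.

Lemma C_null_minus (u v : nat -> C) : C_null u -> C_null v -> C_null (fun n => u n - v n).
Proof.
  rewrite !C_null_eps. intros Hu Hv e He.
  destruct (Hu (e / 2)%R ltac:(lra)) as [N1 H1]. destruct (Hv (e / 2)%R ltac:(lra)) as [N2 H2].
  exists (N1 + N2)%nat. intros n Hn. specialize (H1 n ltac:(lia)). specialize (H2 n ltac:(lia)).
  unfold Cminus. eapply Rle_lt_trans; [apply Cmod_triangle|]. rewrite Cmod_opp. lra.
Qed.

Lemma C_null_const (c : C) : C_null (fun _ => c) -> c = 0.
Proof.
  rewrite C_null_eps. intros H. apply NNPP. intros Hc. apply Cmod_gt_0 in Hc.
  destruct (H _ Hc) as [N HN]. specialize (HN N (le_n N)). lra.
Qed.

Lemma Csum_pad (f : nat -> C) (n m : nat) :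
  (n <= m)%nat -> (forall k, (n <= k)%nat -> f k = 0) -> Csum f m = Csum f n.
Proof.
  intros Hnm H. induction Hnm as [|m Hm IH]; [reflexivity|].
  cbn [Csum]. rewrite IH, H by assumption. ring.
Qed.

Lemma Csum_rev (f : nat -> C) (n : nat) : Csum f n = Csum (fun k => f (n - S k)%nat) n.
Proof.
  induction n as [|n IH]; [reflexivity|].
  rewrite (Csum_S_l (fun k => f (S n - S k)%nat)). cbn [Csum]. rewrite IH.
  replace (S n - 1)%nat with n by lia. apply Cplus_comm.
Qed.

Lemma Csum_delta (f : nat -> C) (q n : nat) :
  (q < n)%nat -> Csum (fun j => if (j =? q)%nat then f j else 0) n = f q.
Proof.
  intros Hq. replace n with (S q + (n - S q))%nat by lia.
  rewrite (Csum_pad _ (S q)).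
  - cbn [Csum]. rewrite Nat.eqb_refl, (Csum_ext _ (fun _ => 0 * 0)), Csum_scal; [ring|].
    intros k Hk. replace (k =? q)%nat with false by (symmetry; apply Nat.eqb_neq; lia). ring.
  - lia.
  - intros k Hk. replace (k =? q)%nat with false by (symmetry; apply Nat.eqb_neq; lia). ring.
Qed.

Definition log_poly (a b : nat -> C) (D n : nat) : C :=
  Csum (fun m => a m * RtoC (INR n ^ m * ln (INR n)) + b m * RtoC (INR n ^ m)) D.

(** Since [log (2n) = log n + log 2], each logarithmic coefficient leaks into the power coefficient
    of the same degree. *)
Lemma log_poly_doubling (a b : nat -> C) (D n : nat) (k : C) :
  (1 <= n)%nat ->
  log_poly a b D (2 * n) - k * log_poly a b D n =
  log_poly (fun m => (2 ^ m - k) * a m)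
    (fun m => 2 ^ m * RtoC (ln 2) * a m + (2 ^ m - k) * b m) D n.
Proof.
  intros Hn. unfold log_poly. rewrite <- Csum_scal, <- Csum_minus. apply Csum_ext. intros m _.
  assert (Hx : (0 < INR n)%R) by (apply lt_0_INR; lia).
  rewrite mult_INR. change (INR 2) with 2%R.
  rewrite ln_mult, Rpow_mult_distr, !RtoC_mult, RtoC_plus, RtoC_pow by lra. ring.
Qed.

(* The operator [u(2n) - 2^D u(n)], applied twice, kills [n^D log n] and [n^D] and
   multiplies the other coefficients by nonzero factors. *)
Lemma log_poly_null (D : nat) (a b : nat -> C) :
  C_null (log_poly a b (S D)) -> a 0%nat = 0 /\ b 0%nat = 0.
Proof.
  assert (Hln : RtoC (ln 2) <> 0) by (apply RtoC_inj_neq; assert (T := ln_lt_2); lra).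
  revert a b. induction D as [|D IH]; intros a b H.
  (* In degree 0 a single difference leaves the constant [ln 2 * a 0]; only then is the sequence
     known to be the constant [b 0]. *)
  - assert (H1 := C_null_doubling _ 1 H).
    apply (C_null_ext _ (fun _ => RtoC (ln 2) * a 0%nat) 1) in H1.
    2:{ intros n Hn. rewrite log_poly_doubling by assumption. unfold log_poly. simpl.
        rewrite !RtoC_mult. ring. }
    apply C_null_const in H1.
    assert (Ha : a 0%nat = 0).
    { apply NNPP. intros Hne. revert H1. now apply Cmult_neq_0. }
    split; [assumption|].
    apply C_null_const. revert H. apply (C_null_ext _ _ 0). intros n _.
    unfold log_poly. simpl. rewrite Ha. ring.
  - set (k := 2 ^ S D : C).
    assert (H1 := C_null_doubling _ k H).
    apply (C_null_ext _ _ 1 (fun n Hn => log_poly_doubling a b (S (S D)) n k Hn)) in H1.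
    (* The first pass kills the top logarithm but leaves [2^D ln 2 a_D n^D] in its place, which the
       second pass removes. *)
    assert (H2 := C_null_doubling _ k H1).
    apply (C_null_ext _ _ 1 (fun n Hn => log_poly_doubling _ _ (S (S D)) n k Hn)) in H2.
    cbv beta in H2.
    assert (Hk : 2 ^ 0 - k <> 0).
    { unfold k. rewrite <- !RtoC_pow, <- RtoC_minus. apply RtoC_inj_neq.
      assert (T : (1 <= 2 ^ D)%R) by (apply pow_R1_Rle; lra). simpl. lra. }
    match type of H2 with context [log_poly ?a' ?b' _] => specialize (IH a' b') end.
    destruct IH as [Ha Hb].
    { revert H2. apply (C_null_ext _ _ 0). intros n _.
      unfold log_poly at 1. cbn [Csum]. fold k.
      match goal with |- ?A + _ = _ => transitivity (A + 0) end; [f_equal; ring|].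
      rewrite Cplus_0_r. reflexivity. }
    cbv beta in Ha, Hb.
    assert (Ha0 : a 0%nat = 0).
    { apply NNPP. intros Hne. revert Ha. repeat apply Cmult_neq_0; assumption. }
    split; [assumption|].
    rewrite Ha0, !Cmult_0_r, !Cplus_0_l in Hb.
    apply NNPP. intros Hne. revert Hb. repeat apply Cmult_neq_0; assumption.
Qed.

(** The case [N = 0] already determines the constant term. The degree may be enlarged freely, so
    that two expansions can be compared at a common one. *)
Lemma log_power_expansion_order_0 (f : nat -> C) (a : nat -> C) (b : Z -> C) :
  log_power_expansion f a b -> exists d : nat, forall D, (d <= D)%nat ->
  C_null (fun n => f n - log_poly a (fun m => b (Z.of_nat m)) (S D) n).
Proof.
  intros [d [Ha [Hb H]]]. exists d. intros D HD. specialize (H 0%nat). revert H.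
  apply (C_null_ext _ _ 0). intros n _.
  rewrite (sum_n_Csum (fun m => a m * RtoC (INR n ^ m * ln (INR n)))).
  rewrite (sum_n_Csum (fun j => let m := (Z.of_nat j - Z.of_nat 0)%Z in
                          b m * RtoC (powerRZ (INR n) m))).
  unfold log_poly. rewrite Csum_plus.
  rewrite (Csum_pad (fun m => a m * RtoC (INR n ^ m * ln (INR n))) (S d) (S D)).
  2:{ lia. }
  2:{ intros k Hk. rewrite Ha by lia. ring. }
  rewrite (Csum_pad (fun m => b (Z.of_nat m) * RtoC (INR n ^ m)) (S d) (S D)).
  2:{ lia. }
  2:{ intros k Hk. rewrite Hb by lia. ring. }
  rewrite Nat.add_0_r. simpl pow.
  rewrite (Csum_ext (fun j => let m := (Z.of_nat j - Z.of_nat 0)%Z in b m * RtoC (powerRZ (INR n) m))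
     (fun m => b (Z.of_nat m) * RtoC (INR n ^ m))).
  - ring.
  - intros k _. cbv zeta. change (Z.of_nat 0) with 0%Z. rewrite Z.sub_0_r, pow_powerRZ. reflexivity.
Qed.

Lemma log_power_expansion_unique (f : nat -> C) (a a' : nat -> C) (b b' : Z -> C) :
  log_power_expansion f a b -> log_power_expansion f a' b' -> b 0%Z = b' 0%Z.
Proof.
  intros H H'.
  destruct (log_power_expansion_order_0 _ _ _ H) as [d Hd].
  destruct (log_power_expansion_order_0 _ _ _ H') as [d' Hd'].
  specialize (Hd (d + d')%nat ltac:(lia)). specialize (Hd' (d + d')%nat ltac:(lia)).
  assert (T := C_null_minus _ _ Hd' Hd).
  apply (C_null_ext _ (log_poly (fun m => a m - a' m)
    (fun m => b (Z.of_nat m) - b' (Z.of_nat m)) (S (d + d'))) 0) in T.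
  - apply log_poly_null in T. destruct T as [_ T]. now apply Ceq_minus.
  - intros n _. unfold log_poly.
    rewrite (Csum_ext (fun m => (a m - a' m) * RtoC (INR n ^ m * ln (INR n)) +
        (b (Z.of_nat m) - b' (Z.of_nat m)) * RtoC (INR n ^ m))
      (fun m => (a m * RtoC (INR n ^ m * ln (INR n)) + b (Z.of_nat m) * RtoC (INR n ^ m))
      - (a' m * RtoC (INR n ^ m * ln (INR n)) + b' (Z.of_nat m) * RtoC (INR n ^ m)))).
    + rewrite Csum_minus. ring.
    + intros m _. ring.
Qed.

Lemma constant_term_eq (f : nat -> C) (a : nat -> C) (b : Z -> C) :
  log_power_expansion f a b -> constant_term f = b 0%Z.
Proof.
  intros H. unfold constant_term.
  destruct (epsilon_spec (inhabits (RtoC 0))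
    (fun c => exists (a : nat -> C) (b : Z -> C), log_power_expansion f a b /\ b 0%Z = c)) as [a' [b' [H' <-]]].
  - now exists (b 0%Z), a, b.
  - exact (log_power_expansion_unique f a' a b' b H' H).
Qed.

(** * The expansion at [s = -n] *)

Lemma opp_INR_S (n : nat) : - RtoC (INR (S n)) + 1 = - RtoC (INR n).
Proof. rewrite S_INR, RtoC_plus. ring. Qed.

Lemma poch_opp_INR (n : nat) : poch (- RtoC (INR n)) n = (- (1)) ^ n * Cfact n.
Proof.
  induction n as [|n IH]; [simpl; ring|].
  cbn [poch]. rewrite opp_INR_S, IH, RtoC_fact_S, Cpow_S. ring.
Qed.

(** The product runs through 0. This is why no logarithm accompanies a negative power in the
    expansion. *)
Lemma poch_opp_INR_eq_0 (n k : nat) : (n < k)%nat -> poch (- RtoC (INR n)) k = 0.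
Proof.
  revert k. induction n as [|n IH]; intros k Hk; (destruct k as [|k]; [lia|]); cbn [poch].
  - simpl. ring.
  - rewrite opp_INR_S, IH by lia. ring.
Qed.

(** The logarithmic derivative of [s (s+1) ... (s+n-1)] at [-n] is the sum of [1/(j-n)] for [j < n],
    that is [- H_n]. *)
Lemma dpoch_opp_INR (n : nat) :
  dpoch (- RtoC (INR n)) n = (- (1)) ^ (n + 1) * Cfact n * RtoC (harmonic n).
Proof.
  induction n as [|n IH].
  - unfold harmonic. rewrite sum_n_m_zero by lia. simpl. change (@zero R_AbelianMonoid) with 0%R. ring.
  - cbn [dpoch]. rewrite opp_INR_S, IH, poch_opp_INR.
    assert (E : RtoC (harmonic (S n)) = RtoC (harmonic n) + / RtoC (INR (S n))).
    { unfold harmonic. rewrite sum_n_Sm by lia. rewrite <- RtoC_inv by now apply not_0_INR.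
      rewrite <- RtoC_plus. reflexivity. }
    rewrite E, RtoC_fact_S, !Nat.add_1_r, !Cpow_S. field. apply RtoC_S_neq_0.
Qed.

Lemma Cpower_powerRZ (x : R) (z : Z) :
  (0 < x)%R -> Cpower (RtoC x) (RtoC (IZR z)) = RtoC (powerRZ x z).
Proof.
  intros Hx. assert (Hne : RtoC x <> 0) by (apply RtoC_inj_neq; lra).
  destruct (Z_le_gt_dec 0 z) as [Hz|Hz].
  - rewrite <- (Z2Nat.id z Hz), <- INR_IZR_INZ, Cpower_INR, <- pow_powerRZ, RtoC_pow by assumption.
    reflexivity.
  - replace z with (- Z.of_nat (Z.to_nat (- z)))%Z by lia.
    rewrite opp_IZR, <- INR_IZR_INZ, RtoC_opp, Cpower_opp_INR by assumption.
    rewrite powerRZ_neg', <- pow_powerRZ, RtoC_inv, RtoC_pow by (apply pow_nonzero; lra).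
    reflexivity.
Qed.

Lemma hurwitz_zeta_is_derive (w s : C) :
  (0 < Re w)%R -> s <> 1 ->
  is_C_derive (fun y => hurwitz_zeta y w) s (C_derive (fun y => hurwitz_zeta y w) s).
Proof.
  intros Hw Hs. apply C_derive_spec.
  destruct (proj1 (proj2 (is_hurwitz_zeta_exists w Hw)) s Hs) as [l Hl].
  exists l. revert Hl. apply is_C_derive_ext_loc.
  generalize (locally_neq s 1 Hs). apply filter_imp. intros y Hy. symmetry. now apply hurwitz_zeta_eq.
Qed.

(** The coefficients of [x^m log x] in [d/ds P_N(s, x)] at [s = -n]: the top one comes from
    [x^(1-s)/(s-1)], the others from the term of index [k = n - m]. *)
Definition zeta_expansion_log (w : C) (n m : nat) : C :=
  if (m =? S n)%nat then / RtoC (INR (S n))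
  else if (m <=? n)%nat then - (bernoulli w (n - m) * poch (- RtoC (INR n)) (n - m))
  else 0.

(** The logarithm-free counterpart. The index [k = n - z] is unbounded, since [dpoch] need not
    vanish at [-n] for [k > n]. *)
Definition zeta_expansion_pow (w : C) (n : nat) (z : Z) : C :=
  if (z =? Z.of_nat (S n))%Z then - / (RtoC (INR (S n)) * RtoC (INR (S n)))
  else if (z <=? Z.of_nat n)%Z then
    bernoulli w (Z.to_nat (Z.of_nat n - z)) * dpoch (- RtoC (INR n)) (Z.to_nat (Z.of_nat n - z))
  else 0.

Definition zeta_expansion_const (L : C) (z : Z) : C := if (z =? 0)%Z then L else 0.

Definition zeta_remainder (w : C) (N m : nat) (s : C) : C :=
  hurwitz_zeta s w
  - Csum (fun k => Cpower (RtoC (INR k) + w) (- s)) m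
  - Cpower (RtoC (INR m)) (1 - s) * / (s - 1)
  - Csum (fun k => bernoulli w k * (poch s k * Cpower (RtoC (INR m)) (- (s + RtoC (INR k))))) N.

(** The remainder is [hurwitz_num - hurwitz_approx] divided by [s - 1]; its uniform smallness near
    [-n] passes to the derivative by Cauchy's estimate. *)
Lemma zeta_remainder_derive_bound (w : C) (n q : nat) :
  (0 < Re w)%R -> exists K, (0 <= K)%R /\ forall (m : nat) (l : C), (1 <= m)%nat ->
    is_C_derive (zeta_remainder w (S (S (n + q))) m) (- RtoC (INR n)) l ->
    (Cmod l <= K * (/ INR m) ^ S q)%R.
Proof.
  (* On the disk of radius 1/2 around [-n] this order gives [Re s + N + 1 >= q + 2], as the rate
     [q + 1] requires. *)
  intros Hw. set (N := S (S (n + q))). set (s0 := - RtoC (INR n)).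
  destruct (hurwitz_num_bound w N (INR n + 1) Hw) as [K [HK H]].
  exists (16 * K)%R. split; [lra|]. intros m l Hm Hl.
  assert (Hn := pos_INR n).
  assert (HRe : forall y, (Cmod (y - s0) < / 2)%R -> (- INR n - / 2 < Re y < - INR n + / 2)%R).
  { intros y Hy. assert (T := re_le_Cmod (y - s0)).
    change (Re (y - s0)) with (Re y - - INR n)%R in T.
    apply Rle_lt_trans with (1 := T) in Hy. apply Rabs_def2 in Hy. lra. }
  assert (Hne : forall y, (Cmod (y - s0) < / 2)%R -> y <> 1).
  { intros y Hy E. assert (T := HRe y Hy). rewrite E in T. simpl in T. lra. }
  (* Here [16 = 4 * 2 / (1/2)]: Cauchy's constant, the bound 2 for [1 / |y - 1|], and the radius. *)
  replace (16 * K * (/ INR m) ^ S q)%R with (4 * (2 * (K * (/ INR m) ^ S q)) / (/ 2))%R by (field;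
    apply not_0_INR; lia).
  apply (Cauchy_estimate (zeta_remainder w N m) s0); [lra| | |exact Hl].
  - intros y Hy.
    eexists. unfold zeta_remainder. apply is_C_derive_minus; [apply is_C_derive_minus; [apply is_C_derive_minus|]|].
    + apply hurwitz_zeta_is_derive; [exact Hw|now apply Hne].
    + apply (is_C_derive_Csum (fun k y => Cpower (RtoC (INR k) + w) (- y))
        (fun k y => - (1) * Clog (RtoC (INR k) + w) * Cpower (RtoC (INR k) + w) (- y))).
      intros k _. apply is_C_derive_Cpower, is_C_derive_opp, is_C_derive_id.
    + apply is_C_derive_mult.
      * apply is_C_derive_Cpower. apply is_C_derive_minus; [apply is_C_derive_const|apply is_C_derive_id].
      * apply (is_C_derive_comp Cinv (fun s => s - 1)).
        -- apply is_C_derive_inv. apply Cminus_eq_contra. now apply Hne.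
        -- apply is_C_derive_minus; [apply is_C_derive_id|apply is_C_derive_const].
    + apply hurwitz_sum_derive.
  - intros y Hy. assert (T := HRe y Hy).
    assert (Hy1 : y - 1 <> 0) by (apply Cminus_eq_contra; now apply Hne).
    replace (zeta_remainder w N m y) with ((hurwitz_num w y - hurwitz_approx w N m y) / (y - 1)).
    2:{ unfold zeta_remainder, hurwitz_approx. rewrite hurwitz_zeta_eq by (trivial; now apply Hne).
        field. exact Hy1. }
    rewrite Cmod_div by assumption.
    assert (Hd : (/ 2 <= Cmod (y - 1))%R).
    { eapply Rle_trans; [|apply re_le_Cmod]. change (Re (y - 1)) with (Re y - 1)%R.
      rewrite Rabs_left; lra. }
    apply Rle_div_l; [lra|].
    assert (B : (Cmod (hurwitz_num w y - hurwitz_approx w N m y) <= K * (/ INR m) ^ S q)%R).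
    { apply H; [assumption| |].
      - replace y with ((y - s0) + s0) by ring. eapply Rle_trans; [apply Cmod_triangle|].
        unfold s0 at 2. rewrite Cmod_opp, Cmod_R, Rabs_pos_eq by assumption. lra.
      - unfold N. rewrite !S_INR, plus_INR. lra. }
    assert (0 <= K * (/ INR m) ^ S q)%R by (eapply Rle_trans; [apply Cmod_ge_0|exact B]). nra.
Qed.

(** At [s = -n] all complex powers become integer powers, and differentiating [(k + w)^(-s)]
    produces the summands of [reg_log_sum], with a minus sign that the remainder reverses. *)
Lemma zeta_remainder_derive (w : C) (n N m : nat) :
  (0 < Re w)%R -> (1 <= m)%nat ->
  let x := INR m in
  let X := fun z : Z => RtoC (powerRZ x z) in
  is_C_derive (zeta_remainder w N m) (- RtoC (INR n))
    (C_derive (fun s => hurwitz_zeta s w) (- RtoC (INR n))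
     + Csum (fun k => (RtoC (INR k) + w) ^ n * Clog (RtoC (INR k) + w)) m
     - (/ RtoC (INR (S n)) * RtoC (ln x) * X (Z.of_nat (S n))
        - / (RtoC (INR (S n)) * RtoC (INR (S n))) * X (Z.of_nat (S n)))
     - Csum (fun k => bernoulli w k * ((dpoch (- RtoC (INR n)) k - poch (- RtoC (INR n)) k * RtoC (ln x))
          * X (Z.of_nat n - Z.of_nat k)%Z)) N).
Proof.
  intros Hw Hm x X. set (s0 := - RtoC (INR n)).
  assert (Hx : (0 < x)%R) by (apply lt_0_INR; lia).
  assert (Hn := pos_INR n).
  assert (HS := RtoC_S_neq_0 n).
  assert (Es : s0 - 1 = - RtoC (INR (S n))) by (unfold s0; rewrite S_INR, RtoC_plus; ring).
  assert (Hne : s0 - 1 <> 0).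
  { rewrite Es. intros E. apply HS.
    replace (RtoC (INR (S n))) with (- - RtoC (INR (S n))) by ring. rewrite E. ring. }
  assert (E1 : forall k, - (1) * Clog (RtoC (INR k) + w) * Cpower (RtoC (INR k) + w) (- s0) =
    - (1) * ((RtoC (INR k) + w) ^ n * Clog (RtoC (INR k) + w))).
  { intros k. unfold s0. replace (- - RtoC (INR n)) with (RtoC (INR n)) by ring.
    rewrite Cpower_INR; [ring|]. intros E.
    assert (T : (0 < Re (RtoC (INR k) + w))%R) by (rewrite re_plus, re_RtoC; assert (T := pos_INR k); lra).
    rewrite E in T. simpl in T. lra. }
  assert (E2 : Cpower (RtoC x) (1 - s0) = X (Z.of_nat (S n))).
  { unfold X. rewrite <- Cpower_powerRZ by assumption. f_equal. rewrite <- INR_IZR_INZ.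
    unfold s0. rewrite S_INR, RtoC_plus. ring. }
  assert (E3 : forall k, Cpower (RtoC x) (- (s0 + RtoC (INR k))) = X (Z.of_nat n - Z.of_nat k)%Z).
  { intros k. unfold X. rewrite <- Cpower_powerRZ by assumption. f_equal.
    rewrite minus_IZR, <- !INR_IZR_INZ, RtoC_minus. unfold s0. ring. }
  eapply C_derive_eq.
  2:{ unfold zeta_remainder. apply is_C_derive_minus; [apply is_C_derive_minus; [apply is_C_derive_minus|]|].
    - apply hurwitz_zeta_is_derive; [exact Hw|]. intros E. apply Hne. fold s0 in E. rewrite E. ring.
    - apply (is_C_derive_Csum (fun k y => Cpower (RtoC (INR k) + w) (- y))
        (fun k y => - (1) * Clog (RtoC (INR k) + w) * Cpower (RtoC (INR k) + w) (- y))).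
      intros k _. apply is_C_derive_Cpower, is_C_derive_opp, is_C_derive_id.
    - apply is_C_derive_mult.
      + apply is_C_derive_Cpower. apply is_C_derive_minus; [apply is_C_derive_const|apply is_C_derive_id].
      + apply (is_C_derive_comp Cinv (fun s => s - 1)).
        * apply is_C_derive_inv. exact Hne.
        * apply is_C_derive_minus; [apply is_C_derive_id|apply is_C_derive_const].
    - apply hurwitz_sum_derive. }
  cbv beta. fold s0. fold x.
  rewrite (Csum_ext (fun k => - (1) * Clog (RtoC (INR k) + w) * Cpower (RtoC (INR k) + w) (- s0)) _ m
    (fun k _ => E1 k)), Csum_scal, E2, Clog_RtoC by assumption.
  rewrite (Csum_ext (fun k => bernoulli w k * (dpoch s0 k * Cpower (RtoC x) (- (s0 + RtoC (INR k)))
           + poch s0 k * (- RtoC (ln x) * Cpower (RtoC x) (- (s0 + RtoC (INR k))))))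
    (fun k => bernoulli w k * ((dpoch s0 k - poch s0 k * RtoC (ln x)) * X (Z.of_nat n - Z.of_nat k)%Z))).
  - rewrite Es. field. exact HS.
  - intros k _. rewrite E3. ring.
Qed.

(** The order [N] is free above [n] because the further terms vanish; reversing the sum matches the
    index [k] with the degree [n - k]. *)
Lemma zeta_expansion_log_sum (w : C) (n N m : nat) :
  (1 <= m)%nat -> (n < N)%nat ->
  Csum (fun j => zeta_expansion_log w n j * RtoC (INR m ^ j * ln (INR m))) (S (S n)) =
  / RtoC (INR (S n)) * RtoC (ln (INR m)) * RtoC (powerRZ (INR m) (Z.of_nat (S n)))
  - Csum (fun k => bernoulli w k * (poch (- RtoC (INR n)) k * RtoC (ln (INR m))
      * RtoC (powerRZ (INR m) (Z.of_nat n - Z.of_nat k)))) N.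
Proof.
  intros Hm HN.
  rewrite (Csum_pad _ (S n) N).
  2:{ lia. }
  2:{ intros k Hk. rewrite poch_opp_INR_eq_0 by lia. ring. }
  change (Csum (fun j => zeta_expansion_log w n j * RtoC (INR m ^ j * ln (INR m))) (S (S n))) with
    (Csum (fun j => zeta_expansion_log w n j * RtoC (INR m ^ j * ln (INR m))) (S n)
     + zeta_expansion_log w n (S n) * RtoC (INR m ^ S n * ln (INR m))).
  unfold zeta_expansion_log at 2. rewrite Nat.eqb_refl, RtoC_mult, <- pow_powerRZ.
  rewrite (Csum_rev (fun k => bernoulli w k * _)).
  rewrite (Csum_ext (fun j => zeta_expansion_log w n j * RtoC (INR m ^ j * ln (INR m)))
    (fun j => - (1) * (bernoulli w (S n - S j) * (poch (- RtoC (INR n)) (S n - S j) * RtoC (ln (INR m))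
      * RtoC (powerRZ (INR m) (Z.of_nat n - Z.of_nat (S n - S j))))))).
  - rewrite Csum_scal. ring.
  - intros j Hj. unfold zeta_expansion_log.
    replace (j =? S n)%nat with false by (symmetry; apply Nat.eqb_neq; lia).
    replace (j <=? n)%nat with true by (symmetry; apply Nat.leb_le; lia).
    replace (Z.of_nat n - Z.of_nat (S n - S j))%Z with (Z.of_nat j) by lia.
    rewrite <- pow_powerRZ, RtoC_mult. simpl Nat.sub. ring.
Qed.

Lemma zeta_expansion_pow_sum (w : C) (n q m : nat) :
  Csum (fun j => zeta_expansion_pow w n (Z.of_nat j - Z.of_nat q) *
     RtoC (powerRZ (INR m) (Z.of_nat j - Z.of_nat q))) (S (S n + q)) =
  - / (RtoC (INR (S n)) * RtoC (INR (S n))) * RtoC (powerRZ (INR m) (Z.of_nat (S n)))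
  + Csum (fun k => bernoulli w k * (dpoch (- RtoC (INR n)) k
      * RtoC (powerRZ (INR m) (Z.of_nat n - Z.of_nat k)))) (S n + q).
Proof.
  rewrite Csum_rev, Csum_S_l. f_equal.
  - replace (Z.of_nat (S (S n + q) - 1) - Z.of_nat q)%Z with (Z.of_nat (S n)) by lia.
    unfold zeta_expansion_pow. now rewrite Z.eqb_refl.
  - apply Csum_ext. intros k Hk.
    replace (Z.of_nat (S (S n + q) - S (S k)) - Z.of_nat q)%Z with (Z.of_nat n - Z.of_nat k)%Z by lia.
    unfold zeta_expansion_pow.
    replace (Z.of_nat n - Z.of_nat k =? Z.of_nat (S n))%Z with false by (symmetry; apply Z.eqb_neq; lia).
    replace (Z.of_nat n - Z.of_nat k <=? Z.of_nat n)%Z with true by (symmetry; apply Z.leb_le; lia).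
    replace (Z.to_nat (Z.of_nat n - (Z.of_nat n - Z.of_nat k))) with k by lia. ring.
Qed.

Lemma zeta_expansion_const_sum (L : C) (q n m : nat) :
  Csum (fun j => zeta_expansion_const L (Z.of_nat j - Z.of_nat q) *
     RtoC (powerRZ (INR m) (Z.of_nat j - Z.of_nat q))) (S (n + q)) = L.
Proof.
  rewrite (Csum_ext _ (fun j => if (j =? q)%nat then L else 0)).
  - rewrite (Csum_delta (fun _ => L)); [reflexivity|lia].
  - intros j _. unfold zeta_expansion_const.
    destruct (Nat.eqb_spec j q) as [->|Hjq].
    + rewrite Z.sub_diag. simpl. ring.
    + replace (Z.of_nat j - Z.of_nat q =? 0)%Z with false by (symmetry; apply Z.eqb_neq; lia). ring.
Qed.

Lemma log_sum_expansion (w : C) (n : nat) :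
  (0 < Re w)%R ->
  log_power_expansion
    (Csum (fun k => (RtoC (INR k) + w) ^ n * Clog (RtoC (INR k) + w)))
    (zeta_expansion_log w n)
    (fun z => zeta_expansion_pow w n z
       - zeta_expansion_const (C_derive (fun s => hurwitz_zeta s w) (- RtoC (INR n))) z).
Proof.
  intros Hw. set (L := C_derive (fun s => hurwitz_zeta s w) (- RtoC (INR n))).
  exists (S n). repeat split.
  - intros m Hm. unfold zeta_expansion_log.
    replace (m =? S n)%nat with false by (symmetry; apply Nat.eqb_neq; lia).
    replace (m <=? n)%nat with false by (symmetry; apply Nat.leb_gt; lia). reflexivity.
  - intros z Hz. unfold zeta_expansion_pow, zeta_expansion_const.
    replace (z =? Z.of_nat (S n))%Z with false by (symmetry; apply Z.eqb_neq; lia).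
    replace (z <=? Z.of_nat n)%Z with false by (symmetry; apply Z.leb_gt; lia).
    replace (z =? 0)%Z with false by (symmetry; apply Z.eqb_neq; lia). ring.
  - intros q.
    destruct (zeta_remainder_derive_bound w n q Hw) as [K [HK HB]].
    (* The remainder bound needs the terms [k < N], while degrees down to [-q] only use [k < k0].
       The one extra term has degree [-q-1] and no logarithm; [E] is its coefficient's modulus, and
       [m^q] times the total error is at most [(K + E) / m]. *)
    set (N := S (S (n + q))) in *. set (k0 := S (n + q)).
    set (E := Cmod (bernoulli w k0 * dpoch (- RtoC (INR n)) k0)).
    apply (C_lim_seq_le _ _ (fun m => ((K + E) * / INR m)%R) 1).
    { replace (Finite 0) with (Rbar_mult (K + E)%R 0) by (simpl; f_equal; ring).
      apply is_lim_seq_scal_l, is_lim_seq_inv_INR. }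
    intros m Hm.
    assert (Hx : (0 < INR m)%R) by (apply lt_0_INR; lia).
    rewrite (sum_n_Csum (fun j => zeta_expansion_log w n j * RtoC (INR m ^ j * ln (INR m)))).
    rewrite (sum_n_Csum (fun j => let z := (Z.of_nat j - Z.of_nat q)%Z in
      (zeta_expansion_pow w n z - zeta_expansion_const L z) * RtoC (powerRZ (INR m) z))).
    rewrite (Csum_ext (fun j => let z := (Z.of_nat j - Z.of_nat q)%Z in
      (zeta_expansion_pow w n z - zeta_expansion_const L z) * RtoC (powerRZ (INR m) z))
      (fun j => zeta_expansion_pow w n (Z.of_nat j - Z.of_nat q) *
          RtoC (powerRZ (INR m) (Z.of_nat j - Z.of_nat q))
        - zeta_expansion_const L (Z.of_nat j - Z.of_nat q) *
          RtoC (powerRZ (INR m) (Z.of_nat j - Z.of_nat q)))) by (intros; cbv zeta; ring).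
    rewrite Csum_minus, zeta_expansion_const_sum, zeta_expansion_pow_sum.
    rewrite (zeta_expansion_log_sum w n N) by (unfold N; lia).
    assert (HD := zeta_remainder_derive w n N m Hw Hm). cbv zeta in HD. fold L in HD.
    assert (HB' := HB m _ Hm HD).
    match type of HD with is_C_derive _ _ ?g => set (G := g) in * end.
    set (X := fun z : Z => RtoC (powerRZ (INR m) z)) in *.
    assert (EX : X (Z.of_nat n - Z.of_nat k0)%Z = RtoC ((/ INR m) ^ S q)).
    { unfold X, k0. replace (Z.of_nat n - Z.of_nat (S (n + q)))%Z with (- Z.of_nat (S q))%Z by lia.
      rewrite powerRZ_neg', <- pow_powerRZ, pow_inv. reflexivity. }
    match goal with |- (Cmod (RtoC (INR m ^ q) * ?A - _) <= _)%R =>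
      replace A with (G + bernoulli w k0 * dpoch (- RtoC (INR n)) k0 * RtoC ((/ INR m) ^ S q)) end.
    + match goal with |- (Cmod ?B <= _)%R => replace B with (RtoC (INR m ^ q) *
        (G + bernoulli w k0 * dpoch (- RtoC (INR n)) k0 * RtoC ((/ INR m) ^ S q))) by ring end.
      assert (Hi : (0 <= (/ INR m) ^ S q)%R) by (apply pow_le, Rlt_le, Rinv_0_lt_compat; lra).
      rewrite Cmod_mult, Cmod_R, Rabs_pos_eq by (apply pow_le; lra).
      replace ((K + E) * / INR m)%R with (INR m ^ q * ((K + E) * (/ INR m) ^ S q))%R.
      * apply Rmult_le_compat_l; [apply pow_le; lra|].
        eapply Rle_trans; [apply Cmod_triangle|].
        rewrite (Cmod_mult (_ * _)), Cmod_R, Rabs_pos_eq by assumption. fold E. lra.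
      * assert (T : (INR m ^ q * (/ INR m) ^ q = 1)%R).
        { rewrite <- Rpow_mult_distr, Rinv_r by lra. apply pow1. }
        simpl. replace (INR m ^ q * ((K + E) * (/ INR m * (/ INR m) ^ q)))%R with
          ((K + E) * / INR m * (INR m ^ q * (/ INR m) ^ q))%R by ring.
        rewrite T. ring.
    + rewrite <- EX. unfold G.
      rewrite (Csum_ext (fun k => bernoulli w k * ((dpoch (- RtoC (INR n)) k
          - poch (- RtoC (INR n)) k * RtoC (ln (INR m))) * X (Z.of_nat n - Z.of_nat k)%Z))
        (fun k => bernoulli w k * (dpoch (- RtoC (INR n)) k * X (Z.of_nat n - Z.of_nat k)%Z)
          - bernoulli w k * (poch (- RtoC (INR n)) k * RtoC (ln (INR m)) * X (Z.of_nat n - Z.of_nat k)%Z)))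
        by (intros; ring).
      rewrite Csum_minus.
      change (Csum (fun k => bernoulli w k * (dpoch (- RtoC (INR n)) k * X (Z.of_nat n - Z.of_nat k)%Z)) N)
        with (Csum (fun k => bernoulli w k * (dpoch (- RtoC (INR n)) k * X (Z.of_nat n - Z.of_nat k)%Z)) k0
          + bernoulli w k0 * (dpoch (- RtoC (INR n)) k0 * X (Z.of_nat n - Z.of_nat k0)%Z)).
      change (S n + q)%nat with k0. fold (X (Z.of_nat (S n))).
      change (fun k => bernoulli w k * (dpoch (- RtoC (INR n)) k * RtoC (powerRZ (INR m) (Z.of_nat n - Z.of_nat k))))
        with (fun k => bernoulli w k * (dpoch (- RtoC (INR n)) k * X (Z.of_nat n - Z.of_nat k)%Z)).
      change (fun k => bernoulli w k * (poch (- RtoC (INR n)) k * RtoC (ln (INR m)) * RtoC (powerRZ (INR m) (Z.of_nat n - Z.of_nat k))))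
        with (fun k => bernoulli w k * (poch (- RtoC (INR n)) k * RtoC (ln (INR m)) * X (Z.of_nat n - Z.of_nat k)%Z)).
      ring.
Qed.

Theorem theorem1p4 (n : nat) (w : C) (hw : (0 < Re w)%R) :
  reg_log_sum n w =
    - C_derive (fun s : C => hurwitz_zeta s w) (- RtoC (INR n))
    + (- RtoC 1) ^ (n + 1) * RtoC (INR (fact n)) * modified_bernoulli n w
      * RtoC (harmonic n).
Proof.
  (* Degree 0 is the index [k = n], and [dpoch] at [-n] with that index supplies the factorial, the
     sign and the harmonic number. *)
  unfold reg_log_sum. rewrite (constant_term_eq _ _ _ (log_sum_expansion w n hw)), modified_bernoulli_eq.
  unfold zeta_expansion_pow, zeta_expansion_const.
  replace (0 =? Z.of_nat (S n))%Z with false by (symmetry; apply Z.eqb_neq; lia).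
  replace (0 <=? Z.of_nat n)%Z with true by (symmetry; apply Z.leb_le; lia).
  rewrite Z.sub_0_r, Nat2Z.id, dpoch_opp_INR. simpl Z.eqb. cbv iota. ring.
Qed.
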